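(* Let $(\mu,\chi,u)$, with $\mu=(\mu_t)_{t\in(0,T_* )}$, be a varifold solution on $(0,T_* )$ of the regularized visco-elastic Mullins–Sekerka system with initial data $(\chi_0,u_0)$ (in the sense defined in the context). Then for almost all $0\le s\le T\le T_*$ $$\begin{aligned}\mathcal{F}(\mu,\chi,u)(T)+\frac12\int_s^T\Big[&\|\partial_t\chi\|_{H^{-1}_{(0)}}^2+\|\partial_tu\|_{H^1_{\chi(t)}}^2+\delta\mathcal{F}(\mu,\chi,u)[B,z]\\&-\frac12\|B\cdot\nabla\chi\|_{H^{-1}_{(0)}}^2-\frac12\|z-\nabla u\,B\|_{H^1_{\chi(t)}}^2\Big]dt\le\mathcal{F}(\mu,\chi,u)(s)\le\mathcal{F}(\chi_0,u_0)\end{aligned}$$ for all measurable maps $z:(0,T_* )\to H^2(\Omega;\mathbb{R}^d)$ with $z(t)\in H^1_\perp(\Omega)$ for all $t\in(0,T_* )$ and $\|z\|_{H^2(\Omega)}\in L^2(0,T_* )$, and all measurable functions $B:(0,T_* )\to C^2(\overline\Omega;\mathbb{R}^d)$ with $B(t)\in\mathcal{S}_{\chi(t)}$ for all $t\in(0,T_* )$ and $\|B\|_{C^2}\in L^2(0,T_* )$. Moreover, for almost all $0\le s\le T\le T_*$, $$\begin{aligned}\mathcal{F}(\mu,\chi,u)(T)&+\frac12\int_s^T\|\partial_t\chi\|_{H^{-1}_{(0)}}^2+\|\partial_tu\|_{H^1_{\chi(t)}}^2\,dt\\&+\frac12\int_s^T\sup_{\substack{B\in\mathcal{S}_{\chi(t,\cdot)}\\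 z\in H^1_\perp(\Omega)\cap H^2(\Omega;\mathbb{R}^d)}}\Big\{\delta\mathcal{F}(\mu,\chi,u)[B,z]-\frac12\|B\cdot\nabla\chi\|_{H^{-1}_{(0)}}^2-\frac12\|z-\nabla u\,B\|_{H^1_{\chi(t)}}^2\Big\}dt\\&\le\mathcal{F}(\mu,\chi,u)(s)\le\mathcal{F}(\chi_0,u_0).\end{aligned}$$
   Context: Setting. $\Omega\subset\mathbb{R}^d$, $d\in\{2,3\}$, is a bounded smooth domain, $n_{\partial\Omega}$ its inner unit normal on $\partial\Omega$; $T_*>0$, $c_0>0$, $\alpha\in(0,\tfrac\pi2]$ are fixed; $\chi_0\in BV(\Omega;\{0,1\})$ with $0<\int_\Omega\chi_0\,dx<|\Omega|$, $u_0\in H^1_\perp(\Omega)\cap H^2(\Omega;\mathbb{R}^d)$. Conventions: $(\nabla u)_{ij}=\partial_ju_i$, $(\nabla^2u)_{ijk}=\partial_j\partial_ku_i$, $(\nabla^2u\,B)_{ij}=(\nabla^2u)_{ijk}B_k$; repeated indices are summed; '':'' is full contraction; $\mathcal{E}(u)=\tfrac12(\nabla u+(\nabla u)^T)$. Elastic data: for $y\in\mathbb{R}$, $\mathbb{C}(y),\mathbb{C}_\nu(y)$ are symmetric linear endomorphisms of $\mathbb{R}^{d\times d}_{sym}$, uniformly positive ($\mathbb{C}(y)E':E'\ge c|E'|^2$, likewise $\mathbb{C}_\nu$, with $c>0$ independent of $y$); $\mathcal{T}(y)\in\mathbb{R}^{d\times d}_{sym}$; $W(\chi,E')=\tfrac12\mathbb{C}(\chi)(E'-\mathcal{T}(\chi)):(E'-\mathcal{T}(\chi))$,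 $W_{,\mathcal{E}}(\chi,E')=\mathbb{C}(\chi)(E'-\mathcal{T}(\chi))$. Spaces: $H^1_\perp(\Omega)$ is the $H^1$-orthogonal complement of $\{u\in H^1(\Omega;\mathbb{R}^d):\mathcal{E}(u)=0\}$; $H^1_{(0)}(\Omega)$ are the mean-zero $H^1$ functions, $H^{-1}_{(0)}(\Omega)$ its dual with norm $\|f\|_{H^{-1}_{(0)}}=\|\nabla(-\Delta_N)^{-1}f\|_{L^2}$, where $\langle-\Delta_Nv,\xi\rangle=\int\nabla v\cdot\nabla\xi$; $\|z\|_{H^1_\chi}^2=\int_\Omega\mathbb{C}_\nu(\chi)\mathcal{E}(z):\mathcal{E}(z)\,dx$ for $z\in H^1(\Omega;\mathbb{R}^d)$ (a seminorm); $L^\infty_{w^*}$ means essentially bounded and weak-* measurable. $M(X)$: finite Radon measures; an oriented varifold on $\overline\Omega$ is a positive $V\in M(\overline\Omega\times\mathbb{S}^{d-1})$ with mass measure $|V|(U)=V(U\times\mathbb{S}^{d-1})$; measures on $\partial\Omega\times\mathbb{S}^{d-1}$ are extended by zero; $\sigma\otimes(\omega_x)$ is the measure $f\mapsto\iint f(x,s)\,d\omega_x(s)\,d\sigma(x)$. Test fields: for $\chi\in BV(\Omega;\{0,1\})$, $\mathcal{S}_\chi=\{B\in C^2(\overline\Omega;\mathbb{R}^d):\int_\Omega\chi\,\nabla\cdot B\,dx=0,\ B\cdot n_{\partial\Omega}=0\text{ on }\partial\Omega\}$; for $B\in\mathcal{S}_\chi$, $B\cdot\nabla\chi\in H^{-1}_{(0)}(\Omega)$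 is defined by $\langle B\cdot\nabla\chi,\xi\rangle=-\int_\Omega\chi\,\mathrm{div}(\xi B)\,dx$, $\xi\in H^1_{(0)}(\Omega)$. Energies: $\mathcal{F}(\mu,\chi,u)(t)=|\mu_t|(\overline\Omega)+\int_\Omega W(\chi,\mathcal{E}(u))(t)\,dx+\int_\Omega\tfrac12|\nabla^2u|^2(t)\,dx$, and $\mathcal{F}(\chi_0,u_0)=c_0|\nabla\chi_0|(\Omega)+\int_{\partial\Omega}c_0(\cos\alpha)\chi_0\,d\mathcal{H}^{d-1}+\int_\Omega W(\chi_0,\mathcal{E}(u_0))+\int_\Omega\tfrac12|\nabla^2u_0|^2$. First variation (at each fixed time $t$, with $\mu=\mu_t$, $\chi=\chi(t)$, $u=u(t)$): $$\begin{aligned}\delta\mathcal{F}(\mu,\chi,u)[B,z]=&\int_{\overline\Omega\times\mathbb{S}^{d-1}}(I-s\otimes s):\nabla B\,d\mu(x,s)+\int_\Omega\big[W(\chi,\mathcal{E}(u))I-(\nabla u)^TW_{,\mathcal{E}}(\chi,\mathcal{E}(u))\big]:\nabla B\,dx\\&+\int_\Omega\tfrac12|\nabla^2u|^2\mathrm{div}B\,dx-\int_\Omega(\nabla^2u)_{ijk}(\nabla u)_{ip}(\nabla^2B)_{pjk}\,dx\\&-\int_\Omega(\nabla^2u)_{ijk}(\nabla^2u)_{ipk}(\nabla B)_{jp}\,dx-\int_\Omega(\nabla^2u)_{ijk}(\nabla^2u)_{ijp}(\nabla B)_{kp}\,dx\\&+\int_\Omega W_{,\mathcal{E}}(\chi,\mathcal{E}(u)):\nabla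 z\,dx+\int_\Omega\nabla^2u:\nabla^2z\,dx.\end{aligned}$$ Varifold solution: a measurable $\chi:(0,T_* )\times\Omega\to\{0,1\}$, a family $(\mu_t)_{t\in(0,T_* )}$ of oriented varifolds on $\overline\Omega$, and $u:(0,T_* )\times\Omega\to\mathbb{R}^d$ such that: (1) $\chi\in L^\infty_{w^*}(0,T_*;BV(\Omega;\{0,1\}))\cap H^1(0,T_*;H^{-1}_{(0)}(\Omega))$, $u\in H^1(0,T_*;H^1_\perp(\Omega))\cap L^\infty(0,T_*;H^2(\Omega;\mathbb{R}^d))$. (2) $\chi(0)=\chi_0$ in $H^{-1}_{(0)}(\Omega)$, $u(0)=u_0$ in $H^1_\perp(\Omega)$. (3) For a.e. $t$: $\mu_t=c_0\mu_t^\Omega+c_0(\cos\alpha)\mu_t^{\partial\Omega}$ with $\mu_t^\Omega=|\mu_t^\Omega|\otimes(\mu^\Omega_{t,x})_{x\in\overline\Omega}\in M(\overline\Omega\times\mathbb{S}^{d-1})$, $\mu_t^{\partial\Omega}=|\mu_t^{\partial\Omega}|\otimes(\delta_{n_{\partial\Omega}(x)})_{x\in\partial\Omega}\in M(\partial\Omega\times\mathbb{S}^{d-1})$ oriented varifolds, $\mu^\Omega_{t,x}$ probability measures on $\mathbb{S}^{d-1}$ for $|\mu_t^\Omega|$-a.e. $x$, and $|\mu_t^{\partial\Omega}|=g(t,\cdot)\mathcal{H}^{d-1}\llcorner\partial\Omega$ with $g\in L^\infty((0,T_* )\times\partial\Omega;[0,1])$. (4) For a.e. $t$: $\int_{\overline\Omega\times\mathbb{S}^{d-1}}\eta\cdot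 s\,d\mu_t^\Omega=\int_\Omega\eta\cdot d\nabla\chi(t)$ for all $\eta\in C^1(\overline\Omega;\mathbb{R}^d)$ with $\eta\cdot n_{\partial\Omega}=0$ on $\partial\Omega$; $-\int s\cdot\xi\,d\mu_t^\Omega=-\int_\Omega\xi\cdot d\nabla\chi(t)+(\cos\alpha)(|\mu_t^{\partial\Omega}|(\partial\Omega)-\int_{\partial\Omega}\chi(t)\,d\mathcal{H}^{d-1})$ for all $\xi\in C^1(\overline\Omega;\mathbb{R}^d)$ with $\xi\cdot n_{\partial\Omega}=\cos\alpha$ on $\partial\Omega$; and $(\cos\alpha)\chi(t)\mathcal{H}^{d-1}\llcorner\partial\Omega\le\cos\alpha(|\mu_t^\Omega|\llcorner\partial\Omega+|\mu_t^{\partial\Omega}|)$. (5) There is $w\in L^2(0,T_*;H^1(\Omega))$ such that for a.e. $t$ and all $B\in C^2(\overline\Omega;\mathbb{R}^d)$ with $B\cdot n_{\partial\Omega}=0$ on $\partial\Omega$: $\int_{\overline\Omega\times\mathbb{S}^{d-1}}(I-s\otimes s):\nabla B\,d\mu_t=\int_\Omega\chi\,\mathrm{div}(wB)+\int_\Omega\mathbb{C}_\nu(\chi)\mathcal{E}(\partial_tu):\nabla^2u\,B-\int_\Omega\tfrac12|\nabla^2u|^2\mathrm{div}B-\int_\Omega[W(\chi,\mathcal{E}(u))I-(\nabla u)^T(\mathbb{C}_\nu(\chi)\mathcal{E}(\partial_tu)+W_{,\mathcal{E}}(\chi,\mathcal{E}(u)))]:\nabla B+\int_\Omega(\nabla^2u)_{ijk}(\nabla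 u)_{ip}(\nabla^2B)_{pjk}+\int_\Omega(\nabla^2u)_{ijk}((\nabla^2u)_{ipk}(\nabla B)_{jp}+(\nabla^2u)_{ijp}(\nabla B)_{kp})$. (6) $v=-(-\Delta_N)^{-1}\partial_t\chi\in L^2(0,T_*;H^1_{(0)}(\Omega))$ satisfies $\int_0^{T_*}\int_\Omega\chi\,\partial_t\zeta-\int_0^{T_*}\int_\Omega\nabla v\cdot\nabla\zeta=-\int_\Omega\chi_0\zeta(0)$ for all $\zeta\in C^1_c([0,T_* )\times\Omega)\cap H^1(0,T_*;H^1_{(0)}(\Omega))$, and $\int_\Omega\chi(t)=\int_\Omega\chi_0$ for a.e. $t$. (7) $\int_0^{T_*}\int_\Omega[\mathbb{C}_\nu(\chi)\mathcal{E}(\partial_tu)+W_{,\mathcal{E}}(\chi,\mathcal{E}(u))]:\mathcal{E}(z)+\nabla^2u:\nabla^2z\,dx\,dt=0$ for all $z\in L^2(0,T_*;H^2(\Omega;\mathbb{R}^d))$. (8) For a.e. $0\le s\le T\le T_*$: $\mathcal{F}(\mu,\chi,u)(T)+\frac12\int_s^T\|\partial_t\chi\|^2_{H^{-1}_{(0)}}+\|\partial_tu\|^2_{H^1_{\chi(t)}}dt+\frac12\int_s^T\|\nabla w\|_{L^2}^2+\|\partial_tu\|^2_{H^1_{\chi(t)}}dt\le\mathcal{F}(\mu,\chi,u)(s)\le\mathcal{F}(\chi_0,u_0)$. (9) $t\mapsto|\mu_t|(\overline\Omega)$ is measurable. *)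

(* Defs.v *)
From HB Require Import structures.
From mathcomp Require Import all_boot all_order all_algebra.
From mathcomp Require Import all_classical all_reals all_analysis.
Set Implicit Arguments.
Unset Strict Implicit.
Unset Printing Implicit Defensive.
Import Order.TTheory GRing.Theory Num.Theory.
Import numFieldNormedType.Exports.
Local Open Scope classical_set_scope.
Local Open Scope ring_scope.

Definition rV_display : measure_display.
Proof. exact: default_measure_display. Qed.

Section rV_measurable.
Context (R : realType) (d : nat).

Definition rV_coord (i : 'I_d) (x : 'rV[R]_d) : measurableTypeR R := x ord0 i.

Let rV_set0 : g_sigma_preimage rV_coord set0.
Proof. exact: sigma_algebra0. Qed.

Let rV_setC A : g_sigma_preimage rV_coord A -> g_sigma_preimage rV_coord (~` A).
Proof. exact: sigma_algebraC. Qed.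

Let rV_bigcup (F : (set 'rV[R]_d)^nat) :
  (forall i, g_sigma_preimage rV_coord (F i)) ->
  g_sigma_preimage rV_coord (\bigcup_i F i).
Proof. exact: sigma_algebra_bigcup. Qed.

(** The sigma-algebra generated by the coordinates, i.e. the Borel
    sigma-algebra of R^d. *)
HB.instance Definition _ := @isMeasurable.Build rV_display 'rV[R]_d
  (g_sigma_preimage rV_coord) rV_set0 rV_setC rV_bigcup.

Lemma measurable_rV_coord (i : 'I_d) :
  measurable_fun [set: 'rV[R]_d] (rV_coord i).
Proof.
move=> _ Y mY; rewrite setTI; apply: sub_sigma_algebra => /=.
rewrite -bigcup_seq/=; exists i => /=; first by rewrite mem_index_enum.
by exists Y => //; rewrite setTI.
Qed.

Lemma measurable_fun_rVP d1 (T1 : measurableType d1) (f : T1 -> 'rV[R]_d) :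
  (forall i, measurable_fun [set: T1] (rV_coord i \o f)) ->
  measurable_fun [set: T1] f.
Proof.
move=> mf _ A mA; rewrite setTI.
suff: g_sigma_preimage (fun i => rV_coord i \o f) `<=` measurable.
  by apply; rewrite g_sigma_preimage_comp; exists A => //; rewrite setTI.
apply: smallest_sub; first exact: sigma_algebra_measurable.
rewrite -bigcup_seq; apply: bigcup_sub => i _.
by move=> _ [B mB <-]; exact: mf.
Qed.

End rV_measurable.

Section lebesgue_rV.
Context (R : realType).

Definition rV_cons d (p : measurableTypeR R * 'rV[R]_d) : 'rV[R]_d.+1 :=
  \row_i oapp (fun j => p.2 ord0 j) p.1 (unlift ord0 i).

Definition rV_uncons d (v : 'rV[R]_d.+1) : measurableTypeR R * 'rV[R]_d :=
  (v ord0 ord0, \row_j v ord0 (lift ord0 j)).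

Lemma measurable_rV_cons d : measurable_fun setT (@rV_cons d).
Proof.
apply: measurable_fun_rVP => i; case: (unliftP ord0 i) => [j|] ->.
- rewrite (_ : _ \o _ = rV_coord j \o snd); last first.
    by apply/funext => -[a v]; rewrite /rV_coord /= mxE liftK.
  by apply: measurableT_comp => //; exact: measurable_rV_coord.
- rewrite (_ : _ \o _ = fst)//.
  by apply/funext => -[a v]; rewrite /rV_coord /= mxE unlift_none.
Qed.

Lemma measurable_rV_uncons d : measurable_fun setT (@rV_uncons d).
Proof.
apply: measurable_fun_pair; first exact: (measurable_rV_coord ord0).
apply: measurable_fun_rVP => i.
rewrite (_ : _ \o _ = rV_coord (lift ord0 i)); first exact: measurable_rV_coord.
by apply/funext => v; rewrite /rV_coord /= mxE.
Qed.

Lemma rV_consK d : cancel (@rV_cons d) (@rV_uncons d).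
Proof.
move=> [a v]; rewrite /rV_uncons /rV_cons /=; congr pair.
  by rewrite mxE unlift_none.
by apply/rowP => j; rewrite !mxE liftK.
Qed.

Section lebesgue_rV_step.
Context d (m : {sigma_finite_measure set 'rV[R]_d -> \bar R}).
Local Open Scope ereal_scope.

Definition lebesgue_rV_step : set 'rV[R]_d.+1 -> \bar R :=
  pushforward (lebesgue_measure \x m) (@rV_cons d).

Let preim_meas (A : set 'rV[R]_d.+1) :
  measurable A -> measurable (@rV_cons d @^-1` A).
Proof. by move=> mA; rewrite -[X in measurable X]setTI; exact: measurable_rV_cons. Qed.

Let step0 : lebesgue_rV_step set0 = 0.
Proof. by rewrite /lebesgue_rV_step /pushforward preimage_set0 measure0. Qed.

Let step_ge0 A : 0 <= lebesgue_rV_step A.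
Proof. exact: (measure_ge0 (lebesgue_measure \x m)%E). Qed.

Let step_sigma_additive : semi_sigma_additive lebesgue_rV_step.
Proof.
move=> F mF tF mUF; rewrite /lebesgue_rV_step /pushforward preimage_bigcup.
apply: measure_semi_sigma_additive.
- by move=> n; exact: preim_meas.
- apply/trivIsetP => /= i j _ _ ij; rewrite -preimage_setI.
  by move/trivIsetP : tF => /(_ _ _ _ _ ij) ->//; rewrite preimage_set0.
- by rewrite -preimage_bigcup; exact: preim_meas.
Qed.

HB.instance Definition _ := isMeasure.Build _ _ _ lebesgue_rV_step
  step0 step_ge0 step_sigma_additive.

Let step_sigma_finite : sigma_finite setT lebesgue_rV_step.
Proof.
have /sigma_finiteP[F [TF ndF Foo]] := sigma_finiteT (@lebesgue_measure R).
have /sigma_finiteP[G [TG ndG Goo]] := sigma_finiteT m.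
exists (fun k => @rV_uncons d @^-1` (F k `*` G k)).
  apply/seteqP; split=> // v _.
  have [n _ Fn] : (\bigcup_k F k) (rV_uncons v).1 by rewrite -TF.
  have [k _ Gk] : (\bigcup_k G k) (rV_uncons v).2 by rewrite -TG.
  exists (maxn n k) => //; split.
    by move: Fn; exact/subsetPset/ndF/leq_maxl.
  by move: Gk; exact/subsetPset/ndG/leq_maxr.
move=> k; have [mF Fk] := Foo k; have [mG Gk] := Goo k; split.
  rewrite -[X in measurable X]setTI; apply: measurable_rV_uncons => //.
  exact: measurableX.
rewrite /lebesgue_rV_step /pushforward -comp_preimage.
rewrite (_ : _ \o _ = id) ?preimage_id; last first.
  by apply/funext => p; exact: rV_consK.
by rewrite product_measure1E// lte_mul_pinfty// ge0_fin_numE.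
Qed.

HB.instance Definition _ := Measure_isSigmaFinite.Build _ _ _ lebesgue_rV_step
  step_sigma_finite.

End lebesgue_rV_step.

Fixpoint lebesgue_rV d : {sigma_finite_measure set 'rV[R]_d -> \bar R} :=
  if d is d'.+1 then lebesgue_rV_step (lebesgue_rV d') else \d_(0 : 'rV[R]_0).

End lebesgue_rV.

Arguments lebesgue_rV {R} d.

Section euclidean.
Context (R : realType) (d : nat).
Local Notation E := 'rV[R]_d.

Definition dotv (u v : E) : R := \sum_i u ord0 i * v ord0 i.

(* The library norm of 'rV[R]_d is the sup norm. *)
Definition enorm (u : E) : R := Num.sqrt (dotv u u).

Definition mdot (A B : 'M[R]_d) : R := \sum_i \sum_j A i j * B i j.

Definition sphere : set E := [set s | dotv s s = 1].

Definition tensor (s : E) : 'M[R]_d := s^T *m s.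

Definition symmx (A : 'M[R]_d) : Prop := A^T = A.

Definition sympart (A : 'M[R]_d) : 'M[R]_d := 2^-1 *: (A + A^T).

Definition boundary (Om : set E) : set E := closure Om `\` Om.

Definition coordf (u : E -> E) (i : 'I_d) : E -> R := fun x => u x ord0 i.

Definition pderiv (j : 'I_d) (f : E -> R) : E -> R :=
  'D_(delta_mx ord0 j : E) f.

Definition cgrad1 (f : E -> R) (x : E) : E := \row_j pderiv j f x.

Definition cgrad (B : E -> E) (x : E) : 'M[R]_d :=
  \matrix_(i, j) pderiv j (coordf B i) x.

Definition chess (B : E -> E) (x : E) (p j k : 'I_d) : R :=
  pderiv j (pderiv k (coordf B p)) x.

Definition cdiv (B : E -> E) (x : E) : R := \sum_i pderiv i (coordf B i) x.

End euclidean.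
Arguments sphere {R d}.

(** [Ck k f]: [f] is of class C^k on the whole (finite-dimensional) space [V].
    Functions of class C^k on the closure of a smooth bounded domain, which all
    extend to R^d, are represented by functions of class C^k on R^d, of which
    only the restriction to the closure is used. *)
Fixpoint Ck (R : realType) (V W : normedModType R) (k : nat) (f : V -> W) :
    Prop :=
  continuous f /\
  if k is k'.+1 then
    (forall x v, derivable f x v) /\ (forall v, Ck k' ('D_v f : V -> W))
  else True.

Section domain.
Context (R : realType) (d : nat).
Local Notation E := 'rV[R]_d.
Local Notation lam := (lebesgue_rV d : {measure set E -> \bar R}).

Definition ediam (U : set E) : \bar R :=
  ereal_sup (0%E |` [set (enorm (x - y))%:E | x in U & y in U]).

(* Normalized by the volume of the unit ball of R^s. *)
Definition hausdorff_delta (s : nat) (delta : R) (A : set E) : \bar R :=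
  ereal_inf [set (\sum_(0 <= k <oo)
      (lebesgue_rV s [set v : 'rV[R]_s | (dotv v v <= 1)%R]
       * ((fine (ediam (U k)) / 2) ^+ s)%:E))%E
    | U in [set U : (set E)^nat | A `<=` \bigcup_k U k /\
        forall k, (ediam (U k) <= delta%:E)%E]].

Definition hausdorff (s : nat) (A : set E) : \bar R :=
  ereal_sup [set hausdorff_delta s delta A | delta in [set delta | 0 < delta]].

(* [integral] accepts an arbitrary set function, and only evaluates it on
   measurable sets, on which [hausdorff d.-1] is a measure. *)
Definition surf_integral (A : set E) (f : E -> R) : R :=
  fine (integral (hausdorff d.-1) A (EFin \o f)).

Definition defining_function (Om : set E) (x : E) (rho : E -> R) : Prop :=
  [/\ forall k, Ck k rho, cgrad1 rho x != 0 &
      \forall y \near x, Om y <-> 0 < rho y].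

Definition smooth_bounded_domain (Om : set E) : Prop :=
  [/\ open Om, connected Om, Om !=set0, bounded_set Om &
      forall x, boundary Om x -> exists rho, defining_function Om x rho].

(* Inner, as [rho] is positive inside [Om]. *)
Definition inner_normal (Om : set E) (x : E) : E :=
  xget 0 [set nu | exists2 rho, defining_function Om x rho &
                   nu = (enorm (cgrad1 rho x))^-1 *: cgrad1 rho x].

Variable Om : set E.

Definition C1c (W : normedModType R) (phi : E -> W) : Prop :=
  Ck 1 phi /\ exists K, [/\ compact K, K `<=` Om &
    forall x, ~ K x -> phi x = 0].

Definition C0 (W : normedModType R) (phi : E -> W) : Prop :=
  continuous phi /\ forall x, ~ Om x -> phi x = 0.

Definition tangential (B : E -> E) : Prop :=
  forall x, boundary Om x -> dotv (B x) (inner_normal Om x) = 0.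

(* Elements of Lebesgue and Sobolev spaces are represented by Borel
   functions. *)
Definition L2 (f : E -> R) : Prop :=
  measurable_fun Om f /\ (\int[lam]_(x in Om) ((f x) ^+ 2)%:E < +oo)%E.

Definition L1loc (f : E -> R) : Prop :=
  measurable_fun Om f /\
  forall K, compact K -> K `<=` Om -> lam.-integrable K (EFin \o f).

(* Testing with C^1_c functions is equivalent to testing with smooth ones. *)
Definition is_wpartial (j : 'I_d) (f g : E -> R) : Prop :=
  [/\ L1loc f, L1loc g & forall phi : E -> R, C1c phi ->
      \int[lam]_(x in Om) (f x * pderiv j phi x) =
      - \int[lam]_(x in Om) (g x * phi x)].

(* A representative of the weak derivative if it exists, and 0 otherwise. *)
Definition wpartial (j : 'I_d) (f : E -> R) : E -> R :=
  xget (cst 0) [set g | is_wpartial j f g].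

Definition wgrad1 (f : E -> R) (x : E) : E := \row_j wpartial j f x.

Definition wgrad (u : E -> E) (x : E) : 'M[R]_d :=
  \matrix_(i, j) wpartial j (coordf u i) x.

Definition whess (u : E -> E) (x : E) (i j k : 'I_d) : R :=
  wpartial j (wpartial k (coordf u i)) x.

Definition wdiv (F : E -> E) (x : E) : R := \sum_i wpartial i (coordf F i) x.

Definition esym (u : E -> E) (x : E) : 'M[R]_d := sympart (wgrad u x).

Definition tdot (S T : 'I_d -> 'I_d -> 'I_d -> R) : R :=
  \sum_i \sum_j \sum_k S i j k * T i j k.

Definition H1 (f : E -> R) : Prop :=
  L2 f /\ forall j, exists2 g, is_wpartial j f g & L2 g.

Definition mean_zero (f : E -> R) : Prop := \int[lam]_(x in Om) f x = 0.

Definition H1v (u : E -> E) : Prop := forall i, H1 (coordf u i).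

Definition H2v (u : E -> E) : Prop :=
  H1v u /\ forall i k, H1 (wpartial k (coordf u i)).

Definition H1v_dot (u v : E -> E) : R :=
  \int[lam]_(x in Om) (dotv (u x) (v x) + mdot (wgrad u x) (wgrad v x)).

Definition H1perp (u : E -> E) : Prop :=
  H1v u /\ forall r, H1v r ->
    {ae lam, forall x, Om x -> esym r x = 0} -> H1v_dot u r = 0.

(** Norms are extended-valued, and equal to [+oo] outside the space. *)

Definition space_norm (P : Prop) (q : R) : \bar R :=
  if `[< P >] then (Num.sqrt q)%:E else +oo%E.

Definition norm_H1 (f : E -> R) : \bar R :=
  space_norm (H1 f)
    (\int[lam]_(x in Om) (f x ^+ 2 + dotv (wgrad1 f x) (wgrad1 f x))).

Definition norm_H10 (f : E -> R) : \bar R :=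
  space_norm (H1 f /\ mean_zero f)
    (\int[lam]_(x in Om) (f x ^+ 2 + dotv (wgrad1 f x) (wgrad1 f x))).

Definition norm_H1perp (u : E -> E) : \bar R :=
  space_norm (H1perp u) (H1v_dot u u).

Definition norm_H2v (u : E -> E) : \bar R :=
  space_norm (H2v u)
    (H1v_dot u u + \int[lam]_(x in Om) tdot (whess u x) (whess u x)).

Definition norm_C2 (B : E -> E) : \bar R :=
  if `[< Ck 2 B >] then
    ereal_sup [set (enorm (B x) + Num.sqrt (mdot (cgrad B x) (cgrad B x)) +
                    Num.sqrt (tdot (chess B x) (chess B x)))%:E
              | x in closure Om]
  else +oo%E.

(* Functionals on mean-zero H^1 functions are total functions [f] of which only
   the values on such functions matter. *)
Definition is_neumann_sol (f : (E -> R) -> R) (v : E -> R) : Prop :=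
  [/\ H1 v, mean_zero v & forall xi, H1 xi -> mean_zero xi ->
      \int[lam]_(x in Om) dotv (wgrad1 v x) (wgrad1 xi x) = f xi].

Definition inv_lapN (f : (E -> R) -> R) : E -> R :=
  xget (cst 0) [set v | is_neumann_sol f v].

Definition norm_Hm1 (f : (E -> R) -> R) : \bar R :=
  space_norm (exists v, is_neumann_sol f v)
    (\int[lam]_(x in Om) dotv (wgrad1 (inv_lapN f) x) (wgrad1 (inv_lapN f) x)).

Definition pairing (chi : E -> R) : (E -> R) -> R :=
  fun xi => \int[lam]_(x in Om) (chi x * xi x).

Definition transport (B : E -> E) (chi : E -> R) : (E -> R) -> R :=
  fun xi => - \int[lam]_(x in Om) (chi x * wdiv (fun y => xi y *: B y) x).

(** Polar form of the distributional gradient: a finite measure [p.1] (the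
    total variation measure) and a density [p.2] of norm 1. *)
Definition is_bv_grad (f : E -> R) (p : {measure set E -> \bar R} * (E -> E)) :
    Prop :=
  [/\ (p.1 setT < +oo)%E /\ p.1 (~` Om) = 0%E,
      measurable_fun Om p.2,
      {ae p.1, forall x, Om x -> enorm (p.2 x) = 1} &
      forall phi : E -> E, C1c phi ->
        \int[lam]_(x in Om) (f x * cdiv phi x) =
        - \int[p.1]_(x in Om) dotv (phi x) (p.2 x)].

Definition BV (f : E -> R) : Prop :=
  lam.-integrable Om (EFin \o f) /\ exists p, is_bv_grad f p.

Definition bv_grad (f : E -> R) : {measure set E -> \bar R} * (E -> E) :=
  if pselect (exists p, is_bv_grad f p) is left h then projT1 (cid h)
  else (mzero : {measure set E -> \bar R}, cst 0).

Definition bv_variation (f : E -> R) : \bar R := (bv_grad f).1 Om.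

Definition bv_integral (f : E -> R) (eta : E -> E) : R :=
  \int[(bv_grad f).1]_(x in Om) dotv (eta x) ((bv_grad f).2 x).

Definition norm_BV (f : E -> R) : \bar R :=
  (\int[lam]_(x in Om) `|f x|%:E + bv_variation f)%E.

(* The sign of the boundary term is due to the normal being the inner one. *)
Definition is_bv_trace (f g : E -> R) : Prop :=
  [/\ measurable_fun (boundary Om) g,
      (integral (hausdorff d.-1) (boundary Om) (fun x => `|g x|%:E) < +oo)%E &
      forall phi : E -> E, Ck 1 phi ->
        \int[lam]_(x in Om) (f x * cdiv phi x) =
        - bv_integral f phi -
        surf_integral (boundary Om)
          (fun x => g x * dotv (phi x) (inner_normal Om x))].

Definition bv_trace (f : E -> R) : E -> R :=
  xget (cst 0) [set g | is_bv_trace f g].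

End domain.

Section bochner.
Context (R : realType) (X : lmodType R).
Variable (N : X -> \bar R) (T : R).
Local Notation leb := (@lebesgue_measure R).

Record simple_fun := SimpleFun {
  sf_card : nat;
  sf_set : 'I_sf_card -> set (measurableTypeR R);
  sf_val : 'I_sf_card -> X;
  sf_measurable : forall i, measurable (sf_set i) }.

Arguments sf_set : clear implicits.
Arguments sf_val : clear implicits.

Definition sf_eval (s : simple_fun) (t : R) : X :=
  \sum_i (\1_(sf_set s i) t : R) *: sf_val s i.

Definition sf_integral (s : simple_fun) : X :=
  \sum_i fine (leb (sf_set s i `&` `]0, T[)) *: sf_val s i.

(* Strong measurability, for the seminorm [N] on [X]; here [X] is a space of
   everywhere defined functions and [N] identifies those equal a.e. *)
Definition bochner_measurable (f : R -> X) : Prop :=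
  exists s : nat -> simple_fun,
    {ae leb, forall t, 0 < t < T ->
       N (f t - sf_eval (s n) t) @[n --> \oo] --> (0 : \bar R)}.

Definition is_bochner_integral (f : R -> X) (v : X) : Prop :=
  exists s : nat -> simple_fun,
    [/\ {ae leb, forall t, 0 < t < T ->
           N (f t - sf_eval (s n) t) @[n --> \oo] --> (0 : \bar R)},
        (\int[leb]_(t in `]0%R, T[) N (f t - sf_eval (s n) t))%E @[n --> \oo]
           --> (0 : \bar R) &
        N (v - sf_integral (s n)) @[n --> \oo] --> (0 : \bar R)].

Definition sq_integrable (f : R -> X) : Prop :=
  (\int[leb]_(t in `]0%R, T[) (N (f t)) ^+ 2 < +oo)%E.

Definition L2t (f : R -> X) : Prop := bochner_measurable f /\ sq_integrable f.

Definition Linft (f : R -> X) : Prop :=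
  bochner_measurable f /\
  exists M : R, {ae leb, forall t, 0 < t < T -> (N (f t) <= M%:E)%E}.

Definition is_wderiv (f g : R -> X) : Prop :=
  forall phi : R -> R, Ck 1 phi ->
    (exists K : set R, [/\ compact K, K `<=` `]0, T[ &
       forall t, ~ K t -> phi t = 0]) ->
    exists2 v, is_bochner_integral (fun t => derive1 phi t *: f t) v &
               is_bochner_integral (fun t => phi t *: g t) (- v).

Definition H1t (f : R -> X) : Prop :=
  L2t f /\ exists2 g, L2t g & is_wderiv f g.

(* A representative of the weak time derivative if [f] is in H^1. *)
Definition wderiv (f : R -> X) : R -> X :=
  xget (fun=> 0) [set g | L2t g /\ is_wderiv f g].

(* The value at 0 of the continuous representative. *)
Definition initial_value (f : R -> X) (f0 : X) : Prop :=
  exists f' : R -> X,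
    {ae leb, forall t, 0 < t < T -> N (f t - f' t) = 0%E} /\
    N (f' t - f0) @[t --> 0^'+] --> (0 : \bar R).

End bochner.

Section time.
Context (R : realType) (T : R).
Local Notation leb := (@lebesgue_measure R).

Definition ae_time (P : R -> Prop) : Prop :=
  {ae leb, forall t, 0 < t < T -> P t}.

Definition ae_time_pairs (P : R -> R -> Prop) : Prop :=
  {ae (leb \x leb)%E, forall p : measurableTypeR R * measurableTypeR R,
     0 <= p.1 -> p.1 <= p.2 -> p.2 <= T -> P p.1 p.2}.

(* Lebesgue measurability, the library measurability being Borel. *)
Definition ae_measurable (f : R -> R) : Prop :=
  exists2 g : R -> R, measurable_fun setT g & ae_time (fun t => f t = g t).

End time.

Section energies.
Context (R : realType) (d : nat).
Local Notation E := 'rV[R]_d.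
Local Notation lam := (lebesgue_rV d : {measure set E -> \bar R}).

Definition elastic_tensor (C : R -> {linear 'M[R]_d -> 'M[R]_d}) : Prop :=
  [/\ forall y A, symmx A -> symmx (C y A),
      forall y A B, symmx A -> symmx B -> mdot (C y A) B = mdot A (C y B) &
      exists2 c, 0 < c &
        forall y A, symmx A -> c * mdot A A <= mdot (C y A) A].

Variables (Om : set E).

Definition oriented_varifold (V : {measure set (E * E) -> \bar R}) : Prop :=
  (V setT < +oo)%E /\ V (~` (closure Om `*` sphere)) = 0%E.

(* [|V| U], for [V] carried by [closure Om `*` sphere]. *)
Definition mass (V : set (E * E) -> \bar R) : set E -> \bar R :=
  fun U => V (U `*` sphere).

(* The measure sigma (x) (k_x). *)
Definition disintegration (sigma : set E -> \bar R) (U : set E)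
    (k : E -> set E -> \bar R) : set (E * E) -> \bar R :=
  fun A => integral sigma U (fun x => k x (xsection A x)).

Definition varifold_integral (V : {measure set (E * E) -> \bar R})
    (f : E -> E -> R) : R :=
  \int[V]_(p in closure Om `*` sphere) f p.1 p.2.

Variables (C Cnu : R -> {linear 'M[R]_d -> 'M[R]_d}) (Tau : R -> 'M[R]_d).

Definition Wel (y : R) (A : 'M[R]_d) : R :=
  2^-1 * mdot (C y (A - Tau y)) (A - Tau y).

Definition Wel_deriv (y : R) (A : 'M[R]_d) : 'M[R]_d := C y (A - Tau y).

Definition sqnorm_chi (chi : E -> R) (z : E -> E) : \bar R :=
  (\int[lam]_(x in Om)
     (mdot (Cnu (chi x) (esym Om z x)) (esym Om z x))%:E)%E.

Definition bulk_energy (chi : E -> R) (u : E -> E) : \bar R :=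
  (\int[lam]_(x in Om) (Wel (chi x) (esym Om u x))%:E +
   \int[lam]_(x in Om) (2^-1 * tdot (whess Om u x) (whess Om u x))%:E)%E.

Definition energy (V : {measure set (E * E) -> \bar R}) (chi : E -> R)
    (u : E -> E) : \bar R :=
  (mass V (closure Om) + bulk_energy chi u)%E.

Definition initial_energy (c0 alpha : R) (chi0 : E -> R) (u0 : E -> E) :
    \bar R :=
  (c0%:E * bv_variation Om chi0 +
   (surf_integral (boundary Om)
      (fun x => c0 * cos alpha * bv_trace Om chi0 x))%:E +
   bulk_energy chi0 u0)%E.

Definition hess_term1 (u B : E -> E) (x : E) : R :=
  \sum_i \sum_j \sum_k \sum_p
    whess Om u x i j k * wgrad Om u x i p * chess B x p j k.

Definition hess_term2 (u B : E -> E) (x : E) : R :=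
  \sum_i \sum_j \sum_k \sum_p
    whess Om u x i j k * whess Om u x i p k * cgrad B x j p.

Definition hess_term3 (u B : E -> E) (x : E) : R :=
  \sum_i \sum_j \sum_k \sum_p
    whess Om u x i j k * whess Om u x i j p * cgrad B x k p.

Definition hess_apply (u B : E -> E) (x : E) : 'M[R]_d :=
  \matrix_(i, j) \sum_k whess Om u x i j k * B x ord0 k.

Definition grad_apply (u B : E -> E) (x : E) : E :=
  \row_i \sum_j wgrad Om u x i j * B x ord0 j.

Definition first_variation (V : {measure set (E * E) -> \bar R}) (chi : E -> R)
    (u B z : E -> E) : R :=
  varifold_integral V (fun x s => mdot (1%:M - tensor s) (cgrad B x))
  + \int[lam]_(x in Om)
      mdot (Wel (chi x) (esym Om u x) *: 1%:M
            - (wgrad Om u x)^T *m Wel_deriv (chi x) (esym Om u x)) (cgrad B x)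
  + \int[lam]_(x in Om)
      (2^-1 * tdot (whess Om u x) (whess Om u x) * cdiv B x)
  - \int[lam]_(x in Om) hess_term1 u B x
  - \int[lam]_(x in Om) hess_term2 u B x
  - \int[lam]_(x in Om) hess_term3 u B x
  + \int[lam]_(x in Om)
      mdot (Wel_deriv (chi x) (esym Om u x)) (wgrad Om z x)
  + \int[lam]_(x in Om) tdot (whess Om u x) (whess Om z x).

Definition test_fields (chi : E -> R) (B : E -> E) : Prop :=
  [/\ Ck 2 B, \int[lam]_(x in Om) (chi x * cdiv B x) = 0 & tangential Om B].

End energies.

Section varifold_solution.
Context (R : realType) (d : nat).
Local Notation E := 'rV[R]_d.
Local Notation lam := (lebesgue_rV d : {measure set E -> \bar R}).
Local Notation leb := (@lebesgue_measure R).
Local Notation varifold := {measure set (E * E) -> \bar R}.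

Definition BV_char (Om : set E) (chi : E -> R) : Prop :=
  BV Om chi /\ forall x, Om x -> chi x = 0 \/ chi x = 1.

Variables (Om : set E) (Tst c0 alpha : R).
Variables (C Cnu : R -> {linear 'M[R]_d -> 'M[R]_d}) (Tau : R -> 'M[R]_d).
Variables (chi0 : E -> R) (u0 : E -> E).
Variables (mu : R -> varifold) (chi : R -> E -> R) (u : R -> E -> E).

Local Notation nu := (inner_normal Om).
Local Notation ae_t := (ae_time Tst).

Definition dt_chi : R -> (E -> R) -> R :=
  wderiv (norm_Hm1 Om) Tst (fun t => pairing Om (chi t)).

Definition dt_u : R -> E -> E := wderiv (norm_H1perp Om) Tst u.

Definition weakstar_Linf_BV : Prop :=
  [/\ ae_t (fun t => BV_char Om (chi t)),
      exists M : R, ae_t (fun t => (norm_BV Om (chi t) <= M%:E)%E) &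
      (* BV(Om) is the dual of a quotient of C_0(Om; R^(1+d)). *)
      forall (f0 : E -> R) (f : E -> E), C0 Om f0 -> C0 Om f ->
        ae_measurable Tst (fun t =>
          \int[lam]_(x in Om) (chi t x * f0 x) + bv_integral Om (chi t) f)].

Definition sol_regularity : Prop :=
  [/\ measurable_fun ((`]0, Tst[ : set (measurableTypeR R)) `*` Om)
        (fun p : measurableTypeR R * E => chi p.1 p.2) /\
      (forall t x, 0 < t < Tst -> Om x -> chi t x = 0 \/ chi t x = 1),
      weakstar_Linf_BV,
      H1t (norm_Hm1 Om) Tst (fun t => pairing Om (chi t)),
      H1t (norm_H1perp Om) Tst u &
      Linft (norm_H2v Om) Tst u].

Definition sol_initial : Prop :=
  initial_value (norm_Hm1 Om) Tst (fun t => pairing Om (chi t))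
    (pairing Om chi0) /\
  initial_value (norm_H1perp Om) Tst u u0.

Definition sol_structure (muO muB : R -> varifold) (g : R -> E -> R) : Prop :=
  [/\ measurable_fun ((`]0, Tst[ : set (measurableTypeR R)) `*` boundary Om)
        (fun p : measurableTypeR R * E => g p.1 p.2),
      (forall t x, 0 < t < Tst -> boundary Om x -> 0 <= g t x <= 1) &
      ae_t (fun t =>
        [/\ forall A, measurable A ->
              mu t A = (c0%:E * muO t A + (c0 * cos alpha)%:E * muB t A)%E,
            oriented_varifold Om (muO t),
            (exists k : R.-ker E ~> E,
              {ae mass (muO t), forall x,
                k x setT = 1%E /\ k x (~` sphere) = 0%E} /\
              forall A, measurable A ->
                muO t A = disintegration (mass (muO t)) setT (fun x => k x) A),
            oriented_varifold Om (muB t) &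
            (forall A, measurable A ->
              mass (muB t) A =
                integral (hausdorff d.-1) (A `&` boundary Om)
                  (fun x => (g t x)%:E)) /\
            (forall A, measurable A ->
              muB t A = disintegration (mass (muB t)) (boundary Om)
                (fun x => \d_(nu x)) A)])].

Definition sol_compatibility (muO muB : R -> varifold) : Prop :=
  ae_t (fun t =>
    [/\ forall eta : E -> E, Ck 1 eta -> tangential Om eta ->
          varifold_integral Om (muO t) (fun x s => dotv (eta x) s) =
          bv_integral Om (chi t) eta,
        forall xi : E -> E, Ck 1 xi ->
          (forall x, boundary Om x -> dotv (xi x) (nu x) = cos alpha) ->
          - varifold_integral Om (muO t) (fun x s => dotv s (xi x)) =
          - bv_integral Om (chi t) xi +
          cos alpha * (fine (mass (muB t) (boundary Om)) -
                       surf_integral (boundary Om) (bv_trace Om (chi t))) &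
        forall A, measurable A -> A `<=` boundary Om ->
          ((cos alpha)%:E * integral (hausdorff d.-1) A
             (fun x => (bv_trace Om (chi t) x)%:E) <=
           (cos alpha)%:E * (mass (muO t) A + mass (muB t) A))%E]).

Definition sol_gibbs_thomson (w : R -> E -> R) : Prop :=
  ae_t (fun t => forall B : E -> E, Ck 2 B -> tangential Om B ->
    let stress x := Cnu (chi t x) (esym Om (dt_u t) x) in
    varifold_integral Om (mu t)
      (fun x s => mdot (1%:M - tensor s) (cgrad B x)) =
    \int[lam]_(x in Om) (chi t x * wdiv Om (fun y => w t y *: B y) x)
    + \int[lam]_(x in Om) mdot (stress x) (hess_apply Om (u t) B x)
    - \int[lam]_(x in Om)
        (2^-1 * tdot (whess Om (u t) x) (whess Om (u t) x) * cdiv B x)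
    - \int[lam]_(x in Om)
        mdot (Wel C Tau (chi t x) (esym Om (u t) x) *: 1%:M
              - (wgrad Om (u t) x)^T *m
                (stress x + Wel_deriv C Tau (chi t x) (esym Om (u t) x)))
             (cgrad B x)
    + \int[lam]_(x in Om) hess_term1 Om (u t) B x
    + \int[lam]_(x in Om) (hess_term2 Om (u t) B x + hess_term3 Om (u t) B x)).

Definition potential_v (t : R) : E -> R :=
  fun x => - inv_lapN Om (dt_chi t) x.

(* Restrictions to [0, Tst) x Om of C^1 functions on R x R^d. *)
Definition C1c_time (zeta : R * E -> R) : Prop :=
  Ck 1 zeta /\ exists K : set (R * E),
    [/\ compact K, K `<=` `[0, Tst[ `*` Om &
        forall p, 0 <= p.1 -> ~ K p -> zeta p = 0].

Definition sol_mass : Prop :=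
  [/\ L2t (norm_H10 Om) Tst potential_v,
      forall zeta : R * E -> R, C1c_time zeta ->
        H1t (norm_H10 Om) Tst (fun t x => zeta (t, x)) ->
        \int[leb]_(t in `]0, Tst[)
           \int[lam]_(x in Om) (chi t x * derive1 (fun r => zeta (r, x)) t)
        - \int[leb]_(t in `]0, Tst[)
           \int[lam]_(x in Om)
             dotv (wgrad1 Om (potential_v t) x)
                  (cgrad1 (fun y => zeta (t, y)) x)
        = - \int[lam]_(x in Om) (chi0 x * zeta (0, x)) &
      ae_t (fun t => \int[lam]_(x in Om) chi t x = \int[lam]_(x in Om) chi0 x)].

Definition sol_momentum : Prop :=
  forall z : R -> E -> E, L2t (norm_H2v Om) Tst z ->
    \int[leb]_(t in `]0, Tst[)
      \int[lam]_(x in Om)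
        (mdot (Cnu (chi t x) (esym Om (dt_u t) x)
               + Wel_deriv C Tau (chi t x) (esym Om (u t) x)) (esym Om (z t) x)
         + tdot (whess Om (u t) x) (whess Om (z t) x)) = 0.

Definition energy_at (t : R) : \bar R := energy Om C Tau (mu t) (chi t) (u t).

Definition energy0 : \bar R := initial_energy Om C Tau c0 alpha chi0 u0.

Definition sqnorm_dt_chi (t : R) : \bar R := ((norm_Hm1 Om (dt_chi t)) ^+ 2)%E.

Definition sqnorm_dt_u (t : R) : \bar R := sqnorm_chi Om Cnu (chi t) (dt_u t).

Definition sol_dissipation (w : R -> E -> R) : Prop :=
  ae_time_pairs Tst (fun s T =>
    ((energy_at T
      + 2^-1%:E * \int[leb]_(t in `]s, T[) (sqnorm_dt_chi t + sqnorm_dt_u t)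
      + 2^-1%:E * \int[leb]_(t in `]s, T[)
          (\int[lam]_(x in Om) (dotv (wgrad1 Om (w t) x) (wgrad1 Om (w t) x))%:E
           + sqnorm_dt_u t)
      <= energy_at s) /\ (energy_at s <= energy0))%E).

Definition varifold_solution : Prop :=
  [/\ (forall t, 0 < t < Tst -> oriented_varifold Om (mu t)) /\ sol_regularity,
      sol_initial,
      (exists muO muB g, sol_structure muO muB g /\ sol_compatibility muO muB),
      (exists w : R -> E -> R, [/\ L2t (norm_H1 Om) Tst w,
         sol_gibbs_thomson w & sol_dissipation w]) &
      [/\ sol_mass, sol_momentum &
          ae_measurable Tst (fun t => fine (mass (mu t) (closure Om)))]].

Definition slope_term (t : R) (B z : E -> E) : \bar R :=
  ((first_variation Om C Tau (mu t) (chi t) (u t) B z)%:E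
   - 2^-1%:E * (norm_Hm1 Om (transport Om B (chi t))) ^+ 2
   - 2^-1%:E * sqnorm_chi Om Cnu (chi t)
       (fun x => z x - grad_apply Om (u t) B x)%R)%E.

End varifold_solution.

(* Main.v *)
Require Import Defs.
From HB Require Import structures.
From mathcomp Require Import all_boot all_order all_algebra.
From mathcomp Require Import all_classical all_reals all_analysis.
From mathcomp Require Import measurable_realfun.
From mathcomp Require Import ring lra.
Set Implicit Arguments.
Unset Strict Implicit.
Unset Printing Implicit Defensive.
Import Order.TTheory GRing.Theory Num.Theory.
Import numFieldNormedType.Exports.
Local Open Scope classical_set_scope.
Local Open Scope ring_scope.

(** The theorem rests on an inequality at almost every single time t.  Let p be
    the time derivative of u and w the potential of the Gibbs-Thomson law.  For
    an admissible pair (B, z), the Gibbs-Thomson law and the momentum balance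
    turn the first variation into

      dF[B, z] = - <B . grad chi, w> - int C_nu(chi) E(p) : E(z - grad u B),

    because every energetic term cancels and because the terms in which the
    viscous stress meets B add up to the gradient of grad u B, by the product
    rule ([wgrad_grad_apply], [first_variation_reduced]).  Both terms are bounded
    by Young's inequality.  The first one is at most
    1/2 |B . grad chi|^2 + 1/2 |grad w|^2: the volume constraint on B makes
    B . grad chi vanish on constants, so that w is admissible in the Neumann
    problem which defines the dual norm ([transport_le]); if the dual norm is
    infinite, the slope is minus infinity.  The second one is at most half the
    sum of the squared viscous norms of p and z - grad u B ([viscous_work_ge]).
    The quadratic terms subtracted in the slope thus absorb
    everything except |grad w|^2 and |p|^2, and the slope is at most the second
    dissipation rate of the solution, uniformly in B and z ([slope_le_ae]).
    Replacing this rate by the slope, or by its supremum, in the dissipation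
    inequality of the solution yields both claims ([integral_slope_le]).

    Two points need care.  The exceptional set of times must not depend on
    (B, z), whereas the momentum balance is only given integrated in time.  It is
    localized at almost every time for a fixed test field, by testing with
    indicators of sets of times, which requires the measurability in time of the
    forms involved ([bochner_comp_ae_measurable]); then for all fields at once,
    by the separability of L^2 ([L2_family_separable], [momentum_at_ae_time]).
    Moreover the slopes need not be measurable in time.  Their integral is a
    lower integral, which is still monotone, and subadditive when one summand is
    measurable ([ae_le_integralD]).

    The calculus of weak derivatives, in which a derivative is an arbitrarily
    chosen representative, is founded on the fundamental lemma of the calculus of
    variations ([test_integral0_ae]), through the uniqueness almost everywhere of
    weak derivatives ([is_wpartial_unique]). *)

(** * Lower integrals and monotonicity without measurability *)

Section lower_integral.
Import HBNNSimple.
Context d (X : measurableType d) (R : realType).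
Variable mu : {measure set X -> \bar R}.
Implicit Types (D : set X) (f g a b : X -> \bar R).
Local Open Scope ereal_scope.

(** The integral of a nonnegative function is a supremum over the simple
    functions below it, so it is monotone whether or not the integrands are
    measurable: cut off outside of the null set, a simple function below [f]
    is below [g].  The slopes, and their suprema over test fields, are not
    known to depend measurably on time. *)
Lemma ge0_ae_le_integral_all D f g : measurable D ->
  (forall x, D x -> 0 <= f x) -> (forall x, D x -> 0 <= g x) ->
  {ae mu, forall x, D x -> f x <= g x} ->
  \int[mu]_(x in D) f x <= \int[mu]_(x in D) g x.
Proof.
move=> mD f0 g0 [N [mN N0 sub]].
rewrite !ge0_integralE//; apply: ge_ereal_sup => _ [h hf <-].
pose DN := D `\` N; have mDN : measurable DN by exact: measurableD.
have fgDN x : DN x -> f x <= g x.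
  by move=> [Dx Nx]; apply: contrapT => H; apply: Nx; apply: sub => /(_ Dx).
have mh : measurable_fun (setT : set X) (EFin \o (h : X -> R)).
  by apply/measurable_EFinP; exact: measurable_funPT.
rewrite -integralT_nnsfun.
have -> : \int[mu]_x (h x)%:E = \int[mu]_(x in DN) (h x)%:E.
  rewrite (@ge0_negligible_integral _ _ _ mu setT N)//; last first.
    by move=> x _; rewrite lee_fin.
  rewrite setTD [LHS](integral_mkcond (~` N)) [RHS](integral_mkcond DN).
  apply: eq_integral => x _; rewrite !patchE /DN in_setD in_setC.
  case: (boolP (x \in N)) => Nx /=; first by rewrite andbF.
  rewrite andbT; case: (boolP (x \in D)) => Dx //; have := hf x.
  rewrite patchE (negbTE Dx) => h0; apply/eqP; rewrite eq_le h0.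
  by rewrite (_ : point = 0%:E)// lee_fin; exact: fun_ge0.
rewrite -ge0_integralE// [leRHS]integral_mkcond integral_mkcond.
rewrite [leLHS]ge0_integralE ?[leRHS]ge0_integralE; last 2 first.
- by move=> x _; rewrite patchE; case: ifPn => // /set_mem /g0.
- by move=> x _; rewrite patchE; case: ifPn => // _; rewrite lee_fin.
apply: ge_ereal_sup => _ [k kh <-]; apply: ereal_sup_ubound; exists k => // x.
apply: le_trans (kh x) _; rewrite !patch_setT !patchE.
case: ifPn => [/set_mem xDN|_]; last by case: ifPn => // /set_mem /g0.
rewrite mem_set; last by case: xDN.
apply: le_trans (hf x) _; rewrite patchE mem_set; last by case: xDN.
exact: fgDN.
Qed.

Lemma ae_le_integral_all D f g : measurable D ->
  {ae mu, forall x, D x -> f x <= g x} ->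
  \int[mu]_(x in D) f x <= \int[mu]_(x in D) g x.
Proof.
move=> mD fg; rewrite integralE [leRHS]integralE; apply: leeB.
  apply: ge0_ae_le_integral_all => //.
  apply: filterS fg => x fg Dx.
  by rewrite !funeposE ge_max !le_max lexx (fg Dx) orbT.
apply: ge0_ae_le_integral_all => //.
apply: filterS fg => x fg Dx.
by rewrite !funenegE ge_max !le_max leeN2 lexx (fg Dx) orbT.
Qed.

Lemma le_integral_all D f g : (forall x, D x -> f x <= g x) ->
  \int[mu]_(x in D) f x <= \int[mu]_(x in D) g x.
Proof.
move=> fg; rewrite integral_mkcond [leRHS]integral_mkcond.
apply: ae_le_integral_all => //; apply: aeW => x _; rewrite !patchE.
by case: ifPn => // /set_mem /fg.
Qed.

Lemma ae_eq_integral_all D f g : measurable D ->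
  {ae mu, forall x, D x -> f x = g x} ->
  \int[mu]_(x in D) f x = \int[mu]_(x in D) g x.
Proof.
move=> mD fg; apply/eqP; rewrite eq_le; apply/andP; split;
  by apply: ae_le_integral_all => //; apply: filterS fg => x fg Dx; rewrite fg.
Qed.

(** Lower integrals are subadditive as soon as one summand is measurable: a
    simple function h below [a + g] is at most max(h - g, 0) + g, where
    max(h - g, 0) is measurable and below [a]. *)
Lemma ge0_le_integral_measurableD D a (g : X -> R) : measurable D ->
  (forall x, D x -> 0 <= a x) -> measurable_fun D g ->
  (forall x, D x -> (0 <= g x)%R) ->
  \int[mu]_(x in D) (a x + (g x)%:E) <=
  \int[mu]_(x in D) a x + \int[mu]_(x in D) (g x)%:E.
Proof.
move=> mD a0 mg g0.
have ag0 x : D x -> 0 <= a x + (g x)%:E.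
  by move=> Dx; rewrite adde_ge0 ?a0// lee_fin g0.
rewrite ge0_integralE//; apply: ge_ereal_sup => _ [h hf <-].
have mh : measurable_fun (setT : set X) (EFin \o (h : X -> R)).
  by apply/measurable_EFinP; exact: measurable_funPT.
have -> : sintegral mu h = \int[mu]_(x in D) (h x)%:E.
  rewrite -integralT_nnsfun [RHS]integral_mkcond; apply: eq_integral => x _.
  rewrite patchE; case: ifPn => // Dx; have := hf x.
  rewrite patchE (negbTE Dx) => h0; apply/eqP; rewrite eq_le h0.
  by rewrite (_ : point = 0%:E)// lee_fin; exact: fun_ge0.
(* The measurable part of [h] that [a] has to dominate. *)
pose k x := maxe ((h x)%:E - (g x)%:E) 0.
have mgE : measurable_fun D (fun x => (g x)%:E) by exact/measurable_EFinP.
have mk : measurable_fun D k.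
  apply: measurable_maxe => //; apply: emeasurable_funB => //.
  exact: measurable_funS mh.
apply: (@le_trans _ _ (\int[mu]_(x in D) (k x + (g x)%:E))).
  apply: le_integral_all => // x _.
  rewrite /k -EFinB -EFin_max -EFinD lee_fin.
  by rewrite -lerBlDr le_max lexx.
rewrite ge0_integralD//; last by move=> x _; rewrite /k le_max lexx orbT.
apply: leeD => //; apply: le_integral_all => // x Dx.
rewrite /k ge_max a0// andbT leeBlDr//.
by have := hf x; rewrite patchE mem_set.
Qed.

(** The form used in time, where the measurable summand [b] is only known up
    to a null set. *)
Lemma ae_le_integralD D f a b (g : X -> R) : measurable D ->
  (forall x, D x -> 0 <= a x) -> measurable_fun D g ->
  (forall x, D x -> (0 <= g x)%R) ->
  {ae mu, forall x, D x -> b x = (g x)%:E /\ f x <= a x + b x} ->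
  \int[mu]_(x in D) f x <= \int[mu]_(x in D) a x + \int[mu]_(x in D) b x.
Proof.
move=> mD a0 mg g0 H.
rewrite (@ae_eq_integral_all _ b (EFin \o g))//; last first.
  by apply: filterS H => x H /H[].
apply: le_trans (ge0_le_integral_measurableD mD a0 mg g0).
by apply: ae_le_integral_all => //; apply: filterS H => x H /H[->].
Qed.

End lower_integral.

(** * Strongly measurable functions of time *)

Section strong_measurability.
Context (R : realType) (X : lmodType R) (N : X -> \bar R) (T : R).
Local Notation leb := (@lebesgue_measure R).
Local Notation I0T := (`]0, T[%classic : set (measurableTypeR R)).

(** Peeling the steps off one by one, by translating the second argument,
    avoids making the sets of the simple function disjoint. *)
Lemma measurable_fun_simple_comp (s : simple_fun X) (Psi : R -> X -> R) :
  (forall v, measurable_fun I0T (Psi ^~ v)) ->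
  measurable_fun I0T (fun t => Psi t (sf_eval s t)).
Proof.
rewrite /sf_eval; elim: (index_enum _) Psi => [|i r IH] Psi mPsi.
  rewrite (_ : (fun t => _) = Psi ^~ 0); first exact: mPsi.
  by apply/funext => t; rewrite big_nil.
pose g t := if t \in sf_set i
  then Psi t (sf_val i + \sum_(j <- r) (\1_(sf_set j) t : R) *: sf_val j)
  else Psi t (0 + \sum_(j <- r) (\1_(sf_set j) t : R) *: sf_val j).
rewrite (_ : (fun t => _) = g); last first.
  apply/funext => t; rewrite /g big_cons indicE.
  by case: ifPn => _; rewrite ?scale1r ?scale0r.
apply: measurable_fun_if => //.
- apply: measurable_funTS; apply: (measurable_fun_bool true).
  rewrite (_ : _ @^-1` _ = sf_set i); last first.
    by apply/seteqP; split=> t; rewrite /preimage/= => ?; [exact/set_mem|exact/mem_set].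
  by rewrite setTI; exact: sf_measurable.
- apply: measurable_funS (IH (fun t v => Psi t (sf_val i + v)) _)=> //.
- apply: measurable_funS (IH (fun t v => Psi t (0 + v)) _)=> //.
Qed.

(** [f] is almost everywhere a limit of simple functions, and the hypothesis
    on [Phi] turns this into an almost everywhere limit of measurable real
    functions. *)
Lemma bochner_comp_ae_measurable (f : R -> X) (Phi : R -> X -> R) :
  bochner_measurable N T f ->
  (forall v, measurable_fun I0T (Phi ^~ v)) ->
  ae_time T (fun t => forall v_ : nat -> X,
    N (f t - v_ n) @[n --> \oo] --> (0 : \bar R) ->
    Phi t (v_ n) @[n --> \oo] --> Phi t (f t)) ->
  ae_measurable T (fun t => Phi t (f t)).
Proof.
move=> [s [N1 [mN1 N10 sub1]]] mPhi [N2 [mN2 N20 sub2]].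
pose D := I0T `\` (N1 `|` N2).
have mU : measurable (N1 `|` N2) by exact: measurableU.
have mD : measurable D by apply: measurableD.
have mf : measurable_fun D (fun t => Phi t (f t)).
  apply: (@measurable_fun_cvg _ _ _ _ (fun n t => Phi t (sf_eval (s n) t))).
    move=> n; apply: measurable_funS (measurable_fun_simple_comp _ mPhi) => //.
    exact: subIsetl.
  move=> t [/= t0T NN].
  have /contrapT h1 : ~ ~ (0 < t < T -> N (f t - sf_eval (s n) t)
      @[n --> \oo] --> (0 : \bar R)).
    by move=> h; apply: NN; left; exact: sub1.
  have /contrapT h2 : ~ ~ (0 < t < T -> forall v_ : nat -> X,
    N (f t - v_ n) @[n --> \oo] --> (0 : \bar R) ->
    Phi t (v_ n) @[n --> \oo] --> Phi t (f t)).
    by move=> h; apply: NN; right; exact: sub2.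
  move: t0T; rewrite in_itv/= => t0T.
  exact: (h2 t0T _ (h1 t0T)).
exists ((fun t => Phi t (f t)) \_ D).
  by apply/(measurable_restrictT _ mD).
exists (N1 `|` N2); split => //.
  by apply: null_set_setU.
move=> t /= /not_implyP[t0T h]; apply: contrapT => NN; apply: h.
by rewrite patchE mem_set//; split => //=; rewrite in_itv.
Qed.

End strong_measurability.

(** * Borel sets of R^d *)

Section borel_rV.
Context (R : realType) (d : nat).
Local Notation E := 'rV[R]_d.

Definition lower_box (q : 'rV[rat]_d) : set E :=
  [set x | forall i, x ord0 i < ratr (q ord0 i)].

Lemma measurable_coordwise (A : 'I_d -> set (measurableTypeR R)) :
  (forall i, measurable (A i)) ->
  measurable [set x : E | forall i, A i (x ord0 i)].
Proof.
move=> mA; rewrite (_ : [set _ | _] =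
    \bigcap_(i in [set: 'I_d]) (@rV_coord R d i @^-1` A i)); last first.
  by apply/seteqP; split=> x h i; [move=> _; exact: h|exact: (h i I)].
apply: fin_bigcap_measurable => // i _.
by rewrite -[X in measurable X]setTI; exact: measurable_rV_coord.
Qed.

Lemma measurable_lower_box q : measurable (lower_box q).
Proof.
apply: (@measurable_coordwise (fun i => `]-oo, ratr (q ord0 i)[%classic)) => i.
exact: measurable_itv.
Qed.

Lemma lower_boxI q1 q2 : lower_box q1 `&` lower_box q2 =
  lower_box (\row_i Order.min (q1 ord0 i) (q2 ord0 i)).
Proof.
apply/seteqP; split=> x /=.
  by move=> [h1 h2] i; rewrite mxE /Order.min; case: ifP => _; [exact: h1|exact: h2].
move=> h; split=> i; have := h i; rewrite mxE.
  by move/lt_le_trans; apply; rewrite ler_rat ge_min lexx.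
by move/lt_le_trans; apply; rewrite ler_rat ge_min lexx orbT.
Qed.

Lemma lower_box_generate :
  (measurable : set (set E)) = <<s range lower_box >>.
Proof.
apply/seteqP; split; last first.
  apply: smallest_sub; first exact: sigma_algebra_measurable.
  by move=> _ [q _ <-]; exact: measurable_lower_box.
apply: smallest_sub => //=.
rewrite -bigcup_seq; apply: bigcup_sub => i _ _ [B mB <-]; rewrite setTI.
pose H := [set B : set (measurableTypeR R) |
             <<s range lower_box >> (@rV_coord R d i @^-1` B)].
suff : <<s @RGenInftyO.G R >> `<=` H.
  apply; move: mB; rewrite -[X in X _ -> _]/(measurable : set (set _)).
  by rewrite (RGenInftyO.measurableE R).
apply: smallest_sub.
  split; rewrite /H/=.
  - by rewrite preimage_set0; exact: sigma_algebra0.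
  - move=> A mA; rewrite setTD preimage_setC -setTD.
    exact: sigma_algebraCD.
  - by move=> F mF; rewrite preimage_bigcup; exact: sigma_algebra_bigcup.
move=> _ [r ->]; rewrite /H/=.
pose F (p : rat * nat) :=
  if ratr p.1 < r then lower_box (\row_j if j == i then p.1 else p.2%:R)
  else set0.
rewrite (_ : _ @^-1` _ = \bigcup_p F p); last first.
  apply/seteqP; split=> x; rewrite /preimage/= in_itv/=; last first.
    move=> [[q n] _]; rewrite /F/=; case: ifPn => // qr /(_ i).
    by rewrite mxE eqxx => /lt_trans; exact.
  move=> xr; have [q] := rat_in_itvoo xr; rewrite in_itv/= => /andP[xq qr].
  exists (q, (\max_(j < d) Num.bound (x ord0 j))%N) => //.
  rewrite /F/= qr => j; rewrite mxE.
  case: eqP => [->//|_]; rewrite ratr_nat.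
  apply: le_lt_trans (ler_norm _) _.
  apply: lt_le_trans (archi_boundP (normr_ge0 (x ord0 j))) _.
  rewrite ler_nat; apply: leq_trans (leq_bigmax j).
  by rewrite /Num.bound/= normr_id.
apply: (@countable_bigcupT_measurable _
  (g_sigma_algebraType (range lower_box))) => // p.
rewrite /F; case: ifPn => _; first by apply: sub_sigma_algebra; eexists.
exact: sigma_algebra0.
Qed.

(** The lower boxes are stable under intersection and generate the Borel
    sets, so Dynkin's theorem applies; their corners are rational in order
    that the same boxes provide a countable dense set in L^2. *)
Lemma lower_box_ind (P : set E -> Prop) :
  P setT -> (forall q, P (lower_box q)) ->
  (forall S, measurable S -> P S -> P (~` S)) ->
  (forall F : (set E)^nat, (forall n, measurable (F n)) ->
     trivIset setT F -> (forall n, P (F n)) -> P (\bigcup_k F k)) ->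
  forall S, measurable S -> P S.
Proof.
move=> PT Pbox PC PU S mS.
apply: (@dynkin_induction _ _ _ P lower_box_generate) => //.
- move=> _ _ [q1 _ <-] [q2 _ <-]; rewrite lower_boxI; by eexists.
- by move=> _ [q _ <-].
- by rewrite -lower_box_generate.
Qed.

Definition open_cube (p : 'rV[rat]_d * nat) : set E :=
  [set x | forall i, `|x ord0 i - ratr (p.1 ord0 i)| < p.2.+1%:R^-1].

Definition closed_cube (p : 'rV[rat]_d * nat) : set E :=
  [set x | forall i, `|x ord0 i - ratr (p.1 ord0 i)| <= p.2.+1%:R^-1].

Lemma measurable_open_cube p : measurable (open_cube p).
Proof.
apply: (@measurable_coordwise
  (fun i => [set y | `|y - ratr (p.1 ord0 i)| < p.2.+1%:R^-1])) => i.
rewrite (_ : [set _ | _] =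
  `]ratr (p.1 ord0 i) - p.2.+1%:R^-1, ratr (p.1 ord0 i) + p.2.+1%:R^-1[%classic).
  exact: measurable_itv.
by apply/seteqP; split=> y /=; rewrite in_itv/= ltr_distl.
Qed.

Lemma compact_closed_cube p : compact (closed_cube p).
Proof.
pose A i : set R :=
  `[ratr (p.1 ord0 i) - p.2.+1%:R^-1, ratr (p.1 ord0 i) + p.2.+1%:R^-1]%classic.
rewrite (_ : closed_cube p = [set v | forall i, A i (v ord0 i)]).
  by apply: (@rV_compact R d A) => i; exact: segment_compact.
apply/seteqP; split=> y h i; have := h i; rewrite /A/= in_itv/= ler_distl//.
Qed.

Lemma sub_open_closed_cube p : open_cube p `<=` closed_cube p.
Proof. by move=> x h i; exact/ltW. Qed.

Lemma open_cube_cover (A : set E) x : open A -> A x ->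
  exists p, open_cube p x /\ closed_cube p `<=` A.
Proof.
move=> oA Ax; have /nbhs_ballP[e /= e0 eA] := open_nbhs_nbhs (conj oA Ax).
pose n := Num.bound (2 / e); pose r : R := n.+1%:R^-1.
have r0 : 0 < r by rewrite invr_gt0.
have re : r + r < e.
  rewrite -mulr2n -mulr_natl -ltr_pdivlMl// /r.
  have h : 2 / e < n.+1%:R.
    apply: lt_le_trans (archi_boundP _) _; first by rewrite divr_ge0// ltW.
    by rewrite ler_nat.
  by rewrite -(invrK (2^-1 * e)) ltf_pV2 ?posrE ?invr_gt0 ?mulr_gt0// invfM invrK.
have qP i : exists q : rat, `|x ord0 i - ratr q| < r.
  have : x ord0 i - r < x ord0 i + r by lra.
  move=> /rat_in_itvoo[q]; rewrite in_itv/= => h; exists q.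
  by rewrite distrC ltr_distl.
exists (\row_i sval (cid (qP i)), n); split => [i|y h].
  by rewrite /= mxE; case: cid.
apply: eA; split=> // i j; rewrite (ord1 i) /ball/=.
have := h j; rewrite /= mxE; case: cid => q /= xq yq.
rewrite -(subrKA (ratr q)); apply: le_lt_trans (ler_normD _ _) _.
apply: lt_trans re; rewrite ltr_leD// distrC //.
Qed.

Lemma open_cubeE (A : set E) : open A ->
  A = \bigcup_(p in [set p | closed_cube p `<=` A]) open_cube p.
Proof.
move=> oA; apply/seteqP; split=> [x Ax|x [p pA px]].
  by have [p [px pA]] := open_cube_cover oA Ax; exists p.
exact/pA/sub_open_closed_cube.
Qed.

(** An open set is the union of those rational cubes of which it contains
    the closure, and there are countably many of them; this ties the
    sigma-algebra generated by the coordinates to the topology. *)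
Lemma open_measurable_rV (A : set E) : open A -> measurable A.
Proof.
move=> oA; rewrite (_ : A = \bigcup_p
    if `[< closed_cube p `<=` A >] then open_cube p else set0).
  apply: countable_bigcupT_measurable => // p.
  by case: ifPn => // _; exact: measurable_open_cube.
rewrite {1}(open_cubeE oA); apply/seteqP; split => x [p].
  by move=> pA px; exists p => //; rewrite asboolT.
by move=> _; case: ifPn => // /asboolP pA px; exists p.
Qed.

Lemma closed_measurable_rV (A : set E) : closed A -> measurable A.
Proof.
by move=> cA; rewrite -(setCK A); apply: measurableC; apply: open_measurable_rV; exact: closed_openC.
Qed.

Lemma compact_measurable_rV (A : set E) : compact A -> measurable A.
Proof.
by move=> cA; apply: closed_measurable_rV; apply: compact_closed.
Qed.

Lemma continuous_measurable_rV (f : E -> R) : continuous f ->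
  measurable_fun setT f.
Proof.
move=> cf; apply: (measurability _ (RGenOpens.measurableE R)).
move=> _ [_ [a [b ->]] <-]; rewrite setTI; apply: open_measurable_rV.
by apply: open_comp; [move=> x _; exact: cf|exact: interval_open].
Qed.

End borel_rV.

(** * Finite measure of bounded sets *)

Section finite_measure_rV.
Context (R : realType).

Lemma le_coord_norm d (x : 'rV[R]_d) i : `|x ord0 i| <= `|x|.
Proof.
rewrite [leRHS]/Num.norm/= mx_normrE.
exact: (le_bigmax _ (fun ij => `|x ij.1 ij.2|) (ord0, i)).
Qed.

Lemma lebesgue_rV_cube_fin d (M : R) :
  (lebesgue_rV d
     [set x : 'rV[R]_d | forall i, (x ord0 i \in `[- M, M])%R]%R < +oo)%E.
Proof.
elim: d => [|d IH]; first by rewrite /= diracE; case: (_ \in _) => /=; rewrite ltry.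
rewrite /= /lebesgue_rV_step /pushforward.
rewrite (_ : _ @^-1` _ =
  (`[- M, M]%classic : set (measurableTypeR R)) `*`
  [set x : 'rV[R]_d | forall i, x ord0 i \in `[- M, M]]); last first.
  apply/seteqP; split => -[a v] /=.
    move=> h; split; first by have := h ord0; rewrite /rV_cons mxE unlift_none.
    by move=> i; have := h (lift ord0 i); rewrite /rV_cons mxE liftK.
  move=> [h1 h2] i; rewrite /rV_cons mxE /=.
  by case: (unliftP ord0 i) => [j|] _ /=; [exact: h2|exact: h1].
rewrite product_measure1E//; last exact: (@measurable_coordwise R d (fun=> `[- M, M]%classic)).
rewrite lte_mul_pinfty// ?ge0_fin_numE//.
  change (lebesgue_measure `[(- M)%R, M]%classic < +oo)%E.
  by rewrite lebesgue_measure_itv/=; case: ifP => _; rewrite ltry.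
Qed.

Lemma lebesgue_rV_bounded d (A : set 'rV[R]_d) : measurable A ->
  bounded_set A -> (lebesgue_rV d A < +oo)%E.
Proof.
move=> mA [M [_ hM]].
apply: le_lt_trans (lebesgue_rV_cube_fin d (M + 1)).
apply: le_measure; rewrite ?inE//.
  by apply: (@measurable_coordwise R d (fun=> `[- (M + 1), M + 1]%classic)).
move=> x Ax i /=; rewrite in_itv/= -ler_norml.
by apply: le_trans (le_coord_norm x i) (hM (M + 1) _ x Ax); rewrite ltrDl.
Qed.

End finite_measure_rV.

(** * Square-integrable functions *)

Section L2_theory.
Context (R : realType) (d : nat).
Local Notation E := 'rV[R]_d.
Local Notation lam := (lebesgue_rV d : {measure set E -> \bar R}).
Variable Om : set E.
Hypothesis mOm : measurable Om.
Implicit Types f g m : E -> R.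

Definition integrableR f := lam.-integrable Om (EFin \o f).

Lemma integrableRD f g : integrableR f -> integrableR g ->
  integrableR (fun x => f x + g x).
Proof. by move=> fi gi; exact: (integrableD mOm fi gi). Qed.

Lemma integrableRZ (c : R) f : integrableR f -> integrableR (fun x => c * f x).
Proof. by move=> fi; exact: (integrableZl mOm c fi). Qed.

Lemma integrableRN f : integrableR f -> integrableR (fun x => - f x).
Proof. by move=> fi; exact: (integrableN fi). Qed.

Lemma integrableRB f g : integrableR f -> integrableR g ->
  integrableR (fun x => f x - g x).
Proof. by move=> fi gi; exact: (integrableB mOm fi gi). Qed.

Lemma integrableR0 : integrableR (fun=> 0).
Proof. exact: integrable0. Qed.

Lemma integrableR_sum (I : Type) (r : seq I) (P : pred I) (F : I -> E -> R) :
  (forall i, P i -> integrableR (F i)) ->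
  integrableR (fun x => \sum_(i <- r | P i) F i x).
Proof.
move=> iF; rewrite -fct_sumE.
by apply: (big_ind integrableR) => //; [exact: integrableR0|exact: integrableRD].
Qed.

Lemma Rintegral_sum (I : Type) (r : seq I) (P : pred I) (F : I -> E -> R) :
  (forall i, P i -> integrableR (F i)) ->
  \int[lam]_(x in Om) (\sum_(i <- r | P i) F i x) =
  \sum_(i <- r | P i) \int[lam]_(x in Om) F i x.
Proof.
move=> iF; elim: r => [|i r IH].
  rewrite big_nil; under eq_Rintegral do rewrite big_nil.
  by rewrite Rintegral_cst// mul0r.
rewrite big_cons; under eq_Rintegral do rewrite big_cons.
case: ifP => Pi //.
by rewrite RintegralD ?IH//; [exact: iF|exact: integrableR_sum].
Qed.

Lemma integrableR_measurable f : integrableR f -> measurable_fun Om f.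
Proof. by move=> /measurable_int/measurable_EFinP. Qed.

Lemma integrableR_le f g : measurable_fun Om f ->
  (forall x, Om x -> `|f x| <= g x) -> integrableR g -> integrableR f.
Proof.
move=> mf fg; apply: le_integrable => //; first exact/measurable_EFinP.
by move=> x Ox /=; rewrite lee_fin (le_trans (fg _ Ox))// ler_norm.
Qed.

Lemma L2_sqr_integrable f : L2 Om f -> integrableR (fun x => f x ^+ 2).
Proof.
move=> [mf foo]; apply/integrableP; split.
  by apply/measurable_EFinP; exact: measurable_funX.
apply: le_lt_trans foo; apply: le_integral_all => // x _ /=.
by rewrite ger0_norm ?sqr_ge0.
Qed.

Lemma sqr_integrable_L2 f : measurable_fun Om f ->
  integrableR (fun x => f x ^+ 2) -> L2 Om f.
Proof.
move=> mf /integrableP[_ foo]; split=> //; apply: le_lt_trans foo.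
by apply: le_integral_all => // x _ /=; rewrite lee_fin ler_norm.
Qed.

Lemma L2M_integrable f g : L2 Om f -> L2 Om g ->
  integrableR (fun x => f x * g x).
Proof.
move=> Lf Lg; have [mf _] := Lf; have [mg _] := Lg.
apply: (@integrableR_le _ (fun x => f x ^+ 2 + g x ^+ 2)).
- exact: measurable_funM.
- move=> x _; rewrite normrM -[f x ^+ 2]real_normK ?num_real//.
  rewrite -[g x ^+ 2]real_normK ?num_real//.
  by have := normr_ge0 (f x); have := normr_ge0 (g x); nra.
- by apply: integrableRD; exact: L2_sqr_integrable.
Qed.

Lemma L2_Mbounded m f (K : R) : measurable_fun Om m ->
  (forall x, Om x -> `|m x| <= K) -> L2 Om f -> L2 Om (fun x => m x * f x).
Proof.
move=> mm mK Lf; have [mf _] := Lf.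
apply: sqr_integrable_L2; first exact: measurable_funM.
apply: (@integrableR_le _ (fun x => K ^+ 2 * f x ^+ 2)).
- by apply: measurable_funX; exact: measurable_funM.
- move=> x Ox; rewrite ger0_norm ?sqr_ge0// exprMn ler_wpM2r ?sqr_ge0//.
  by rewrite -[m x ^+ 2]real_normK ?num_real// lerXn2r ?nnegrE// ?mK// (le_trans _ (mK _ Ox)).
- by apply: integrableRZ; exact: L2_sqr_integrable.
Qed.

Lemma L2Z (c : R) f : L2 Om f -> L2 Om (fun x => c * f x).
Proof. by move=> Lf; apply: (@L2_Mbounded (fun=> c) f `|c|) => //. Qed.

Lemma L2D f g : L2 Om f -> L2 Om g -> L2 Om (fun x => f x + g x).
Proof.
move=> Lf Lg; have [mf _] := Lf; have [mg _] := Lg.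
apply: sqr_integrable_L2; first exact: measurable_funD.
rewrite (_ : (fun x => _) =
  fun x => f x ^+ 2 + (2 * (f x * g x) + g x ^+ 2)); last first.
  by apply/funext => x; ring.
apply: integrableRD; first exact: L2_sqr_integrable.
apply: integrableRD; last exact: L2_sqr_integrable.
by apply: integrableRZ; exact: L2M_integrable.
Qed.

Lemma L2N f : L2 Om f -> L2 Om (fun x => - f x).
Proof. by move=> /(L2Z (-1)); under eq_fun do rewrite mulN1r. Qed.

Lemma L2B f g : L2 Om f -> L2 Om g -> L2 Om (fun x => f x - g x).
Proof. by move=> Lf Lg; apply: L2D => //; exact: L2N. Qed.

Lemma L20 : L2 Om (fun=> 0).
Proof.
by split => //; rewrite integral0_eq ?ltry// => x _; rewrite expr0n.
Qed.

Lemma L2_sum (I : Type) (r : seq I) (P : pred I) (F : I -> E -> R) :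
  (forall i, P i -> L2 Om (F i)) -> L2 Om (fun x => \sum_(i <- r | P i) F i x).
Proof.
move=> iF; rewrite -fct_sumE.
by apply: (big_ind (L2 Om)) => //; [exact: L20|exact: L2D].
Qed.

Definition ae_on (P : E -> Prop) : Prop := {ae lam, forall x, Om x -> P x}.

Lemma ae_onI (P Q : E -> Prop) : ae_on P -> ae_on Q ->
  ae_on (fun x => P x /\ Q x).
Proof. by rewrite /ae_on => hP hQ; apply: filterS2 hP hQ => x p q Ox; split; auto. Qed.

Lemma ae_onS (P Q : E -> Prop) : (forall x, Om x -> P x -> Q x) ->
  ae_on P -> ae_on Q.
Proof. by rewrite /ae_on => PQ; apply: filterS => x h Ox; apply: PQ => //; exact: h. Qed.

Lemma ae_on_all (P : E -> Prop) : (forall x, Om x -> P x) -> ae_on P.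
Proof. by rewrite /ae_on => h; apply: aeW => x Ox; exact: h. Qed.

Lemma ae_on_fin (I : finType) (P : I -> E -> Prop) : (forall i, ae_on (P i)) ->
  ae_on (fun x => forall i, P i x).
Proof.
rewrite /ae_on => h; suff: {ae lam, forall x i, Om x -> P i x}.
  by apply: filterS => x H Ox i; exact: H.
by apply: filter_forall => i; exact: h.
Qed.

Lemma ae_eq_Rintegral f g : measurable_fun Om f -> measurable_fun Om g ->
  ae_on (fun x => f x = g x) ->
  \int[lam]_(x in Om) f x = \int[lam]_(x in Om) g x.
Proof.
move=> mf mg fg; congr fine; apply: ae_eq_integral => //.
- exact/measurable_EFinP.
- exact/measurable_EFinP.
- by apply: ae_onS fg => x _ /= ->.
Qed.

Lemma L2_ae f g : L2 Om f -> measurable_fun Om g ->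
  ae_on (fun x => f x = g x) -> L2 Om g.
Proof.
move=> [mf foo] mg fg; split=> //; rewrite (_ : integral _ _ _ =
  \int[lam]_(x in Om) (f x ^+ 2)%:E)%E//.
apply: ae_eq_integral => //.
- by apply/measurable_EFinP; exact: measurable_funX.
- by apply/measurable_EFinP; exact: measurable_funX.
- by apply: ae_onS fg => x _ ->.
Qed.

Definition L2sq f : R := \int[lam]_(x in Om) (f x ^+ 2).
Definition L2norm f : R := Num.sqrt (L2sq f).

Lemma L2sq_ge0 f : 0 <= L2sq f.
Proof. by apply: Rintegral_ge0 => x _; exact: sqr_ge0. Qed.

Lemma discriminant_le (a b c : R) : 0 <= a -> 0 <= c ->
  (forall s, 0 <= s ^+ 2 * a + 2 * s * b + c) -> b ^+ 2 <= a * c.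
Proof.
move=> a0 c0 h; have [a00|an0] := eqVneq a 0.
  rewrite a00 mul0r; have [->|bn0] := eqVneq b 0; first by rewrite expr0n.
  exfalso; have := h (- (c + 1) / b); rewrite a00 mulr0 add0r.
  rewrite mulrA [2 * _]mulrC -!mulrA mulVf// mulr1 => ?; lra.
have ap : 0 < a by rewrite lt_neqAle eq_sym an0.
have := h (- b / a) => H.
have : 0 <= a * ((- b / a) ^+ 2 * a + 2 * (- b / a) * b + c).
  by rewrite mulr_ge0.
rewrite (_ : a * _ = a * c - b ^+ 2); last by field.
lra.
Qed.

Lemma L2_cauchy_schwarz f g : L2 Om f -> L2 Om g ->
  `|\int[lam]_(x in Om) (f x * g x)| <= L2norm f * L2norm g.
Proof.
move=> Lf Lg; rewrite /L2norm -sqrtrM ?L2sq_ge0// -sqrtr_sqr.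
apply: ler_wsqrtr; apply: discriminant_le; rewrite ?L2sq_ge0// => s.
have fg := L2M_integrable Lf Lg.
have ff := L2_sqr_integrable Lf; have gg := L2_sqr_integrable Lg.
rewrite -!RintegralZl// -!RintegralD//; try exact: integrableRZ.
  apply: Rintegral_ge0 => x _.
  rewrite (_ : _ + _ = (s * f x + g x) ^+ 2) ?sqr_ge0//; ring.
by apply: integrableRD; exact: integrableRZ.
Qed.

End L2_theory.

(** * Functions of class C^1 *)

Section C1_functions.
Context (R : realType) (E : normedModType R).
Implicit Types (f g : E -> R).

Lemma Ck1I f (f' : E -> E -> R) : continuous f ->
  (forall x v, is_derive x v f (f' v x)) -> (forall v, continuous (f' v)) ->
  Ck 1 f.
Proof.
move=> cf df cf'; split => //; split => [x v|v].
  by have [] := df x v.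
split=> //; rewrite (_ : 'D_v f = f' v)//.
by apply/funext => x; exact: derive_val.
Qed.

Lemma Ck1_continuous f : Ck 1 f -> continuous f. Proof. by case. Qed.

Lemma Ck1_derivable f x v : Ck 1 f -> derivable f x v.
Proof. by move=> [_ []]. Qed.

Lemma Ck1_is_derive f x v : Ck 1 f -> is_derive x v f ('D_v f x).
Proof. by move=> /Ck1_derivable h; split. Qed.

Lemma Ck1_derive_continuous f v : Ck 1 f -> continuous ('D_v f).
Proof. by move=> [_ [_ /(_ v)[]]]. Qed.

Lemma Ck1_cst (c : R) : Ck 1 (cst c : E -> R).
Proof.
apply: (@Ck1I _ (fun _ _ => 0)).
- exact: cst_continuous.
- by move=> v; exact: cst_continuous.
Qed.

Lemma Ck1M f g : Ck 1 f -> Ck 1 g -> Ck 1 (fun x => f x * g x).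
Proof.
move=> cf cg.
have fc := Ck1_continuous cf; have gc := Ck1_continuous cg.
have fc' v := Ck1_derive_continuous (v := v) cf.
have gc' v := Ck1_derive_continuous (v := v) cg.
apply: (@Ck1I _ (fun v x => f x * 'D_v g x + g x * 'D_v f x)).
- by move=> x; apply: cvgM; [exact: fc|exact: gc].
- by move=> x v; apply: is_deriveM; exact: Ck1_is_derive.
- move=> v x; apply: cvgD; apply: cvgM.
  + exact: fc.
  + exact: gc'.
  + exact: gc.
  + exact: fc'.
Qed.

Lemma Ck1D f g : Ck 1 f -> Ck 1 g -> Ck 1 (fun x => f x + g x).
Proof.
move=> cf cg.
have fc := Ck1_continuous cf; have gc := Ck1_continuous cg.
have fc' v := Ck1_derive_continuous (v := v) cf.
have gc' v := Ck1_derive_continuous (v := v) cg.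
apply: (@Ck1I _ (fun v x => 'D_v f x + 'D_v g x)).
- by move=> x; apply: cvgD; [exact: fc|exact: gc].
- by move=> x v; apply: is_deriveD; exact: Ck1_is_derive.
- move=> v x.
  by apply: cvgD; [exact: fc'|exact: gc'].
Qed.

Lemma Ck1V f : (forall x, f x != 0) -> Ck 1 f -> Ck 1 (fun x => (f x)^-1).
Proof.
move=> f0 cf.
have fc := Ck1_continuous cf.
have fc' v := Ck1_derive_continuous (v := v) cf.
apply: (@Ck1I _ (fun v x => - (f x) ^- 2 * 'D_v f x)).
- by move=> x; apply: cvgV => //; exact: fc.
- move=> x v; split; first by apply: derivableV => //; exact: Ck1_derivable.
  by rewrite deriveV//; exact: Ck1_derivable.
- move=> v x; apply: cvgM; last exact: fc'.
  apply: cvgN; apply: cvgV; first by rewrite expf_neq0.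
  under eq_fun do rewrite expr2.
  rewrite expr2.
  by apply: cvgM; exact: fc.
Qed.

Lemma Ck1_prod (I : Type) (r : seq I) (F : I -> E -> R) :
  (forall i, Ck 1 (F i)) -> Ck 1 (fun x => \prod_(i <- r) F i x).
Proof.
move=> cF; elim: r => [|i r IH].
  rewrite (_ : (fun x => _) = cst 1); first exact: Ck1_cst.
  by apply/funext => x; rewrite big_nil.
rewrite (_ : (fun x => _) = fun x => F i x * \prod_(j <- r) F j x).
  exact: (Ck1M (cF i) IH).
by apply/funext => x; rewrite big_cons.
Qed.

(** Allows the squared positive part to be differentiated without a case
    distinction at its singular point. *)
Lemma is_derive_quadratic f x v (l K : R) :
  (forall h, `|f (h *: v + x) - f x - h * l| <= K * h ^+ 2) ->
  is_derive x v f l.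
Proof.
move=> H; have K0 : 0 <= K.
  by have := H 1; rewrite expr1n mulr1; exact: le_trans.
suff h : h^-1 *: ((f \o shift x) (h *: v) - f x) @[h --> 0^'] --> l.
  by split; [apply/cvg_ex; exists l|apply/cvg_lim].
apply/cvgrPdist_le => e e0.
have K1 : 0 < e / (K + 1) by rewrite divr_gt0// ltr_wpDl.
near=> h.
have h0 : h != 0 by near: h; exact: nbhs_dnbhs_neq.
have hs : `|h| <= e / (K + 1).
  near: h; apply: dnbhs0_le; exact: K1.
rewrite -[l](mulKf h0) -mulrBr normrM normfV ler_pdivrMl ?normr_gt0//.
rewrite -normrN opprB; apply: le_trans (H h) _.
rewrite -[h ^+ 2]real_normK ?num_real// expr2 mulrCA ler_wpM2l//.
apply: (@le_trans _ _ (K * (e / (K + 1)))); first by rewrite ler_wpM2l.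
rewrite mulrCA ler_piMr ?(ltW e0)// ler_pdivrMr ?mul1r ?lerDl//.
by rewrite ltr_wpDl.
Unshelve. all: by end_near. Qed.

End C1_functions.

Section pos_sqr.
Context (R : realType).

(** The square of the positive part. *)
Definition pos_sqr (s : R) : R := (s * (s + `|s|)) / 2.

Lemma pos_sqr_taylor (s h : R) :
  `|pos_sqr (s + h) - pos_sqr s - h * (s + `|s|)| <= h ^+ 2.
Proof.
rewrite /pos_sqr ler_norml.
case: (ger0P (s + h)) => h1; case: (ger0P s) => h2; apply/andP; split; nra.
Qed.

Lemma pos_sqr_gt0 s : (0 < pos_sqr s) = (0 < s).
Proof.
rewrite /pos_sqr; case: (ger0P s) => s0; apply/idP/idP => h; nra.
Qed.

Lemma pos_sqr_ge0 s : 0 <= pos_sqr s.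
Proof. rewrite /pos_sqr; case: (ger0P s) => s0; nra. Qed.

Lemma Ck1_pos_sqr (E : normedModType R) (l : E -> R) (c e : R) :
  (forall h v x, l (h *: v + x) = h * l v + l x) -> continuous l ->
  Ck 1 (fun x : E => pos_sqr (c * l x + e)).
Proof.
move=> lin cl0.
have cl : continuous (fun x : E => c * l x + e).
  move=> x; apply: cvgD; last exact: cvg_cst.
  by apply: cvgM; [exact: cvg_cst|exact: cl0].
have cl' : continuous (fun x : E => c * l x + e + `|c * l x + e|).
  move=> x; apply: cvgD; first exact: cl.
  by apply: cvg_norm; exact: cl.
apply: (@Ck1I _ _ _
  (fun v x => c * l v * (c * l x + e + `|c * l x + e|))).
- move=> x; apply: cvgM; last exact: cvg_cst.
  by apply: cvgM; [exact: cl|exact: cl'].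
- move=> x v; apply: (@is_derive_quadratic _ _ _ _ _ _ ((c * l v) ^+ 2)) => h.
  have := pos_sqr_taylor (c * l x + e) (h * (c * l v)).
  have -> : c * l (h *: v + x) + e = c * l x + e + h * (c * l v).
    by rewrite lin; ring.
  have -> : (c * l v) ^+ 2 * h ^+ 2 = (h * (c * l v)) ^+ 2 by ring.
  by rewrite -(mulrA h (c * l v)).
- by move=> v x; apply: cvgM; [exact: cvg_cst|exact: cl'].
Qed.

End pos_sqr.

(** * The fundamental lemma of the calculus of variations *)

Lemma ae_forall_countable dp (T : measurableType dp) (R : realType)
    (mu : {measure set T -> \bar R}) (I : countType) (P : I -> T -> Prop) :
  (forall i, {ae mu, forall x, P i x}) -> {ae mu, forall x, forall i, P i x}.
Proof.
move=> h.
have : {ae mu, forall x (n : nat), if unpickle n is Some i then P i x else True}.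
  by apply: ae_foralln => n; case: (unpickle n) => [i|]; [exact: h|exact: aeW].
by apply: filterS => x H i; have := H (pickle i); rewrite pickleK.
Qed.

Lemma continuous_compact_le (R : realType) (T : topologicalType) (f : T -> R)
    (K : set T) : continuous f -> compact K ->
  exists M : R, 0 <= M /\ forall x, K x -> `|f x| <= M.
Proof.
move=> cf cK.
have /compact_bounded[M [_ hM]] : compact (f @` K).
  by apply: continuous_compact => //; exact: continuous_subspaceT.
exists (`|M| + 1); split; first by rewrite addr_ge0.
move=> x Kx; apply: (hM (`|M| + 1)); last by exists x.
by rewrite (le_lt_trans (ler_norm _))// ltrDl.
Qed.

Section fundamental_lemma.
Context (R : realType) (d : nat).
Local Notation E := 'rV[R]_d.
Local Notation lam := (lebesgue_rV d : {measure set E -> \bar R}).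

Definition open_box (a b : 'I_d -> R) : set E :=
  [set x | forall i, a i < x ord0 i < b i].

Definition closed_box (a b : 'I_d -> R) : set E :=
  [set x | forall i, a i <= x ord0 i <= b i].

Lemma measurable_open_box a b : measurable (open_box a b).
Proof.
apply: (@measurable_coordwise R d (fun i => [set y | a i < y < b i])) => i.
rewrite (_ : [set _ | _] = `]a i, b i[%classic); first exact: measurable_itv.
by apply/seteqP; split=> y /=; rewrite in_itv.
Qed.

Lemma compact_closed_box a b : compact (closed_box a b).
Proof.
pose A i : set R := `[a i, b i]%classic.
rewrite (_ : closed_box a b = [set v | forall i, A i (v ord0 i)]).
  by apply: (@rV_compact R d A) => i; exact: segment_compact.
by apply/seteqP; split=> y h i; have := h i; rewrite /A/= in_itv/=.
Qed.

Lemma sub_open_closed_box a b : open_box a b `<=` closed_box a b.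
Proof. by move=> x h i; have /andP[/ltW -> /ltW ->] := h i. Qed.

(** Of class C^1, and positive exactly in the open box. *)
Definition box_weight (a b : 'I_d -> R) (x : E) : R :=
  \prod_i (pos_sqr (x ord0 i - a i) * pos_sqr (b i - x ord0 i)).

(** This is n w / (1 + n w) for the weight w, which tends to the indicator of
    the box while staying between 0 and 1. *)
Definition bump (a b : 'I_d -> R) (n : nat) (x : E) : R :=
  1 - (1 + n%:R * box_weight a b x)^-1.

Lemma box_weight_ge0 a b x : 0 <= box_weight a b x.
Proof. by apply: prodr_ge0 => i _; rewrite mulr_ge0 ?pos_sqr_ge0. Qed.

Lemma box_weight_gt0 a b x : open_box a b x -> 0 < box_weight a b x.
Proof.
move=> h; apply: prodr_gt0 => i _; have /andP[h1 h2] := h i.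
by rewrite mulr_gt0 ?pos_sqr_gt0 ?subr_gt0.
Qed.

Lemma pos_sqr_eq0 s : s <= 0 -> pos_sqr s = 0 :> R.
Proof. by move=> s0; rewrite /pos_sqr ler0_norm// subrr mulr0 mul0r. Qed.

Lemma box_weight_eq0 a b x : ~ open_box a b x -> box_weight a b x = 0.
Proof.
move=> /existsNP[i /negP]; rewrite negb_and -!leNgt => h.
rewrite /box_weight (bigD1 i)//=.
case/orP: h => h.
  by rewrite (@pos_sqr_eq0 (x ord0 i - a i)) ?subr_le0// !mul0r.
by rewrite (@pos_sqr_eq0 (b i - x ord0 i)) ?subr_le0// mulr0 mul0r.
Qed.

Lemma Ck1_box_weight a b : Ck 1 (box_weight a b).
Proof.
have cc i : continuous (fun x : E => x ord0 i) by exact: coord_continuous.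
have lin i h (v x : E) : (h *: v + x) ord0 i = h * v ord0 i + x ord0 i.
  by rewrite !mxE.
apply: Ck1_prod => i; apply: Ck1M.
  have := Ck1_pos_sqr 1 (- a i) (lin i) (@cc i).
  by under eq_fun do rewrite mul1r.
have := Ck1_pos_sqr (-1) (b i) (lin i) (@cc i).
by under eq_fun do rewrite mulN1r addrC.
Qed.

Lemma bump_den_gt0 a b n x : 0 < 1 + n%:R * box_weight a b x.
Proof. by rewrite ltr_wpDr// mulr_ge0// box_weight_ge0. Qed.

Lemma Ck1_bump a b n : Ck 1 (bump a b n).
Proof.
rewrite (_ : bump a b n = fun x => cst 1 x +
  cst (- 1) x * (cst 1 x + cst n%:R x * box_weight a b x)^-1); last first.
  by apply/funext => x; rewrite /bump mulN1r.
apply: Ck1D; first exact: Ck1_cst.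
apply: Ck1M; first exact: Ck1_cst.
apply: Ck1V; first by move=> x; rewrite gt_eqF// bump_den_gt0.
apply: Ck1D; first exact: Ck1_cst.
by apply: Ck1M; [exact: Ck1_cst|exact: Ck1_box_weight].
Qed.

Lemma bump_eq0 a b n x : ~ open_box a b x -> bump a b n x = 0.
Proof.
by move=> h; rewrite /bump box_weight_eq0// mulr0 addr0 invr1 subrr.
Qed.

Lemma bump_le1 a b n x : `|bump a b n x| <= 1.
Proof.
rewrite /bump; set y := (_^-1).
have y0 : 0 < y by rewrite invr_gt0 bump_den_gt0.
have y1 : y <= 1.
  by rewrite invf_le1 ?bump_den_gt0// lerDl mulr_ge0// box_weight_ge0.
by rewrite ler_norml; lra.
Qed.

Lemma bump_cvg a b x : bump a b n x @[n --> \oo] --> (\1_(open_box a b) x : R).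
Proof.
have [h|h] := pselect (open_box a b x); last first.
  rewrite indicE memNset//=.
  under eq_cvg do rewrite (bump_eq0 _ h).
  exact: cvg_cst.
rewrite indicE mem_set//= /bump.
rewrite -[X in _ --> X]subr0; apply: cvgB; first exact: cvg_cst.
have w0 := box_weight_gt0 h; set w := box_weight a b x in w0 *.
have c0 : harmonic n * (1 + w^-1) @[n --> \oo] --> (0 : R).
  by rewrite -[X in _ --> X](mul0r (1 + w^-1)); apply: cvgMr_tmp; exact: cvg_harmonic.
apply: (squeeze_cvgr _ (cvg_cst 0) c0).
apply: nearW => n; have p1 : 0 < 1 + n%:R * w.
  by rewrite ltr_wpDr// mulr_ge0// ltW.
rewrite invr_ge0 (ltW p1)/= [leRHS]mulrC ler_pdivlMr// mulrC ler_pdivrMr//.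
rewrite mulrDl mul1r mulrDr mulr1 mulrCA mulVf ?gt_eqF// mulr1 -natr1.
have : 0 <= n%:R * w by rewrite mulr_ge0// ltW.
have : 0 <= w^-1 by rewrite invr_ge0 ltW.
lra.
Qed.

Variable Om : set E.
Hypothesis oOm : open Om.
Let mOm : measurable Om. Proof. exact: open_measurable_rV. Qed.

Lemma pderiv_support (phi : E -> R) (K : set E) j : compact K ->
  (forall x, ~ K x -> phi x = 0) -> forall x, ~ K x -> pderiv j phi x = 0.
Proof.
move=> cK h x Kx; rewrite /pderiv.
rewrite (@near_eq_derive _ _ _ phi (cst 0)) ?derive_cst//.
have oK : open (~` K) by apply: closed_openC; exact: compact_closed.
have : nbhs x (~` K) by exact: open_nbhs_nbhs.
by apply: filterS => y; exact: h.
Qed.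

Lemma L1loc_test_integrable (g phi : E -> R) (K : set E) :
  L1loc Om g -> continuous phi -> compact K -> K `<=` Om ->
  (forall x, ~ K x -> phi x = 0) ->
  integrableR Om (fun x => g x * phi x).
Proof.
move=> [mg ig] cphi cK KOm phi0; rewrite /integrableR.
have mK := compact_measurable_rV cK.
have [M [M0 hM]] := continuous_compact_le cphi cK.
apply/(integrable_mkcond _ mOm).
rewrite (_ : _ \_ Om = (EFin \o (fun x => g x * phi x)) \_ K); last first.
  apply/funext => x; rewrite !patchE; case: ifPn => xOm; case: ifPn => xK //.
  - by rewrite /= phi0 ?mulr0//; move: xK; rewrite notin_setE.
  - by move: xOm; rewrite notin_setE; case; apply: KOm; rewrite -in_setE.
apply/(integrable_mkcond _ mK).
have mphi : measurable_fun K phi.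
  by apply: measurable_funTS; exact: continuous_measurable_rV.
apply: (@integrableR_le _ _ _ mK _ (fun x => M * `|g x|)).
- by apply: measurable_funM => //; exact: measurable_funS mg.
- by move=> x Kx; rewrite normrM mulrC ler_wpM2r// hM.
- apply: (integrableRZ mK).
  by apply: (integrable_norm (ig _ cK KOm)).
Qed.

(** The bumps are test functions that converge boundedly to the indicator of
    the box, so the hypothesis passes to the limit. *)
Lemma open_box_integral0 (g : E -> R) a b : L1loc Om g ->
  (forall phi : E -> R, C1c Om phi ->
     \int[lam]_(x in Om) (g x * phi x) = 0) ->
  closed_box a b `<=` Om -> (\int[lam]_(x in open_box a b) (g x)%:E = 0)%E.
Proof.
move=> Lg H sub.
have cK := @compact_closed_box a b; have mK := compact_measurable_rV cK.
have [mg ig] := Lg.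
have Kg := ig _ cK sub.
have b0 n x : ~ closed_box a b x -> bump a b n x = 0.
  by move=> h; apply: bump_eq0 => /sub_open_closed_box.
have cb n : continuous (bump a b n) by case: (Ck1_bump a b n).
have int0 n : (\int[lam]_(x in closed_box a b) (g x * bump a b n x)%:E = 0)%E.
  have it := L1loc_test_integrable Lg (cb n) cK sub (b0 n).
  have := H (bump a b n); rewrite /Rintegral => /(_ _) Hn.
  have {Hn} : fine (\int[lam]_(x in Om) (g x * bump a b n x)%:E)%E = 0.
    apply: Hn; split; first exact: Ck1_bump.
    by exists (closed_box a b); split => //; exact: b0.
  move=> /(congr1 (@EFin R)); rewrite fineK; last exact: (integrable_fin_num mOm it).
  move=> Om0; rewrite -[RHS]Om0 [RHS]integral_mkcond [LHS]integral_mkcond.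
  apply: eq_integral => x _; rewrite !patchE.
  case: ifPn => xK; case: ifPn => xOm //.
    by move: xOm; rewrite notin_setE; case; apply: sub; rewrite -in_setE.
  by rewrite b0 ?mulr0//; move: xK; rewrite notin_setE.
have mgK : measurable_fun (closed_box a b) g by exact: measurable_funS mg.
have mo := @measurable_open_box a b.
pose F n x := (g x * bump a b n x)%:E.
have mF n : measurable_fun (closed_box a b) (F n).
  apply/measurable_EFinP; apply: measurable_funM => //.
  by apply: measurable_funTS; exact: continuous_measurable_rV.
have mL : measurable_fun (closed_box a b)
    (fun x => (g x * \1_(open_box a b) x)%:E).
  apply/measurable_EFinP; apply: measurable_funM => //.
have [_ _] : [/\ lam.-integrable (closed_box a b)
                   (fun x => (g x * \1_(open_box a b) x)%:E),
    [sequence \int[lam]_(x in closed_box a b)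
       `|F n x - (g x * \1_(open_box a b) x)%:E|]_n @ \oo --> 0 &
    [sequence \int[lam]_(x in closed_box a b) F n x]_n @ \oo -->
    \int[lam]_(x in closed_box a b) (g x * \1_(open_box a b) x)%:E]%E.
  apply: (dominated_convergence mK mF mL (g := fun x => `|(g x)%:E|%E)).
  - apply: aeW => x _; apply: cvg_EFin; first exact: nearW.
    by apply: cvgM; [exact: cvg_cst|exact: bump_cvg].
  - exact: (integrable_abse Kg).
  - apply: aeW => x n _; rewrite lee_fin normrM ler_piMr//.
    exact: bump_le1.
rewrite (_ : [sequence _]_n = cst 0%E); last by apply/funext => n; exact: int0.
move=> /(cvg_lim (@ereal_hausdorff R)); rewrite lim_cst// => int_lim0.
rewrite int_lim0 integral_mkcond [RHS]integral_mkcond.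
apply: eq_integral => x _.
rewrite !patchE indicE; case: (boolP (x \in open_box a b)) => xo.
  by rewrite mem_set ?mulr1//; apply: sub_open_closed_box; rewrite -in_setE.
by case: ifP; rewrite ?mulr0.
Qed.

Lemma L1loc_open_cube (g : E -> R) p : L1loc Om g -> closed_cube p `<=` Om ->
  lam.-integrable (open_cube p) (EFin \o g).
Proof.
move=> [_ ig] sub.
apply: (integrableS _ _ (@sub_open_closed_cube R d p)).
- by apply: compact_measurable_rV; exact: compact_closed_cube.
- exact: measurable_open_cube.
- by apply: ig => //; exact: compact_closed_cube.
Qed.

(** The cube meets lower boxes in boxes, where the previous lemma applies;
    Dynkin's theorem extends this to all Borel sets. *)
Lemma open_cube_setI_integral0 (g : E -> R) p : L1loc Om g ->
  (forall phi : E -> R, C1c Om phi ->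
     \int[lam]_(x in Om) (g x * phi x) = 0) ->
  closed_cube p `<=` Om -> forall A, measurable A ->
  (\int[lam]_(x in A `&` open_cube p) (g x)%:E = 0)%E.
Proof.
move=> Lg H sub.
pose lo i := ratr (p.1 ord0 i) - p.2.+1%:R^-1 : R.
pose hi i := ratr (p.1 ord0 i) + p.2.+1%:R^-1 : R.
have oE : open_cube p = open_box lo hi.
  by apply/seteqP; split=> x h i; have := h i; rewrite ltr_distl.
have cE : closed_cube p = closed_box lo hi.
  by apply/seteqP; split=> x h i; have := h i; rewrite ler_distl.
have mQ := @measurable_open_cube R d p.
have iQ := L1loc_open_cube Lg sub.
have QT : (\int[lam]_(x in open_cube p) (g x)%:E = 0)%E.
  by rewrite oE; apply: open_box_integral0 => //; rewrite -cE.
apply: lower_box_ind => //.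
- by rewrite setTI.
- move=> q; rewrite (_ : _ `&` _ = open_box lo
      (fun i => Num.min (hi i) (ratr (q ord0 i)))).
    apply: open_box_integral0 => // x xb; apply: sub; rewrite cE => i.
    by have := xb i; rewrite le_min => /and3P[-> ->].
  rewrite oE; apply/seteqP; split=> x.
    by move=> [h1 h2] i; rewrite lt_min andbA h2 h1.
  by move=> h; split=> i; have := h i; rewrite lt_min => /and3P[? ? ?] //; apply/andP.
- move=> S mS S0.
  have : (\int[lam]_(x in (S `&` open_cube p) `|` (~` S `&` open_cube p))
            (g x)%:E = 0)%E by rewrite -setIUl setUv setTI.
  rewrite integral_setU//; last 4 first.
  + exact: measurableI.
  + by apply: measurableI => //; exact: measurableC.
  + by rewrite -setIUl setUv setTI; exact: (measurable_int _ iQ).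
  + by apply/disj_setPS => x [[Sx _] [nSx _]].
  by rewrite S0 add0e.
- move=> F mF tF F0; rewrite setI_bigcupl integral_bigcup//.
  + by rewrite eseries0// => n _ _; exact: F0.
  + by apply: trivIset_setIr.
  + by move=> k; exact: measurableI.
  + rewrite -setI_bigcupl; apply: integrableS iQ => //.
    by apply: measurableI => //; exact: bigcup_measurable.
Qed.

(** The fundamental lemma of the calculus of variations: in each of the
    countably many rational cubes, [g] has zero integral over all Borel
    sets. *)
Lemma test_integral0_ae (g : E -> R) : L1loc Om g ->
  (forall phi : E -> R, C1c Om phi ->
     \int[lam]_(x in Om) (g x * phi x) = 0) ->
  ae_on Om (fun x => g x = 0).
Proof.
move=> Lg H.
have hp : forall p, {ae lam, forall x, closed_cube p `<=` Om -> open_cube p x ->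
    g x = 0}.
  move=> p; have [pOm|npOm] := pselect (closed_cube p `<=` Om); last first.
    exact: aeW.
  have mQ := @measurable_open_cube R d p.
  have iQ := L1loc_open_cube Lg pOm.
  have := @integral_ae_eq _ _ _ lam _ mQ (cst 0%E) (EFin \o g) iQ
    (@measurable_cst _ _ _ _ _ _).
  move=> /(_ _)/wrap[]; last by apply: filterS => x h _ /h[].
  move=> A AQ mA; rewrite integral0 -(setIidl AQ).
  exact: open_cube_setI_integral0.
have := ae_forall_countable hp.
rewrite /ae_on; apply: filterS => x h Ox.
by have [p [px pOm]] := open_cube_cover oOm Ox; exact: (h p).
Qed.

End fundamental_lemma.

(** * Integrals of derivatives over R^d *)

Section integral_of_derivative.
Context (R : realType).
Local Notation leb := (@lebesgue_measure R).

Lemma continuous_normr_comp (T : topologicalType) (f : T -> R) :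
  continuous f -> continuous (fun t => `|f t|).
Proof. by move=> cf t; apply: cvg_norm; exact: cf. Qed.

Lemma continuous_rowP (T : topologicalType) n (f : T -> 'rV[R]_n) :
  (forall j, continuous (fun t => f t ord0 j)) -> continuous f.
Proof.
move=> cf t; apply/cvg_ballP => e e0.
suff : \forall s \near t, forall j : 'I_n, ball (f t ord0 j) e (f s ord0 j).
  by apply: filterS => s h; split=> // i j; rewrite (ord1 i); exact: h.
apply: filter_forall => j; move: (cf j t) => /cvg_ballP; exact.
Qed.

Lemma derive_affine_comp (V W : normedModType R) (phi : W -> R) (g : V -> W)
    (x v : V) (w : W) : (forall h : R, g (h *: v + x) = h *: w + g x) ->
  derivable phi (g x) w -> is_derive x v (phi \o g) ('D_w phi (g x)).
Proof.
move=> gE dphi.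
have E : (fun h : R => h^-1 *: (((phi \o g) \o shift x) (h *: v) - (phi \o g) x))
    = (fun h : R => h^-1 *: ((phi \o shift (g x)) (h *: w) - phi (g x))).
  by apply/funext => h /=; rewrite gE.
by split; rewrite /derivable /derive E.
Qed.

Lemma continuous_rV_consl d (v : 'rV[R]_d) :
  continuous (fun a : R => rV_cons (a, v)).
Proof.
apply: continuous_rowP => j; rewrite /rV_cons.
case: (unliftP ord0 j) => [k|] ->.
  under eq_fun do rewrite mxE liftK/=.
  exact: cst_continuous.
by under eq_fun do rewrite mxE unlift_none/=.
Qed.

Lemma continuous_rV_consr d (a : R) :
  continuous (fun v : 'rV[R]_d => rV_cons (a, v)).
Proof.
apply: continuous_rowP => j; rewrite /rV_cons.
case: (unliftP ord0 j) => [k|] ->.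
  under eq_fun do rewrite mxE liftK/=.
  exact: coord_continuous.
under eq_fun do rewrite mxE unlift_none/=.
exact: cst_continuous.
Qed.

Lemma rV_cons_affinel d (v : 'rV[R]_d) (a h : R) :
  rV_cons (h *: (1 : R) + a, v) = h *: delta_mx ord0 ord0 + rV_cons (a, v).
Proof.
apply/rowP => j; rewrite /rV_cons !mxE eqxx/=.
case: (unliftP ord0 j) => [k|] ->.
  by rewrite /= mulr0 add0r.
by [].
Qed.

Lemma rV_cons_affiner d (v : 'rV[R]_d) (a h : R) j :
  rV_cons (a, h *: delta_mx ord0 j + v) =
  h *: delta_mx ord0 (lift ord0 j) + rV_cons (a, v).
Proof.
apply/rowP => i; rewrite /rV_cons !mxE eqxx/=.
case: (unliftP ord0 i) => [k|] ->.
  by rewrite /= !mxE eqxx/= (inj_eq lift_inj).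
by rewrite /= mulr0 add0r.
Qed.

Definition vanishes_outside d (f : 'rV[R]_d -> R) (M : R) :=
  forall x : 'rV[R]_d, (exists i, M < `|x ord0 i|) -> f x = 0.

Lemma pderiv_vanishes_outside d (f : 'rV[R]_d -> R) M j :
  vanishes_outside f M -> vanishes_outside (pderiv j f) M.
Proof.
move=> h x [i Mx]; rewrite /pderiv.
rewrite (@near_eq_derive _ _ _ f (cst 0)) ?derive_cst//.
have cc : continuous (fun y : 'rV[R]_d => `|y ord0 i|).
  by apply: continuous_normr_comp; exact: coord_continuous.
have : nbhs x [set y : 'rV[R]_d | M < `|y ord0 i|].
  by apply: (cvgr_gt _ (cc x)).
by apply: filterS => y My; apply: h; exists i.
Qed.

Lemma continuous_vanishes_integrable d (f : 'rV[R]_d -> R) M :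
  continuous f -> vanishes_outside f M ->
  (lebesgue_rV d).-integrable setT (EFin \o f).
Proof.
move=> cf f0.
pose K := closed_box (fun _ : 'I_d => - M) (fun=> M).
have cK : compact K by exact: compact_closed_box.
have mK := compact_measurable_rV cK.
have [B [B0 hB]] := continuous_compact_le cf cK.
have Kfin : (lebesgue_rV d K < +oo)%E.
  rewrite (_ : K = [set x : 'rV[R]_d | forall i, x ord0 i \in `[- M, M]]).
    exact: lebesgue_rV_cube_fin.
  by apply/seteqP; split=> x h i; have := h i; rewrite in_itv.
have -> : EFin \o f = (EFin \o f) \_ K.
  apply/funext => x; rewrite patchE; case: ifPn => //.
  rewrite notin_setE => /existsNP[i] /negP; rewrite -ler_norml -ltNge => Mx.
  by rewrite /= f0//; exists i.
apply/(integrable_mkcond _ mK); apply: measurable_bounded_integrable => //.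
  by apply: measurable_funTS; exact: continuous_measurable_rV.
exists B; split; first exact: num_real.
by move=> B' BB' x Kx /=; apply: le_trans (ltW BB'); exact: hB.
Qed.

Lemma integral_derive1_vanishes (f : R -> R) (M : R) :
  (forall a, derivable f a 1) -> continuous ('D_1 f) ->
  (forall a, M < `|a| -> f a = 0) ->
  (\int[leb]_a ('D_1 f a)%:E = 0)%E.
Proof.
move=> df cdf f0.
pose L : R := `|M| + 1; have L0 : 0 < L by rewrite ltr_wpDl.
have ML : M < L by rewrite (le_lt_trans (ler_norm _))// ltrDl.
have f1E : derive1 f = 'D_1 f by apply/funext => a; rewrite derive1E.
have cf : continuous f.
  move=> a; apply: differentiable_continuous; exact/derivable1_diffP.
have -> : (\int[leb]_a ('D_1 f a)%:E =
           \int[leb]_(a in `[(- L)%R, L]) ('D_1 f a)%:E)%E.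
  rewrite [RHS]integral_mkcond; apply: eq_integral => a _; rewrite patchE.
  case: ifPn => //; rewrite notin_setE /= in_itv/= => /negP.
  rewrite -ler_norml -ltNge => aL.
  rewrite (@near_eq_derive _ _ _ f (cst 0)) ?derive_cst//.
  have : \forall y \near a, L < `|y|.
    by apply: (cvgr_gt _ (@norm_continuous _ R^o a)).
  by apply: filterS => y Ly; apply: f0; exact: lt_trans Ly.
rewrite (@continuous_FTC2 _ _ f); last 4 first.
- by rewrite gtrN.
- exact: continuous_subspaceT.
- split; first by move=> a _; exact: df.
    by apply: cvg_at_right_filter; exact: cf.
  by apply: cvg_at_left_filter; exact: cf.
- by move=> a _; rewrite f1E.
by rewrite !f0 ?normrN ?(ger0_norm (ltW L0))// sube0.
Qed.

(** The measure on R^(d+1) is the product of the line, for the first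
    coordinate, with R^d.  By Fubini's theorem the derivative is integrated
    first in its own direction: by the fundamental theorem of calculus if this
    is the first coordinate, and by induction otherwise. *)
Lemma integral_pderiv_vanishes d (f : 'rV[R]_d -> R) M j :
  continuous f -> (forall x, derivable f x (delta_mx ord0 j)) ->
  continuous (pderiv j f) -> vanishes_outside f M ->
  (\int[lebesgue_rV d]_x (pderiv j f x)%:E = 0)%E.
Proof.
elim: d f j => [|d IH] f j; first by case: j.
move=> cf df cdf f0.
have p0 := pderiv_vanishes_outside j f0.
have ip := continuous_vanishes_integrable cdf p0.
have mp : measurable_fun setT (EFin \o pderiv j f).
  by apply/measurable_EFinP; exact: continuous_measurable_rV.
have mc := @measurable_rV_cons R d.
have ic : (leb \x lebesgue_rV d)%E.-integrable setT
    ((EFin \o pderiv j f) \o @rV_cons R d).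
  apply/integrableP; split; first exact: measurableT_comp.
  have /integrableP[_] := ip; apply: le_lt_trans.
  rewrite [leRHS](_ : _ = \int[pushforward (leb \x lebesgue_rV d)%E
     (@rV_cons R d)]_x `|(EFin \o pderiv j f) x|)%E//.
  rewrite ge0_integral_pushforward//.
  by apply: measurableT_comp.
have -> : (\int[lebesgue_rV d.+1]_x (pderiv j f x)%:E =
  \int[(leb \x lebesgue_rV d)%E]_p ((EFin \o pderiv j f) \o @rV_cons R d) p)%E.
  rewrite [LHS](_ : _ = \int[pushforward (leb \x lebesgue_rV d)%E
     (@rV_cons R d)]_x (EFin \o pderiv j f) x)%E//.
  by rewrite integral_pushforward.
case: (unliftP ord0 j) => [k|] jE.
- rewrite -integral12_prod_meas1//; apply: integral0_eq => a _.
  rewrite /fubini_F /= -[RHS](IH (fun v => f (rV_cons (a, v))) k).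
  + apply: eq_integral => v _; congr EFin; rewrite /pderiv jE.
    apply/esym/derive_val.
    apply: (derive_affine_comp (g := fun v => rV_cons (a, v))).
      by move=> h; exact: rV_cons_affiner.
    by rewrite -jE; exact: df.
  + by move=> v; apply: continuous_comp; [exact: continuous_rV_consr|exact: cf].
  + move=> v; apply: ex_derive.
    apply: (derive_affine_comp (g := fun v => rV_cons (a, v))).
      by move=> h; exact: rV_cons_affiner.
    by rewrite -jE; exact: df.
  + rewrite (_ : pderiv k _ = pderiv j f \o (fun v => rV_cons (a, v))).
      by move=> v; apply: continuous_comp;
        [exact: continuous_rV_consr|exact: cdf].
    apply/funext => v; rewrite /pderiv jE; apply: derive_val.
    apply: (derive_affine_comp (g := fun v => rV_cons (a, v))).
      by move=> h; exact: rV_cons_affiner.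
    by rewrite -jE; exact: df.
  + move=> v [i Mi]; apply: f0; exists (lift ord0 i).
    by rewrite /rV_cons mxE liftK.
- rewrite -integral21_prod_meas1//; apply: integral0_eq => v _.
  rewrite /fubini_G /=.
  have dE (a : R) : is_derive a (1 : R) (fun b : R => f (rV_cons (b, v)))
      (pderiv j f (rV_cons (a, v))).
    rewrite /pderiv jE.
    apply: (derive_affine_comp (g := fun a : R => rV_cons (a, v))).
      by move=> h; exact: rV_cons_affinel.
    by rewrite -jE; exact: df.
  have DE : 'D_(1 : R) (fun a : R => f (rV_cons (a, v))) =
      pderiv j f \o (fun a => rV_cons (a, v)).
    by apply/funext => a; exact: derive_val.
  rewrite -[RHS](@integral_derive1_vanishes (fun a => f (rV_cons (a, v))) M).
  + apply: eq_integral => a _; congr EFin.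
    by apply/esym; exact: derive_val.
  + by move=> a; have [] := dE a.
  + rewrite DE => a; apply: continuous_comp;
      [exact: continuous_rV_consl|exact: cdf].
  + move=> a Ma; apply: f0; exists ord0.
    by rewrite /rV_cons mxE unlift_none.
Qed.

End integral_of_derivative.

(** * Weak derivatives *)

Section weak_derivatives.
Context (R : realType) (d : nat).
Local Notation E := 'rV[R]_d.
Local Notation lam := (lebesgue_rV d : {measure set E -> \bar R}).
Variable Om : set E.
Hypotheses (oOm : open Om) (bOm : bounded_set Om).
Let mOm : measurable Om. Proof. exact: open_measurable_rV. Qed.
Implicit Types (f g b phi : E -> R) (j : 'I_d).

Lemma bounded_open_measure_fin : (lam Om < +oo)%E.
Proof. exact: lebesgue_rV_bounded. Qed.

Lemma integrableR_cst c : integrableR Om (fun=> c).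
Proof.
apply: measurable_bounded_integrable => //.
  exact: bounded_open_measure_fin.
exists `|c|; split; first exact: num_real.
by move=> M cM x _; exact: ltW.
Qed.

Lemma L2_cst c : L2 Om (fun=> c).
Proof. by apply: sqr_integrable_L2 => //; exact: integrableR_cst. Qed.

Lemma L2_integrable f : L2 Om f -> integrableR Om f.
Proof.
move=> Lf; have := L2M_integrable mOm Lf (L2_cst 1).
by under eq_fun do rewrite mulr1.
Qed.

Lemma integrableR_L1loc f : integrableR Om f -> L1loc Om f.
Proof.
move=> fi; split; first exact: integrableR_measurable.
move=> K cK KOm; apply: integrableS fi => //; exact: compact_measurable_rV.
Qed.

Lemma L1loc_lin (a : R) f g : L1loc Om f -> L1loc Om g ->
  L1loc Om (fun x => a * f x + g x).
Proof.
move=> [mf fi] [mg gi]; split.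
  by apply: measurable_funD => //; exact: measurable_funM.
move=> K cK KOm; have mK := compact_measurable_rV cK.
by apply: (integrableRD mK); [apply: (integrableRZ mK); exact: fi|exact: gi].
Qed.

Lemma L1locM f b : L1loc Om f -> continuous b -> L1loc Om (fun x => f x * b x).
Proof.
move=> [mf fi] cb; split.
  apply: measurable_funM => //; apply: measurable_funTS.
  exact: continuous_measurable_rV.
move=> K cK KOm; have mK := compact_measurable_rV cK.
have [M [M0 hM]] := continuous_compact_le cb cK.
apply: (@integrableR_le _ _ _ mK _ (fun x => M * `|f x|)).
- apply: measurable_funM; first exact: measurable_funS mf.
  by apply: measurable_funTS; exact: continuous_measurable_rV.
- by move=> x Kx; rewrite normrM mulrC ler_wpM2r// hM.
- by apply: (integrableRZ mK); apply: (integrable_norm (fi _ cK KOm)).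
Qed.

Lemma C1c_integrable f phi : L1loc Om f -> C1c Om phi ->
  integrableR Om (fun x => f x * phi x).
Proof.
move=> Lf [[cphi _] [K [cK KOm phi0]]].
exact: (L1loc_test_integrable oOm Lf cphi cK KOm phi0).
Qed.

Lemma C1c_pderiv_integrable j f phi b : L1loc Om f -> C1c Om phi ->
  continuous b -> integrableR Om (fun x => f x * (b x * pderiv j phi x)).
Proof.
move=> Lf [C1phi [K [cK KOm phi0]]] cb.
apply: (L1loc_test_integrable oOm Lf (K := K)) => //.
  have cp := Ck1_derive_continuous (v := delta_mx ord0 j) C1phi.
  by move=> x; apply: continuousM; [exact: cb|exact: cp].
by move=> x Kx; rewrite (pderiv_support j cK phi0)// mulr0.
Qed.

(** By the fundamental lemma.  The representative chosen by [wpartial] thus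
    obeys all rules of calculus almost everywhere. *)
Lemma is_wpartial_unique j f g1 g2 : is_wpartial Om j f g1 ->
  is_wpartial Om j f g2 -> ae_on Om (fun x => g1 x = g2 x).
Proof.
move=> [Lf Lg1 h1] [_ Lg2 h2].
have H : ae_on Om (fun x => -1 * g2 x + g1 x = 0).
  apply: (test_integral0_ae oOm); first exact: L1loc_lin.
  move=> phi Cphi.
  under eq_Rintegral do rewrite mulrDl mulN1r mulNr addrC.
  rewrite RintegralB//; [|exact: C1c_integrable..].
  by apply/eqP; rewrite subr_eq0 -(inj_eq oppr_inj) -h1// -h2.
by apply: ae_onS H => x _ /eqP; rewrite mulN1r addrC subr_eq0 => /eqP.
Qed.

Lemma is_wpartial_lin j (a : R) f f' g g' : is_wpartial Om j f f' ->
  is_wpartial Om j g g' ->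
  is_wpartial Om j (fun x => a * f x + g x) (fun x => a * f' x + g' x).
Proof.
move=> [Lf Lf' h1] [Lg Lg' h2]; split; [exact: L1loc_lin|exact: L1loc_lin|].
move=> phi Cphi.
have i1 k : L1loc Om k -> integrableR Om (fun x => k x * pderiv j phi x).
  move=> Lk; have := C1c_pderiv_integrable j Lk Cphi (b := cst 1).
  under eq_fun do rewrite mul1r; apply; exact: cst_continuous.
under eq_Rintegral do rewrite mulrDl -mulrA.
under [in RHS]eq_Rintegral do rewrite mulrDl -mulrA.
rewrite !RintegralD ?RintegralZl ?h1 ?h2 ?mulrN ?opprD//;
  by [exact: i1|exact: C1c_integrable|apply: (integrableRZ mOm); exact: i1|
      apply: (integrableRZ mOm); exact: C1c_integrable].
Qed.

(** The product of a test function with [b] is again a test function. *)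
Lemma is_wpartial_M j f f' b : is_wpartial Om j f f' -> Ck 1 b ->
  is_wpartial Om j (fun x => f x * b x)
    (fun x => f' x * b x + f x * pderiv j b x).
Proof.
move=> [Lf Lf' h] C1b.
have cb := Ck1_continuous C1b.
have cpb := Ck1_derive_continuous (v := delta_mx ord0 j) C1b.
have L1 := L1locM Lf' cb; have L2 := L1locM Lf cpb.
split; first exact: L1locM.
  have := L1loc_lin 1 L1 L2; by under eq_fun do rewrite mul1r.
move=> phi Cphi; have [C1phi [K [cK KOm phi0]]] := Cphi.
have Cbphi : C1c Om (fun x => b x * phi x).
  split; first exact: Ck1M.
  by exists K; split=> // x /phi0 ->; rewrite mulr0.
have pE x : pderiv j (fun x => b x * phi x) x =
    b x * pderiv j phi x + phi x * pderiv j b x.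
  rewrite /pderiv; apply: derive_val.
  by apply: is_deriveM; exact: Ck1_is_derive.
have i1 := C1c_pderiv_integrable j Lf Cphi cb.
have i2 := C1c_integrable L2 Cphi.
have i3 := C1c_integrable L1 Cphi.
have := h _ Cbphi.
under eq_Rintegral do rewrite pE mulrDr [phi _ * _]mulrC (mulrA (f _) (pderiv _ _ _)).
rewrite RintegralD// => /(canRL (addrK _)).
under [in X in X -> _]eq_Rintegral do rewrite mulrA.
move=> ->.
under [in RHS]eq_Rintegral do rewrite mulrDl.
rewrite RintegralD// opprD.
by under [in LHS]eq_Rintegral do rewrite mulrA.
Qed.

(** The integral of the derivative of a test function vanishes. *)
Lemma is_wpartial_cst j (c : R) : is_wpartial Om j (fun=> c) (fun=> 0).
Proof.
have Lc k : L1loc Om (fun=> k).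
  by apply: integrableR_L1loc; exact: integrableR_cst.
split=> // phi Cphi; have [C1phi [K [cK KOm phi0]]] := Cphi.
under [in RHS]eq_Rintegral do rewrite mul0r.
rewrite Rintegral_cst// mul0r oppr0.
have ip : integrableR Om (pderiv j phi).
  have := C1c_pderiv_integrable j (Lc 1) Cphi (b := cst 1).
  by under eq_fun do rewrite !mul1r; apply; exact: cst_continuous.
rewrite RintegralZl// (_ : \int[lam]_(x in Om) _ = 0) ?mulr0//.
have [M [_ KM]] := compact_bounded cK.
have vphi : vanishes_outside phi (M + 1).
  move=> x [i Mx]; apply: phi0 => Kx.
  have := le_lt_trans (le_trans (le_coord_norm x i)
    (KM (M + 1) (ltr_pwDr ltr01 (lexx M)) x Kx)) Mx.
  by rewrite ltxx.
rewrite /Rintegral (_ : integral _ _ _ =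
  \int[lam]_x (pderiv j phi x)%:E)%E; last first.
  rewrite integral_mkcond; apply: eq_integral => x _; rewrite patchE.
  case: ifPn => //; rewrite notin_setE => Ox.
  by rewrite (pderiv_support j cK phi0)// => /KOm.
rewrite (integral_pderiv_vanishes _ _ _ vphi)//.
- exact: Ck1_continuous.
- by move=> x; exact: Ck1_derivable.
- exact: Ck1_derive_continuous.
Qed.

Lemma is_wpartial_ae j f g f' g' : is_wpartial Om j f f' ->
  measurable_fun Om g -> measurable_fun Om g' ->
  ae_on Om (fun x => f x = g x) -> ae_on Om (fun x => f' x = g' x) ->
  is_wpartial Om j g g'.
Proof.
move=> [Lf Lf' h] mg mg' fg fg'.
have LL k k' : L1loc Om k -> measurable_fun Om k' ->
    ae_on Om (fun x => k x = k' x) -> L1loc Om k'.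
  move=> [mk ki] mk' kk'; split=> // K cK KOm.
  have mK := compact_measurable_rV cK.
  apply/integrableP; split.
    by apply/measurable_EFinP; exact: measurable_funS mk'.
  have /integrableP[_] := ki _ cK KOm; congr (_ < _)%E.
  apply: ae_eq_integral => //.
  - apply: measurableT_comp => //; apply/measurable_EFinP.
    exact: measurable_funS mk.
  - apply: measurableT_comp => //; apply/measurable_EFinP.
    exact: measurable_funS mk'.
  - move: kk'; rewrite /ae_on; apply: filterS => x kk' Kx /=.
    by rewrite kk'//; exact: KOm.
split; [exact: LL fg|exact: LL fg'|] => phi Cphi.
have mphi : measurable_fun Om phi.
  by apply: measurable_funTS; apply: continuous_measurable_rV; case: Cphi => -[].
have mp : measurable_fun Om (pderiv j phi).
  apply: measurable_funTS; apply: continuous_measurable_rV.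
  by case: Cphi => C1phi _; exact: Ck1_derive_continuous.
have [mf _] := Lf; have [mf' _] := Lf'.
rewrite -(@ae_eq_Rintegral _ _ _ mOm (fun x => f x * pderiv j phi x)).
- rewrite h//; congr (- _); apply: ae_eq_Rintegral => //.
  + exact: measurable_funM.
  + exact: measurable_funM.
  + by apply: ae_onS fg' => x _ ->.
- exact: measurable_funM.
- exact: measurable_funM.
- by apply: ae_onS fg => x _ ->.
Qed.

Lemma wpartial_eq j f g : is_wpartial Om j f g ->
  ae_on Om (fun x => wpartial Om j f x = g x).
Proof.
move=> h; apply: (is_wpartial_unique _ h).
by apply: (xgetPex (cst 0) (P := [set g | is_wpartial Om j f g])); exists g.
Qed.

Lemma H1_L2 f : H1 Om f -> L2 Om f. Proof. by case. Qed.

Lemma H1_is_wpartial j f : H1 Om f -> is_wpartial Om j f (wpartial Om j f).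
Proof.
move=> [_ /(_ j)[g h _]].
by apply: (xgetPex (cst 0) (P := [set g | is_wpartial Om j f g])); exists g.
Qed.

Lemma H1_wpartial_L2 j f : H1 Om f -> L2 Om (wpartial Om j f).
Proof.
move=> Hf; have [_ [m _] _] := H1_is_wpartial j Hf.
have [_ /(_ j)[g h Lg]] := Hf; apply: (L2_ae mOm Lg m).
by apply: ae_onS (wpartial_eq h) => x _ ->.
Qed.

Lemma H1_lin (a : R) f g : H1 Om f -> H1 Om g ->
  H1 Om (fun x => a * f x + g x).
Proof.
move=> Hf Hg; split.
  by apply: (L2D mOm); [apply: (L2Z mOm)|]; exact: H1_L2.
move=> j; exists (fun x => a * wpartial Om j f x + wpartial Om j g x).
  by apply: is_wpartial_lin; exact: H1_is_wpartial.
by apply: (L2D mOm); [apply: (L2Z mOm)|]; exact: H1_wpartial_L2.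
Qed.

Lemma wpartial_lin j (a : R) f g : H1 Om f -> H1 Om g ->
  ae_on Om (fun x => wpartial Om j (fun x => a * f x + g x) x =
                     a * wpartial Om j f x + wpartial Om j g x).
Proof.
by move=> Hf Hg; apply: wpartial_eq; apply: is_wpartial_lin; exact: H1_is_wpartial.
Qed.

Lemma H1_cst c : H1 Om (fun=> c).
Proof.
by split; [exact: L2_cst|move=> j; exists (fun=> 0);
  [exact: is_wpartial_cst|exact: L2_cst]].
Qed.

Lemma wpartial_cst j c : ae_on Om (fun x => wpartial Om j (fun=> c) x = 0).
Proof. exact/wpartial_eq/is_wpartial_cst. Qed.

Lemma H1_ae f g : H1 Om f -> measurable_fun Om g ->
  ae_on Om (fun x => f x = g x) -> H1 Om g.
Proof.
move=> Hf mg fg; split; first exact: L2_ae (H1_L2 Hf) mg fg.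
move=> j; exists (wpartial Om j f); last exact: H1_wpartial_L2.
have wf := H1_is_wpartial j Hf; have [_ [m _] _] := wf.
by apply: (is_wpartial_ae wf) => //; apply: ae_on_all.
Qed.

Lemma wpartial_ae j f g : H1 Om f -> measurable_fun Om g ->
  ae_on Om (fun x => f x = g x) ->
  ae_on Om (fun x => wpartial Om j g x = wpartial Om j f x).
Proof.
move=> Hf mg fg; apply: wpartial_eq.
have wf := H1_is_wpartial j Hf; have [_ [m _] _] := wf.
by apply: (is_wpartial_ae wf) => //; apply: ae_on_all.
Qed.

Lemma continuous_bounded_on b : continuous b ->
  exists M : R, forall x, Om x -> `|b x| <= M.
Proof.
move=> cb; have [M [_ hM]] := bOm.
have cK : compact (closed_box (fun _ : 'I_d => - (M + 1)) (fun=> M + 1)).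
  exact: compact_closed_box.
have [B [_ hB]] := continuous_compact_le cb cK; exists B => x Ox.
apply: hB => i; rewrite -ler_norml; apply: le_trans (le_coord_norm x i) _.
by apply: hM Ox; rewrite ltrDl.
Qed.

Lemma continuous_measurable_on b : continuous b -> measurable_fun Om b.
Proof. by move=> cb; apply: measurable_funTS; exact: continuous_measurable_rV. Qed.

Lemma L2_Mcontinuous f b : L2 Om f -> continuous b -> L2 Om (fun x => f x * b x).
Proof.
move=> Lf cb; have [M hM] := continuous_bounded_on cb.
rewrite (_ : (fun x => _) = (fun x => b x * f x)).
  by apply: (L2_Mbounded mOm _ hM) => //; exact: continuous_measurable_on.
by apply/funext => x; rewrite mulrC.
Qed.

Lemma H1_M f b : H1 Om f -> Ck 1 b -> H1 Om (fun x => f x * b x).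
Proof.
move=> Hf Cb; split.
  by apply: L2_Mcontinuous; [exact: H1_L2|exact: Ck1_continuous].
move=> j; exists (fun x => wpartial Om j f x * b x + f x * pderiv j b x).
  by apply: is_wpartial_M => //; exact: H1_is_wpartial.
apply: (L2D mOm); apply: L2_Mcontinuous.
- exact: H1_wpartial_L2.
- exact: Ck1_continuous.
- exact: H1_L2.
- exact: Ck1_derive_continuous.
Qed.

Lemma wpartial_M j f b : H1 Om f -> Ck 1 b ->
  ae_on Om (fun x => wpartial Om j (fun x => f x * b x) x =
    wpartial Om j f x * b x + f x * pderiv j b x).
Proof.
by move=> Hf Cb; apply: wpartial_eq; apply: is_wpartial_M => //; exact: H1_is_wpartial.
Qed.

End weak_derivatives.

(** * Separability of L^2 *)

Section L2_separability.
Context (R : realType) (d : nat).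
Local Notation E := 'rV[R]_d.
Local Notation lam := (lebesgue_rV d : {measure set E -> \bar R}).
Variable Om : set E.
Hypotheses (oOm : open Om) (bOm : bounded_set Om).
Let mOm : measurable Om. Proof. exact: open_measurable_rV. Qed.
Implicit Types (f g : E -> R).

Definition box_code := (rat * 'rV[rat]_d)%type.

Definition rat_step (s : seq box_code) (x : E) : R :=
  \sum_(p <- s) ratr p.1 * \1_(lower_box p.2 : set E) x.

Lemma L2_indic A : measurable A -> L2 Om (\1_A : E -> R).
Proof.
move=> mA; rewrite (_ : \1_A = fun x => (\1_A x : R) * 1); last first.
  by apply/funext => x; rewrite mulr1.
apply: (@L2_Mbounded _ _ _ mOm _ _ 1); last exact: L2_cst.
  by apply: measurable_funTS; exact: measurable_indic.
by move=> x _; rewrite indicE; case: (_ \in _); rewrite ?normr1 ?normr0.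
Qed.

Lemma L2_rat_step s : L2 Om (rat_step s).
Proof.
apply: (L2_sum mOm) => p _; apply: (L2Z mOm); apply: L2_indic.
exact: measurable_lower_box.
Qed.

Lemma L2sqD f g : L2 Om f -> L2 Om g ->
  L2sq Om (fun x => f x + g x) <= 2 * (L2sq Om f + L2sq Om g).
Proof.
move=> Lf Lg; have If := L2_sqr_integrable Lf.
have Ig := L2_sqr_integrable Lg.
rewrite /L2sq -RintegralD// -RintegralZl//; last exact: integrableRD.
apply: le_Rintegral => //.
- by apply: L2_sqr_integrable => //; exact: L2D.
- by apply: integrableRZ => //; exact: integrableRD.
- by move=> x _; have := sqr_ge0 (f x - g x); lra.
Qed.

Lemma L2sqZ c f : L2 Om f -> L2sq Om (fun x => c * f x) = c ^+ 2 * L2sq Om f.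
Proof.
move=> Lf; rewrite /L2sq -RintegralZl//; last exact: L2_sqr_integrable.
by apply: eq_Rintegral => x _; rewrite exprMn.
Qed.

Lemma L2sq_eq f g : (forall x, Om x -> f x = g x) -> L2sq Om f = L2sq Om g.
Proof. by move=> fg; apply: eq_Rintegral => x /set_mem Ox; rewrite fg. Qed.

Definition step_approx f :=
  forall e : R, 0 < e -> exists s, L2sq Om (fun x => f x - rat_step s x) < e.

Lemma step_approx_closure f : L2 Om f ->
  (forall e : R, 0 < e -> exists g, [/\ L2 Om g, step_approx g &
     L2sq Om (fun x => f x - g x) < e]) -> step_approx f.
Proof.
move=> Lf H e e0; have e4 : 0 < e / 4 by rewrite divr_gt0.
have [g [Lg ag fg]] := H _ e4; have [s gs] := ag _ e4.
exists s; have Ls := L2_rat_step s.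
rewrite (@L2sq_eq _ (fun x => (f x - g x) + (g x - rat_step s x))); last first.
  by move=> x _; rewrite subrKA.
apply: le_lt_trans (L2sqD _ _) _; [exact: L2B|exact: L2B|lra].
Qed.

Lemma step_approxD f g : L2 Om f -> L2 Om g -> step_approx f ->
  step_approx g -> step_approx (fun x => f x + g x).
Proof.
move=> Lf Lg af ag e e0; have e4 : 0 < e / 4 by rewrite divr_gt0.
have [s fs] := af _ e4; have [t gt] := ag _ e4; exists (s ++ t).
have Ls := L2_rat_step s; have Lt := L2_rat_step t.
rewrite (@L2sq_eq _ (fun x => (f x - rat_step s x) + (g x - rat_step t x))).
  apply: le_lt_trans (L2sqD _ _) _; [exact: L2B|exact: L2B|lra].
by move=> x _; rewrite /rat_step big_cat/= opprD addrACA.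
Qed.

Lemma rat_stepZ q s x :
  rat_step [seq (q * p.1, p.2) | p <- s] x = ratr q * rat_step s x.
Proof.
rewrite /rat_step big_map mulr_sumr; apply: eq_bigr => p _ /=.
by rewrite rmorphM mulrA.
Qed.

Lemma step_approxZ c f : L2 Om f -> step_approx f ->
  step_approx (fun x => c * f x).
Proof.
move=> Lf af; apply: step_approx_closure; first exact: L2Z.
move=> e e0.
have ec : 0 < e / (c ^+ 2 + 1) by rewrite divr_gt0// ltr_wpDl// sqr_ge0.
have [s fs] := af _ ec; have Ls := L2_rat_step s.
exists (fun x => c * rat_step s x); split; first exact: L2Z.
  move=> e' e'0.
  pose K := L2sq Om (rat_step s) + 1.
  have K0 : 0 < K by rewrite ltr_wpDl// L2sq_ge0.
  pose r := Num.min 1 (e' / K); have r0 : 0 < r by rewrite lt_min ltr01 divr_gt0.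
  have [q] : exists q : rat, ratr q \in `]c - r, c + r[.
    by apply: rat_in_itvoo; lra.
  rewrite in_itv/= -ltr_distl => qc.
  exists [seq (q * p.1, p.2) | p <- s].
  rewrite (@L2sq_eq _ (fun x => (c - ratr q) * rat_step s x)); last first.
    by move=> x _; rewrite rat_stepZ mulrBl.
  rewrite L2sqZ//.
  have h1 : (c - ratr q) ^+ 2 <= r.
    rewrite -real_normK ?num_real// distrC expr2.
    have h : `|ratr q - c| <= 1 by rewrite (le_trans (ltW qc))// ge_min lexx.
    by apply: le_trans (ltW qc); rewrite ler_piMl.
  have h2 : r <= e' / K by rewrite ge_min lexx orbT.
  apply: (@le_lt_trans _ _ (e' / K * L2sq Om (rat_step s))).
    by rewrite ler_wpM2r ?L2sq_ge0// (le_trans h1).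
  by rewrite mulrAC ltr_pdivrMr// ltr_pM2l// /K ltrDl.
rewrite (@L2sq_eq _ (fun x => c * (f x - rat_step s x))); last first.
  by move=> x _; rewrite mulrBr.
rewrite L2sqZ; last exact: L2B.
apply: (@le_lt_trans _ _ (c ^+ 2 * (e / (c ^+ 2 + 1)))).
  by rewrite ler_wpM2l ?sqr_ge0// ltW.
rewrite mulrA ltr_pdivrMr ?ltr_wpDl ?sqr_ge0// mulrDr mulr1 mulrC ltrDl//.
Qed.

Lemma L2_dominated_cvg (f_ : nat -> E -> R) f g :
  (forall n, L2 Om (f_ n)) -> L2 Om f -> L2 Om g ->
  (forall x, Om x -> f_ n x @[n --> \oo] --> f x) ->
  (forall n x, Om x -> `|f x - f_ n x| <= `|g x|) ->
  L2sq Om (fun x => f x - f_ n x) @[n --> \oo] --> 0.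
Proof.
move=> Lf_ Lf Lg cvf dom.
have Lfn n : L2 Om (fun x => f x - f_ n x) by exact: L2B.
pose F n x := ((f x - f_ n x) ^+ 2)%:E.
have [_ _] : [/\ lam.-integrable Om (cst 0%E),
    [sequence \int[lam]_(x in Om) `|F n x - cst 0 x|]_n @ \oo --> 0 &
    [sequence \int[lam]_(x in Om) F n x]_n @ \oo -->
    \int[lam]_(x in Om) cst 0 x]%E.
  apply: (dominated_convergence mOm (g := fun x => (g x ^+ 2)%:E)) => //.
  - by move=> n; exact: measurable_int (L2_sqr_integrable (Lfn n)).
  - apply: aeW => x Ox; apply: cvg_EFin; first exact: nearW.
    rewrite /comp/= -[X in _ --> X](mulr0 0).
    have h : f x - f_ n x @[n --> \oo] --> 0.
      by rewrite -(subrr (f x)); apply: cvgB; [exact: cvg_cst|exact: cvf].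
    by under eq_fun do rewrite expr2; exact: cvgM.
  - exact: L2_sqr_integrable.
  - apply: aeW => x n Ox; rewrite lee_fin ger0_norm ?sqr_ge0//.
    rewrite -[leLHS]real_normK ?num_real// -[leRHS]real_normK ?num_real//.
    by rewrite lerXn2r ?nnegrE//; exact: dom.
by rewrite integral0 => h; apply: fine_cvg; exact: h.
Qed.

Lemma step_approx_cvg (f_ : nat -> E -> R) f g :
  (forall n, L2 Om (f_ n)) -> L2 Om f -> L2 Om g ->
  (forall x, Om x -> f_ n x @[n --> \oo] --> f x) ->
  (forall n x, Om x -> `|f x - f_ n x| <= `|g x|) ->
  (forall n, step_approx (f_ n)) -> step_approx f.
Proof.
move=> Lf_ Lf Lg cvf dom af; apply: step_approx_closure => // e e0.
have /cvgrPdist_lt/(_ _ e0)[n _ /(_ n (leqnn n))] :=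
  L2_dominated_cvg Lf_ Lf Lg cvf dom.
by rewrite sub0r normrN ger0_norm ?L2sq_ge0// => h; exists (f_ n).
Qed.

Lemma step_approx_eq f g : (forall x, Om x -> f x = g x) ->
  step_approx f -> step_approx g.
Proof.
move=> fg af e e0; have [s hs] := af _ e0; exists s.
by rewrite (@L2sq_eq _ (fun x => f x - rat_step s x))// => x Ox; rewrite fg.
Qed.

Lemma step_approx_lower_box q : step_approx \1_(lower_box q : set E).
Proof.
move=> e e0; exists [:: (1, q)].
rewrite (@L2sq_eq _ (fun=> 0)).
  rewrite /L2sq Rintegral_cst// expr0n mul0r//.
by move=> x _; rewrite /rat_step big_seq1/= rmorph1 mul1r subrr.
Qed.

(** In the bounded set [Om] the whole space is not distinguished from a large
    box. *)
Lemma step_approx_setT : step_approx \1_(setT : set E).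
Proof.
have [M [_ hM]] := bOm.
pose q : 'rV[rat]_d := \row_i (Num.bound (M + 1))%:R.
apply: (step_approx_eq _ (step_approx_lower_box q)) => x Ox.
rewrite !indicE in_setT mem_set//= => i; rewrite mxE ratr_nat.
apply: le_lt_trans (ler_norm _) _; apply: le_lt_trans (le_coord_norm x i) _.
have xM : `|x| <= M + 1 by apply: hM => //; rewrite ltrDl.
apply: (le_lt_trans xM); apply: archi_boundP.
exact: le_trans (normr_ge0 x) xM.
Qed.

Lemma step_approx_indic A : measurable A -> step_approx \1_A.
Proof.
move: A; apply: lower_box_ind.
- exact: step_approx_setT.
- exact: step_approx_lower_box.
- move=> S mS aS.
  apply: (@step_approx_eq (fun x => \1_setT x + -1 * \1_S x)).
    move=> x _; rewrite !indicE in_setT in_setC.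
    by case: (x \in S) => /=; rewrite ?mulr1 ?mulr0 ?subrr ?addr0.
  apply: step_approxD; [exact: L2_indic| |exact: step_approx_setT|].
    by apply: (L2Z mOm); exact: L2_indic.
  by apply: step_approxZ => //; exact: L2_indic.
- move=> F mF tF aF.
  pose G n : set E := \big[setU/set0]_(k < n) F k.
  have mG n : measurable (G n) by exact: bigsetU_measurable.
  have mU : measurable (\bigcup_k F k) by exact: bigcupT_measurable.
  apply: (@step_approx_cvg (fun n => \1_(G n)) _ (fun=> 1)).
  + by move=> n; exact: L2_indic.
  + exact: L2_indic.
  + exact: L2_cst.
  + move=> x Ox; have [[n _ Fx]|nFx] := pselect ((\bigcup_k F k) x).
      apply: cvg_near_cst; near=> k; rewrite !indicE !mem_set//; first by exists n.
      rewrite /G -bigcup_mkord; exists n => //=.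
      by near: k; exists n.+1.
    apply: cvg_near_cst; near=> k; rewrite !indicE !memNset//.
    by move=> Gx; apply: nFx; move: Gx; rewrite /G -bigcup_mkord => -[i _ Fi]; exists i.
  + move=> n x _; rewrite normr1 !indicE.
    case: (_ \in _); case: (_ \in _);
      by rewrite ?subrr ?subr0 ?sub0r ?normrN ?normr1 ?normr0.
  + elim=> [|n IH].
      apply: (@step_approx_eq (fun x => 0 * \1_setT x)).
        by move=> x _; rewrite mul0r /G big_ord0 indicE in_set0.
      by apply: step_approxZ; [exact: L2_indic|exact: step_approx_setT].
    apply: (@step_approx_eq (fun x => \1_(G n) x + \1_(F n) x)).
      move=> x _; rewrite /G big_ord_recr/= -/(G n) !indicE in_setU.
      case: (boolP (x \in G n)) => xG; case: (boolP (x \in F n)) => xF;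
        rewrite /= ?addr0 ?add0r//.
      move: xG xF; rewrite !inE /G -bigcup_mkord => -[i /= ik Fi] Fn.
      exfalso; have ii : i != n by rewrite ltn_eqF.
      have : (F i `&` F n) x by [].
      by rewrite (trivIsetP.1 tF i n I I ii).
    by apply: step_approxD => //; exact: L2_indic.
Unshelve. all: by end_near. Qed.

Import HBNNSimple.

Lemma step_approx_nnsfun (h : {nnsfun E >-> R}) : step_approx h.
Proof.
suff H r : step_approx (fun x => \sum_(y <- r) y * \1_(h @^-1` [set y]) x).
  apply: (step_approx_eq _ (H (finmap.enum_fset (fset_set (range h))))) => x _.
  by rewrite [RHS](fimfunE h) fsbig_finite.
elim: r => [|y r IH].
  apply: (@step_approx_eq (fun x => 0 * \1_setT x)).
    by move=> x _; rewrite mul0r big_nil.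
  by apply: step_approxZ; [exact: L2_indic|exact: step_approx_setT].
apply: (@step_approx_eq (fun x => y * \1_(h @^-1` [set y]) x +
    \sum_(z <- r) z * \1_(h @^-1` [set z]) x)).
  by move=> x _; rewrite big_cons.
have mh z : measurable (h @^-1` [set z]).
  exact: measurable_funPTI.
apply: step_approxD => //.
- by apply: (L2Z mOm); exact: L2_indic.
- by apply: (L2_sum mOm) => z _; apply: (L2Z mOm); exact: L2_indic.
- by apply: step_approxZ; [exact: L2_indic|exact: step_approx_indic].
Qed.

Lemma L2_le f g : measurable_fun Om f ->
  (forall x, Om x -> `|f x| <= `|g x|) -> L2 Om g -> L2 Om f.
Proof.
move=> mf fg Lg; apply: sqr_integrable_L2 => //.
apply: (integrableR_le mOm _ _ (L2_sqr_integrable Lg)).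
  exact: measurable_funX.
move=> x Ox; rewrite ger0_norm ?sqr_ge0//.
rewrite -[leLHS]real_normK ?num_real// -[leRHS]real_normK ?num_real//.
by rewrite lerXn2r ?nnegrE//; exact: fg.
Qed.

Lemma step_approx_ge0 f : (forall x, Om x -> 0 <= f x) -> L2 Om f ->
  step_approx f.
Proof.
move=> f0 Lf; have [mf _] := Lf.
have mEf : measurable_fun Om (EFin \o f) by exact/measurable_EFinP.
pose h := nnsfun_approx mOm mEf.
have f0' x : Om x -> (0 <= (EFin \o f) x)%E by move=> Ox; rewrite lee_fin f0.
have cvh x : Om x -> h n x @[n --> \oo] --> f x.
  move=> Ox; have := cvg_nnsfun_approx mOm mEf f0' Ox.
  by move=> /fine_cvg.
have hf n x : Om x -> h n x <= f x.
  move=> Ox; have hE := cvg_lim (@Rhausdorff R) (cvh x Ox).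
  rewrite -hE; apply: nondecreasing_cvgn_le.
    by move=> a b ab; exact/lefP/nd_nnsfun_approx.
  by apply/cvg_ex; exists (f x); exact: cvh.
apply: (@step_approx_cvg (fun n => h n) _ f) => //.
- move=> n; apply: (L2_le _ _ Lf).
    by apply: measurable_funTS; exact: measurable_funPT.
  by move=> x Ox; rewrite !ger0_norm ?f0//; exact: hf.
- move=> n x Ox; rewrite !ger0_norm ?f0 ?subr_ge0 ?hf//.
  by rewrite lerBlDr lerDl; exact: fun_ge0.
- by move=> n; exact: step_approx_nnsfun.
Qed.

(** The space L^2 is separable: the combinations of indicators of lower boxes
    with rational coefficients are countable in number and dense. *)
Lemma L2_step_approx f : L2 Om f -> step_approx f.
Proof.
move=> Lf; have [mf _] := Lf.
have m1 : measurable_fun Om (fun x => Num.max (f x) 0) by exact: measurable_maxr.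
have m2 : measurable_fun Om (fun x => Num.max (- f x) 0).
  by apply: measurable_maxr => //; exact: measurableT_comp.
have L1 : L2 Om (fun x => Num.max (f x) 0).
  apply: L2_le Lf => // x _; rewrite /Order.max; case: ifP => h.
    by rewrite normr0.
  by [].
have L2' : L2 Om (fun x => Num.max (- f x) 0).
  apply: L2_le Lf => // x _; rewrite /Order.max; case: ifP => h.
    by rewrite normr0.
  by rewrite normrN.
apply: (@step_approx_eq (fun x => Num.max (f x) 0 + -1 * Num.max (- f x) 0)).
  move=> x _; rewrite mulN1r /Order.max oppr_lt0.
  by case: ltgtP => h; rewrite ?opprK ?subr0 ?add0r// h addr0.
apply: step_approxD => //.
- exact: L2Z.
- by apply: step_approx_ge0 => // x _; rewrite le_max lexx orbT.
- apply: step_approxZ => //.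
  by apply: step_approx_ge0 => // x _; rewrite le_max lexx orbT.
Qed.

(** Any subset of a separable metric space is separable; here for families of
    finitely many square-integrable functions. *)
Lemma L2_family_separable (X : Type) (I : finType) (P : X -> Prop)
    (J : X -> I -> E -> R) (z0 : X) : P z0 ->
  (forall z i, P z -> L2 Om (J z i)) ->
  exists (K : countType) (zz : K -> X), (forall k, P (zz k)) /\
    forall z, P z -> forall e : R, 0 < e ->
      exists k, forall i, L2sq Om (fun x => J z i x - J (zz k) i x) < e.
Proof.
move=> P0 LJ.
pose K := ({ffun I -> seq box_code} * nat)%type.
(* Codes are rational step functions, which need not belong to the family; a
   code close to some member is replaced by such a member. *)
pose near_code (k : K) z := P z /\
  forall i, L2sq Om (fun x => J z i x - rat_step (k.1 i) x) < k.2.+1%:R^-1.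
pose zz (k : K) : X :=
  if pselect (exists z, near_code k z) is left h then projT1 (cid h) else z0.
exists K, zz; split.
  by move=> k; rewrite /zz; case: pselect => // h; case: cid => ? /= [].
move=> z Pz e e0.
pose m := Num.bound (4 / e).
have me : m.+1%:R^-1 < e / 4.
  rewrite -[e / 4]invrK ltf_pV2 ?posrE ?invr_gt0 ?divr_gt0// invfM invrK mulrC.
  apply: lt_le_trans (archi_boundP _) _; first by rewrite divr_ge0// ltW.
  by rewrite ler_nat.
have m0 : 0 < m.+1%:R^-1 :> R by rewrite invr_gt0.
have hs i : exists s, L2sq Om (fun x => J z i x - rat_step s x) < m.+1%:R^-1.
  exact: (L2_step_approx (LJ z i Pz)).
pose k : K := ([ffun i => projT1 (cid (hs i))], m).
have nk : near_code k z.
  by split=> // i; rewrite ffunE; case: cid.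
exists k => i.
have [Pzz hzz] : near_code k (zz k).
  by rewrite /zz; case: pselect => [h|[]]; [case: cid|exists z].
have [_ hz] := nk.
have Lr := L2_rat_step (k.1 i).
rewrite (@L2sq_eq _ (fun x => (J z i x - rat_step (k.1 i) x) +
   -1 * (J (zz k) i x - rat_step (k.1 i) x))); last first.
  by move=> x _; rewrite mulN1r opprB subrKA.
have L1 := L2B mOm (LJ _ i Pz) Lr; have L2' := L2B mOm (LJ _ i Pzz) Lr.
apply: le_lt_trans (L2sqD L1 (L2Z mOm (-1) L2')) _.
rewrite L2sqZ// sqrrN expr1n mul1r.
move: (hz i : _ < m.+1%:R^-1) (hzz i : _ < m.+1%:R^-1) me.
set a := L2sq _ _; set b := L2sq _ _; set c := _^-1; lra.
Qed.

End L2_separability.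

(** * Convergence in L^2 *)

Section L2_convergence.
Context (R : realType) (d : nat).
Local Notation E := 'rV[R]_d.
Local Notation lam := (lebesgue_rV d : {measure set E -> \bar R}).
Variable Om : set E.
Hypotheses (oOm : open Om) (bOm : bounded_set Om).
Let mOm : measurable Om. Proof. exact: open_measurable_rV. Qed.
Implicit Types (f g : E -> R).

(** Square-integrability is asked only eventually: a sequence that converges
    for an extended-valued norm may start outside of the space. *)
Definition L2cvg (f_ : nat -> E -> R) f : Prop :=
  [/\ L2 Om f, \forall n \near \oo, L2 Om (f_ n) &
      L2sq Om (fun x => f x - f_ n x) @[n --> \oo] --> 0].

Lemma L2sq_ae f g : L2 Om f -> L2 Om g -> ae_on Om (fun x => f x = g x) ->
  L2sq Om f = L2sq Om g.
Proof.
move=> [mf _] [mg _] fg; apply: ae_eq_Rintegral => //.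
- exact: measurable_funX.
- exact: measurable_funX.
- by apply: ae_onS fg => x _ ->.
Qed.

Lemma L2cvg_squeeze (f_ : nat -> E -> R) f (q : nat -> R) : L2 Om f ->
  (\forall n \near \oo, L2 Om (f_ n)) ->
  (\forall n \near \oo, L2sq Om (fun x => f x - f_ n x) <= q n) ->
  q n @[n --> \oo] --> 0 -> L2cvg f_ f.
Proof.
move=> Lf Lf_ le q0; split=> //.
apply: (squeeze_cvgr _ (cvg_cst 0) q0).
by apply: filterS le => n ->; rewrite L2sq_ge0.
Qed.

Lemma L2cvg_cst f : L2 Om f -> L2cvg (fun=> f) f.
Proof.
move=> Lf; split=> //; first exact: nearW.
rewrite (_ : (fun n => _) = cst 0); first exact: cvg_cst.
apply/funext => n; rewrite (@L2sq_eq _ _ _ _ (fun=> 0)).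
  by rewrite /L2sq Rintegral_cst// expr0n mul0r.
by move=> x _; rewrite subrr.
Qed.

Lemma L2cvgD (f_ g_ : nat -> E -> R) f g : L2cvg f_ f -> L2cvg g_ g ->
  L2cvg (fun n x => f_ n x + g_ n x) (fun x => f x + g x).
Proof.
move=> [Lf Lf_ cf] [Lg Lg_ cg].
apply: (@L2cvg_squeeze _ _ (fun n => 2 * (L2sq Om (fun x => f x - f_ n x) +
    L2sq Om (fun x => g x - g_ n x)))).
- exact: L2D.
- by apply: filterS2 Lf_ Lg_ => n; exact: L2D.
- apply: filterS2 Lf_ Lg_ => n Lfn Lgn.
  rewrite (@L2sq_eq _ _ _ _ (fun x => (f x - f_ n x) + (g x - g_ n x))).
    by apply: L2sqD => //; exact: L2B.
  by move=> x _; rewrite opprD addrACA.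
- have -> : (0 : R) = 2 * (0 + 0) by ring.
  by apply: cvgM; [exact: cvg_cst|exact: cvgD].
Qed.

Lemma L2cvgM (m : E -> R) K (f_ : nat -> E -> R) f : measurable_fun Om m ->
  (forall x, Om x -> `|m x| <= K) -> L2cvg f_ f ->
  L2cvg (fun n x => m x * f_ n x) (fun x => m x * f x).
Proof.
move=> mm mK [Lf Lf_ cf].
apply: (@L2cvg_squeeze _ _ (fun n => K ^+ 2 * L2sq Om (fun x => f x - f_ n x))).
- exact: (L2_Mbounded mOm mm mK).
- by apply: filterS Lf_ => n; exact: (L2_Mbounded mOm mm mK).
- apply: filterS Lf_ => n Lfn; have Lfn' := L2B mOm Lf Lfn.
  rewrite -L2sqZ//; apply: le_Rintegral => //.
  + apply: L2_sqr_integrable; rewrite (_ : (fun x => _) =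
      (fun x => m x * (f x - f_ n x))); last first.
      by apply/funext => x; rewrite mulrBr.
    exact: (L2_Mbounded mOm mm mK).
  + by apply: L2_sqr_integrable; exact: L2Z.
  + move=> x Ox; rewrite -mulrBr !exprMn ler_wpM2r ?sqr_ge0//.
    have := mK x Ox; rewrite -[m x ^+ 2]real_normK ?num_real// => h.
    by rewrite lerXn2r ?nnegrE// (le_trans _ h).
- rewrite -[X in _ --> X](mulr0 (K ^+ 2)).
  by apply: cvgM; [exact: cvg_cst|exact: cf].
Qed.

Lemma L2cvgZ c (f_ : nat -> E -> R) f : L2cvg f_ f ->
  L2cvg (fun n x => c * f_ n x) (fun x => c * f x).
Proof. by move=> h; apply: (@L2cvgM (fun=> c) `|c|). Qed.

Lemma L2cvg_sum (I : Type) (r : seq I) (F_ : I -> nat -> E -> R)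
    (F : I -> E -> R) : (forall i, L2cvg (F_ i) (F i)) ->
  L2cvg (fun n x => \sum_(i <- r) F_ i n x) (fun x => \sum_(i <- r) F i x).
Proof.
move=> h; elim: r => [|i r IH].
  rewrite (_ : (fun n x => _) = fun=> fun=> 0).
    rewrite (_ : (fun x => _) = fun=> 0); first exact/L2cvg_cst/L20.
    by apply/funext => x; rewrite big_nil.
  by apply/funext => n; apply/funext => x; rewrite big_nil.
rewrite (_ : (fun n x => _) =
  fun n x => F_ i n x + \sum_(j <- r) F_ j n x).
  rewrite (_ : (fun x => _) = fun x => F i x + \sum_(j <- r) F j x).
    exact: L2cvgD.
  by apply/funext => x; rewrite big_cons.
by apply/funext => n; apply/funext => x; rewrite big_cons.
Qed.

Lemma L2norm_cvg0 (f_ : nat -> E -> R) : L2sq Om (f_ n) @[n --> \oo] --> 0 ->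
  L2norm Om (f_ n) @[n --> \oo] --> 0.
Proof.
move=> h; rewrite -(@sqrtr0 R).
by apply: (continuous_cvg _ (@sqrt_continuous R 0)).
Qed.

Lemma L2cvg_Rintegral (f_ g_ : nat -> E -> R) f g : L2cvg f_ f -> L2cvg g_ g ->
  \int[lam]_(x in Om) (f_ n x * g_ n x) @[n --> \oo] -->
  \int[lam]_(x in Om) (f x * g x).
Proof.
move=> [Lf Lf_ cf] [Lg Lg_ cg].
pose a n := L2norm Om (fun x => f x - f_ n x).
pose b n := L2norm Om (fun x => g x - g_ n x).
have a0 : a n @[n --> \oo] --> 0 by exact: L2norm_cvg0.
have b0 : b n @[n --> \oo] --> 0 by exact: L2norm_cvg0.
pose q n := L2norm Om f * b n + L2norm Om g * a n + a n * b n.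
have q0 : q n @[n --> \oo] --> 0.
  have -> : (0 : R) = L2norm Om f * 0 + L2norm Om g * 0 + 0 * 0 by ring.
  apply: cvgD; last exact: cvgM.
  by apply: cvgD; apply: cvgM => //; exact: cvg_cst.
apply/subr_cvg0/norm_cvg0P; apply: (squeeze_cvgr _ (cvg_cst 0) q0).
near=> n; rewrite normr_ge0/=.
have Lfn : L2 Om (f_ n) by near: n.
have Lgn : L2 Om (g_ n) by near: n.
have Lf' := L2B mOm Lf Lfn; have Lg' := L2B mOm Lg Lgn.
have i1 := L2M_integrable mOm Lf Lg'.
have i2 := L2M_integrable mOm Lg Lf'.
have i3 := L2M_integrable mOm Lf' Lg'.
rewrite -RintegralB//; try exact: L2M_integrable.
have i1' : integrableR Om (fun x => f x * (g x - g_ n x) * -1).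
  by under eq_fun do rewrite mulrN1; exact: integrableRN.
have i2' : integrableR Om (fun x => g x * (f x - f_ n x) * -1).
  by under eq_fun do rewrite mulrN1; exact: integrableRN.
rewrite (_ : \int[lam]_(x in Om) _ =
  \int[lam]_(x in Om) (f x * (g x - g_ n x) * -1) +
  \int[lam]_(x in Om) (g x * (f x - f_ n x) * -1) +
  \int[lam]_(x in Om) ((f x - f_ n x) * (g x - g_ n x))); last first.
  rewrite -!RintegralD//; last exact: integrableRD.
  by apply: eq_Rintegral => x _; ring.
rewrite !RintegralZr// !mulrN1.
apply: le_trans (ler_normD _ _) _; apply: lerD; last exact: L2_cauchy_schwarz.
apply: le_trans (ler_normD _ _) _; rewrite !normrN.
by apply: lerD; exact: L2_cauchy_schwarz.
Unshelve. all: by end_near. Qed.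

Definition mxL2 (A : E -> 'M[R]_d) : Prop :=
  forall i j, L2 Om (fun x => A x i j).

Definition mxL2cvg (A_ : nat -> E -> 'M[R]_d) (A : E -> 'M[R]_d) : Prop :=
  forall i j, L2cvg (fun n x => A_ n x i j) (fun x => A x i j).

Lemma mxL2cvg_cst A : mxL2 A -> mxL2cvg (fun=> A) A.
Proof. by move=> LA i j; exact: L2cvg_cst. Qed.

Lemma mdot_integrable A B : mxL2 A -> mxL2 B ->
  integrableR Om (fun x => mdot (A x) (B x)).
Proof.
move=> LA LB; apply: (integrableR_sum mOm) => i _.
by apply: (integrableR_sum mOm) => j _; exact: L2M_integrable.
Qed.

Lemma Rintegral_mdot A B : mxL2 A -> mxL2 B ->
  \int[lam]_(x in Om) mdot (A x) (B x) =
  \sum_i \sum_j \int[lam]_(x in Om) (A x i j * B x i j).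
Proof.
move=> LA LB; rewrite /mdot Rintegral_sum//.
  apply: eq_bigr => i _; rewrite Rintegral_sum// => j _.
  exact: L2M_integrable.
by move=> i _; apply: (integrableR_sum mOm) => j _; exact: L2M_integrable.
Qed.

Lemma tdot_integrable (S T : E -> 'I_d -> 'I_d -> 'I_d -> R) :
  (forall i j k, L2 Om (fun x => S x i j k)) ->
  (forall i j k, L2 Om (fun x => T x i j k)) ->
  integrableR Om (fun x => tdot (S x) (T x)).
Proof.
move=> LS LT; apply: (integrableR_sum mOm) => i _.
apply: (integrableR_sum mOm) => j _; apply: (integrableR_sum mOm) => k _.
exact: L2M_integrable.
Qed.

Lemma Rintegral_tdot (S T : E -> 'I_d -> 'I_d -> 'I_d -> R) :
  (forall i j k, L2 Om (fun x => S x i j k)) ->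
  (forall i j k, L2 Om (fun x => T x i j k)) ->
  \int[lam]_(x in Om) tdot (S x) (T x) =
  \sum_i \sum_j \sum_k \int[lam]_(x in Om) (S x i j k * T x i j k).
Proof.
move=> LS LT; have LST i j k := L2M_integrable mOm (LS i j k) (LT i j k).
rewrite /tdot Rintegral_sum//; last first.
  move=> i _; apply: (integrableR_sum mOm) => j _.
  by apply: (integrableR_sum mOm) => k _; exact: LST.
apply: eq_bigr => i _; rewrite Rintegral_sum//; last first.
  by move=> j _; apply: (integrableR_sum mOm) => k _; exact: LST.
by apply: eq_bigr => j _; rewrite Rintegral_sum// => k _; exact: LST.
Qed.

Lemma mxL2cvg_mxL2 A_ A : mxL2cvg A_ A ->
  mxL2 A /\ \forall n \near \oo, mxL2 (A_ n).
Proof.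
move=> h; split; first by move=> i j; have [] := h i j.
have : \forall n \near \oo, forall i j, L2 Om (fun x => A_ n x i j).
  apply: filter_forall => i; apply: filter_forall => j.
  by have [] := h i j.
by apply: filterS => n.
Qed.

Lemma cvg_sumr (I : Type) (r : seq I) (F_ : I -> nat -> R) (F : I -> R) :
  (forall i, F_ i n @[n --> \oo] --> F i) ->
  \sum_(i <- r) F_ i n @[n --> \oo] --> \sum_(i <- r) F i.
Proof.
move=> h; elim: r => [|i r IH].
  rewrite (_ : (fun n => _) = cst 0) ?big_nil; first exact: cvg_cst.
  by apply/funext => n; rewrite big_nil.
rewrite (_ : (fun n => _) = (fun n => F_ i n + \sum_(j <- r) F_ j n)).
  by rewrite big_cons; apply: cvgD.
by apply/funext => n; rewrite big_cons.
Qed.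

Lemma mxL2cvg_Rintegral A_ B_ A B : mxL2cvg A_ A -> mxL2cvg B_ B ->
  \int[lam]_(x in Om) mdot (A_ n x) (B_ n x) @[n --> \oo] -->
  \int[lam]_(x in Om) mdot (A x) (B x).
Proof.
move=> hA hB; have [LA LA_] := mxL2cvg_mxL2 hA.
have [LB LB_] := mxL2cvg_mxL2 hB.
rewrite Rintegral_mdot//.
have h : \sum_i \sum_j \int[lam]_(x in Om) (A_ n x i j * B_ n x i j)
    @[n --> \oo] --> \sum_i \sum_j \int[lam]_(x in Om) (A x i j * B x i j).
  by apply: cvg_sumr => i; apply: cvg_sumr => j; exact: L2cvg_Rintegral.
apply: cvg_trans h; apply: near_eq_cvg.
by apply: filterS2 LA_ LB_ => n LAn LBn; rewrite Rintegral_mdot.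
Qed.

Lemma tdot_cvg_Rintegral (S_ T_ : nat -> E -> 'I_d -> 'I_d -> 'I_d -> R)
    (S T : E -> 'I_d -> 'I_d -> 'I_d -> R) :
  (forall i j k, L2cvg (fun n x => S_ n x i j k) (fun x => S x i j k)) ->
  (forall i j k, L2cvg (fun n x => T_ n x i j k) (fun x => T x i j k)) ->
  \int[lam]_(x in Om) tdot (S_ n x) (T_ n x) @[n --> \oo] -->
  \int[lam]_(x in Om) tdot (S x) (T x).
Proof.
move=> hS hT.
have nL (U_ : nat -> E -> 'I_d -> 'I_d -> 'I_d -> R) U :
    (forall i j k, L2cvg (fun n x => U_ n x i j k) (fun x => U x i j k)) ->
    \forall n \near \oo, forall i j k, L2 Om (fun x => U_ n x i j k).
  move=> h; apply: filter_forall => i; apply: filter_forall => j.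
  by apply: filter_forall => k; have [] := h i j k.
rewrite Rintegral_tdot; [|by move=> i j k; have [] := hS i j k
                         |by move=> i j k; have [] := hT i j k].
have h : \sum_i \sum_j \sum_k \int[lam]_(x in Om) (S_ n x i j k * T_ n x i j k)
    @[n --> \oo] -->
    \sum_i \sum_j \sum_k \int[lam]_(x in Om) (S x i j k * T x i j k).
  apply: cvg_sumr => i; apply: cvg_sumr => j; apply: cvg_sumr => k.
  exact: L2cvg_Rintegral.
apply: cvg_trans h; apply: near_eq_cvg.
by apply: filterS2 (nL _ _ hS) (nL _ _ hT) => n Sn Tn; rewrite Rintegral_tdot.
Qed.

End L2_convergence.

(** * Sobolev vector fields *)

Section vector_sobolev.
Context (R : realType) (d : nat).
Local Notation E := 'rV[R]_d.
Local Notation lam := (lebesgue_rV d : {measure set E -> \bar R}).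
Variable Om : set E.
Hypotheses (oOm : open Om) (bOm : bounded_set Om).
Let mOm : measurable Om. Proof. exact: open_measurable_rV. Qed.
Implicit Types (u v r : E -> E) (a : R).

Lemma coordf_lin a u v i :
  coordf (a *: u + v) i = fun x => a * coordf u i x + coordf v i x.
Proof. by apply/funext => x; rewrite /coordf !mxE. Qed.

Lemma H1v_lin a u v : H1v Om u -> H1v Om v -> H1v Om (a *: u + v).
Proof. by move=> Hu Hv i; rewrite coordf_lin; apply: H1_lin. Qed.

Lemma coordf0 i : coordf (0 : E -> E) i = fun=> 0.
Proof. by apply/funext => x; rewrite /coordf mxE. Qed.

Lemma H1v0 : H1v Om 0.
Proof. by move=> i; rewrite coordf0; exact: H1_cst. Qed.

Lemma wgrad_lin a u v : H1v Om u -> H1v Om v ->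
  ae_on Om (fun x => wgrad Om (a *: u + v) x = a *: wgrad Om u x + wgrad Om v x).
Proof.
move=> Hu Hv.
have : ae_on Om (fun x => forall i j,
    wpartial Om j (coordf (a *: u + v) i) x =
    a * wpartial Om j (coordf u i) x + wpartial Om j (coordf v i) x).
  apply: ae_on_fin => i; apply: ae_on_fin => j; rewrite coordf_lin.
  exact: wpartial_lin.
by apply: ae_onS => x _ h; apply/matrixP => i j; rewrite !mxE h.
Qed.

Lemma sympart_lin a (A B : 'M[R]_d) :
  sympart (a *: A + B) = a *: sympart A + sympart B.
Proof. by apply/matrixP => i j; rewrite !mxE; ring. Qed.

Lemma sympart_sym (A : 'M[R]_d) : symmx (sympart A).
Proof. by apply/matrixP => i j; rewrite !mxE addrC. Qed.

Lemma esym_lin a u v : H1v Om u -> H1v Om v ->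
  ae_on Om (fun x => Defs.esym Om (a *: u + v) x = a *: Defs.esym Om u x + Defs.esym Om v x).
Proof.
move=> Hu Hv; apply: ae_onS (wgrad_lin a Hu Hv) => x _.
by rewrite /Defs.esym => ->; rewrite sympart_lin.
Qed.

Lemma wgrad0 : ae_on Om (fun x => wgrad Om 0 x = 0).
Proof.
have : ae_on Om (fun x => forall i j, wpartial Om j (coordf (0 : E -> E) i) x = 0).
  apply: ae_on_fin => i; apply: ae_on_fin => j; rewrite coordf0.
  exact: wpartial_cst.
by apply: ae_onS => x _ h; apply/matrixP => i j; rewrite !mxE h.
Qed.

Lemma esym0 : ae_on Om (fun x => Defs.esym Om 0 x = 0).
Proof.
apply: ae_onS wgrad0 => x _; rewrite /Defs.esym => ->.
by rewrite /sympart trmx0 addr0 scaler0.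
Qed.

Lemma wgrad_L2 u : H1v Om u -> mxL2 Om (wgrad Om u).
Proof.
move=> Hu i j; under eq_fun do rewrite mxE.
exact: (H1_wpartial_L2 oOm j (Hu i)).
Qed.

Lemma esym_L2 u : H1v Om u -> mxL2 Om (Defs.esym Om u).
Proof.
move=> /wgrad_L2 Lu i j; rewrite (_ : (fun x => _) =
  (fun x => 2^-1 * (wgrad Om u x i j + wgrad Om u x j i))).
  by apply: (L2Z mOm); apply: (L2D mOm); exact: Lu.
by apply/funext => x; rewrite !mxE.
Qed.

Lemma H2v_H1v u : H2v Om u -> H1v Om u. Proof. by case. Qed.

Lemma wpartial_coordf_lin a u v i k : H1v Om u -> H1v Om v ->
  ae_on Om (fun x => a * wpartial Om k (coordf u i) x + wpartial Om k (coordf v i) x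
     = wpartial Om k (coordf (a *: u + v) i) x).
Proof.
move=> Hu Hv; rewrite coordf_lin.
by apply: ae_onS (wpartial_lin oOm k a (Hu i) (Hv i)) => x _ ->.
Qed.

Lemma H2v_lin a u v : H2v Om u -> H2v Om v -> H2v Om (a *: u + v).
Proof.
move=> [Hu Hu2] [Hv Hv2]; split; first exact: H1v_lin.
move=> i k; apply: (H1_ae oOm (H1_lin oOm a (Hu2 i k) (Hv2 i k))).
  by have [] := H1_wpartial_L2 oOm k (H1v_lin a Hu Hv i).
exact: wpartial_coordf_lin.
Qed.

Lemma whess_lin a u v : H2v Om u -> H2v Om v ->
  ae_on Om (fun x => forall i j k, whess Om (a *: u + v) x i j k =
    a * whess Om u x i j k + whess Om v x i j k).
Proof.
move=> [Hu Hu2] [Hv Hv2].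
apply: ae_on_fin => i; apply: ae_on_fin => j; apply: ae_on_fin => k.
have m : measurable_fun Om (wpartial Om k (coordf (a *: u + v) i)).
  by have [] := H1_wpartial_L2 oOm k (H1v_lin a Hu Hv i).
have h1 := wpartial_ae oOm j (H1_lin oOm a (Hu2 i k) (Hv2 i k)) m
  (wpartial_coordf_lin a i k Hu Hv).
have h2 := wpartial_lin oOm j a (Hu2 i k) (Hv2 i k).
by apply: ae_onS (ae_onI h1 h2) => x _ [h3 h4]; rewrite /whess h3 h4.
Qed.

Lemma H2v0 : H2v Om 0.
Proof.
split; first exact: H1v0.
move=> i k; apply: (H1_ae oOm (H1_cst oOm bOm 0)).
  by have [] := H1_wpartial_L2 oOm k (H1v0 i).
by rewrite coordf0; apply: ae_onS (wpartial_cst oOm bOm k 0) => x _ ->.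
Qed.

Lemma whess0 : ae_on Om (fun x => forall i j k, whess Om 0 x i j k = 0).
Proof.
apply: ae_on_fin => i; apply: ae_on_fin => j; apply: ae_on_fin => k.
have m : measurable_fun Om (wpartial Om k (coordf (0 : E -> E) i)).
  by have [] := H1_wpartial_L2 oOm k (H1v0 i).
have := wpartial_ae oOm j (H1_cst oOm bOm 0) m.
rewrite coordf0 => /(_ _)/wrap[].
  by apply: ae_onS (wpartial_cst oOm bOm k 0) => x _ ->.
move=> h1; apply: ae_onS (ae_onI h1 (wpartial_cst oOm bOm j 0)) => x _ [h3 h4].
by rewrite /whess coordf0 h3 h4.
Qed.

Lemma whess_L2 u i j k : H2v Om u -> L2 Om (fun x => whess Om u x i j k).
Proof. by move=> [_ /(_ i k) H]; exact: H1_wpartial_L2. Qed.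

Lemma dotv_integrable u v : H1v Om u -> H1v Om v ->
  integrableR Om (fun x => dotv (u x) (v x)).
Proof.
move=> Hu Hv; apply: (integrableR_sum mOm) => i _.
by apply: L2M_integrable => //; [exact: H1_L2 (Hu i)|exact: H1_L2 (Hv i)].
Qed.

Lemma H1v_dot_integrable u v : H1v Om u -> H1v Om v ->
  integrableR Om (fun x => dotv (u x) (v x) + mdot (wgrad Om u x) (wgrad Om v x)).
Proof.
move=> Hu Hv; apply: integrableRD => //; first exact: dotv_integrable.
by apply: mdot_integrable => //; exact: wgrad_L2.
Qed.

Lemma mdot_linl a (A B C : 'M[R]_d) :
  mdot (a *: A + B) C = a * mdot A C + mdot B C.
Proof.
rewrite /mdot mulr_sumr -big_split/=; apply: eq_bigr => i _.
rewrite mulr_sumr -big_split/=; apply: eq_bigr => j _.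
by rewrite !mxE; ring.
Qed.

Lemma mdotC (A B : 'M[R]_d) : mdot A B = mdot B A.
Proof.
by apply: eq_bigr => i _; apply: eq_bigr => j _; rewrite mulrC.
Qed.

Lemma mdot_linr a (A B C : 'M[R]_d) :
  mdot C (a *: A + B) = a * mdot C A + mdot C B.
Proof. by rewrite mdotC mdot_linl !(mdotC C). Qed.

Lemma mdot_ge0 (A : 'M[R]_d) : 0 <= mdot A A.
Proof. by do 2 apply: sumr_ge0 => ? _; rewrite -expr2 sqr_ge0. Qed.

Lemma dotv_linl a (x y z : E) : dotv (a *: x + y) z = a * dotv x z + dotv y z.
Proof.
rewrite /dotv mulr_sumr -big_split/=; apply: eq_bigr => i _.
by rewrite !mxE; ring.
Qed.

Lemma dotv_ge0 (x : E) : 0 <= dotv x x.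
Proof. by apply: sumr_ge0 => ? _; rewrite -expr2 sqr_ge0. Qed.

Lemma H1v_dot_lin a u v r : H1v Om u -> H1v Om v -> H1v Om r ->
  H1v_dot Om (a *: u + v) r = a * H1v_dot Om u r + H1v_dot Om v r.
Proof.
move=> Hu Hv Hr; rewrite /H1v_dot.
have iu := H1v_dot_integrable Hu Hr; have iv := H1v_dot_integrable Hv Hr.
rewrite -RintegralZl// -RintegralD//; last exact: integrableRZ.
apply: ae_eq_Rintegral => //.
- apply: integrableR_measurable; apply: H1v_dot_integrable => //.
  exact: H1v_lin.
- by apply: integrableR_measurable; apply: integrableRD => //; exact: integrableRZ.
- apply: ae_onS (wgrad_lin a Hu Hv) => x _ ->.
  by rewrite mdot_linl (_ : (a *: u + v) x = a *: u x + v x)// dotv_linl; ring.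
Qed.

Lemma H1perp_lin a u v : H1perp Om u -> H1perp Om v -> H1perp Om (a *: u + v).
Proof.
move=> [Hu pu] [Hv pv]; split; first exact: H1v_lin.
move=> r Hr Er; rewrite H1v_dot_lin// pu// pv// mulr0 addr0//.
Qed.

Lemma H1v_dot_ge_component u i j : H1v Om u ->
  L2sq Om (fun x => wgrad Om u x i j) <= H1v_dot Om u u.
Proof.
move=> Hu; apply: le_Rintegral => //.
- by apply: L2_sqr_integrable; exact: wgrad_L2.
- exact: H1v_dot_integrable.
- move=> x _; rewrite -[leLHS]add0r lerD ?dotv_ge0//.
  rewrite /mdot (bigD1 i)//= (bigD1 j)//= -expr2 -addrA lerDl addr_ge0//.
    by apply: sumr_ge0 => k _; rewrite -expr2 sqr_ge0.
  by do 2 apply: sumr_ge0 => ? _; rewrite -expr2 sqr_ge0.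
Qed.

Lemma H1v_dot_ge0 u : 0 <= H1v_dot Om u u.
Proof. by apply: Rintegral_ge0 => x _; rewrite addr_ge0 ?dotv_ge0 ?mdot_ge0. Qed.

Lemma tdot_ge0 (S : 'I_d -> 'I_d -> 'I_d -> R) : 0 <= tdot S S.
Proof. by do 3 apply: sumr_ge0 => ? _; rewrite -expr2 sqr_ge0. Qed.

Lemma tdot_ge_component (S : 'I_d -> 'I_d -> 'I_d -> R) i j k :
  S i j k ^+ 2 <= tdot S S.
Proof.
rewrite /tdot (bigD1 i)//= (bigD1 j)//= (bigD1 k)//= -expr2 -!addrA lerDl.
by rewrite !addr_ge0//; do ?[apply: sumr_ge0 => ? _]; rewrite -expr2 sqr_ge0.
Qed.

(** A norm that is infinite outside of its space keeps a sequence converging to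
    zero in the space eventually; the finitely many other terms are absorbed in
    [q']. *)
Lemma space_norm_cvg (P : nat -> Prop) (q : nat -> R) :
  (forall n, P n -> 0 <= q n) ->
  space_norm (P n) (q n) @[n --> \oo] --> (0 : \bar R) ->
  (\forall n \near \oo, P n) /\
  exists2 q' : nat -> R, q' n @[n --> \oo] --> 0 &
    forall n, P n -> q' n = q n.
Proof.
move=> q0 /fine_cvgP[fn cv]; split.
  apply: filterS fn => n; rewrite /space_norm.
  by case: asboolP.
exists (fun n => (fine (space_norm (P n) (q n))) ^+ 2).
  rewrite -(mulr0 0); under eq_fun do rewrite expr2.
  by apply: cvgM; exact: cv.
by move=> n Pn; rewrite /space_norm asboolT//= sqr_sqrtr// q0.
Qed.

Lemma cvg_of_difference (f_ : nat -> E -> R) (g_ : nat -> E -> R)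
    (f : E -> R) (P : nat -> Prop) (q' : nat -> R) : L2 Om f ->
  (\forall n \near \oo, P n) -> q' n @[n --> \oo] --> 0 ->
  (forall n, P n -> [/\ L2 Om (f_ n), L2 Om (g_ n),
     ae_on Om (fun x => g_ n x = f x - f_ n x) & L2sq Om (g_ n) <= q' n]) ->
  L2cvg Om f_ f.
Proof.
move=> Lf nP q0 h; apply: (L2cvg_squeeze Lf _ _ q0).
  by apply: filterS nP => n /h[].
apply: filterS nP => n /h[L1 L2' ae le].
rewrite (@L2sq_ae _ _ _ oOm _ (g_ n))//; first exact: (L2B mOm).
by apply: ae_onS ae => x _ ->.
Qed.

Lemma fun_subE (u v : E -> E) : u - v = -1 *: v + u.
Proof. by rewrite scaleN1r addrC. Qed.

(** Strong measurability is expressed with extended norms, while the quadratic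
    forms of the problem depend on the L^2 components of the derivatives; this
    lemma and the next two pass from the former to the latter. *)
Lemma norm_H1perp_cvg u (v_ : nat -> E -> E) : H1perp Om u ->
  norm_H1perp Om (u - v_ n) @[n --> \oo] --> (0 : \bar R) ->
  (\forall n \near \oo, H1perp Om (v_ n)) /\
  mxL2cvg Om (fun n => wgrad Om (v_ n)) (wgrad Om u).
Proof.
move=> Hu /space_norm_cvg[n _|nP [q' q0 q'E]]; first exact: H1v_dot_ge0.
have Hv n : H1perp Om (u - v_ n) -> H1perp Om (v_ n).
  move=> h; rewrite (_ : v_ n = -1 *: (u - v_ n) + u); first exact: H1perp_lin.
  by rewrite scaleN1r opprB addrNK.
split; first by apply: filterS nP => n /Hv.
move=> i j; have [H1u _] := Hu.
apply: (cvg_of_difference (wgrad_L2 H1u i j) nP q0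
  (g_ := fun n x => wgrad Om (u - v_ n) x i j)) => n Pn.
have [H1v' _] := Hv _ Pn; have [H1d _] := Pn.
split.
- exact: wgrad_L2.
- exact: wgrad_L2.
- rewrite fun_subE; apply: ae_onS (wgrad_lin (-1) H1v' H1u) => x _ ->.
  by rewrite !mxE mulN1r addrC.
- by rewrite q'E//; exact: H1v_dot_ge_component.
Qed.

Lemma norm_H1_cvg (f : E -> R) (v_ : nat -> E -> R) : H1 Om f ->
  norm_H1 Om (f - v_ n) @[n --> \oo] --> (0 : \bar R) ->
  (\forall n \near \oo, H1 Om (v_ n)) /\
  forall j, L2cvg Om (fun n => wpartial Om j (v_ n)) (wpartial Om j f).
Proof.
move=> Hf /space_norm_cvg[n _|nP [q' q0 q'E]].
  by apply: Rintegral_ge0 => x _; rewrite addr_ge0 ?sqr_ge0// dotv_ge0.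
have Hv n : H1 Om (f - v_ n) -> H1 Om (v_ n).
  move=> h; rewrite (_ : v_ n = fun x => -1 * (f - v_ n) x + f x).
    exact: H1_lin.
  by apply/funext => x; rewrite mulN1r (_ : (f - v_ n) x = f x - v_ n x)// opprB addrNK.
split; first by apply: filterS nP => n /Hv.
move=> j.
apply: (cvg_of_difference (H1_wpartial_L2 oOm j Hf) nP q0
  (g_ := fun n => wpartial Om j (f - v_ n))) => n Pn.
have H1v' := Hv _ Pn.
have Lg k : L2 Om (fun x => wgrad1 Om (f - v_ n) x ord0 k).
  by under eq_fun do rewrite mxE; exact: H1_wpartial_L2.
split.
- exact: H1_wpartial_L2.
- exact: H1_wpartial_L2.
- have := wpartial_lin oOm j (-1) H1v' Hf.
  rewrite (_ : (fun x => -1 * v_ n x + f x) = f - v_ n).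
    by apply: ae_onS => x _ ->; rewrite mulN1r addrC.
  by apply/funext => x; rewrite mulN1r addrC.
- rewrite q'E//; apply: le_Rintegral => //.
  + by apply: L2_sqr_integrable; exact: H1_wpartial_L2.
  + apply: integrableRD => //; first by apply: L2_sqr_integrable; case: Pn.
    by apply: (integrableR_sum mOm) => k _; exact: L2M_integrable.
  + move=> x _; rewrite -[leLHS]add0r lerD ?sqr_ge0//.
    rewrite /dotv (bigD1 j)//= !mxE -expr2 lerDl.
    by apply: sumr_ge0 => k _; rewrite -expr2 sqr_ge0.
Qed.

Lemma norm_H2v_cvg u (v_ : nat -> E -> E) : H2v Om u ->
  norm_H2v Om (u - v_ n) @[n --> \oo] --> (0 : \bar R) ->
  [/\ \forall n \near \oo, H2v Om (v_ n),
      mxL2cvg Om (fun n => wgrad Om (v_ n)) (wgrad Om u) &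
      forall i j k, L2cvg Om (fun n x => whess Om (v_ n) x i j k)
                            (fun x => whess Om u x i j k)].
Proof.
move=> Hu /space_norm_cvg[n _|nP [q' q0 q'E]].
  by rewrite addr_ge0 ?H1v_dot_ge0//; apply: Rintegral_ge0 => x _; exact: tdot_ge0.
have Hv n : H2v Om (u - v_ n) -> H2v Om (v_ n).
  move=> h; rewrite (_ : v_ n = -1 *: (u - v_ n) + u); first exact: H2v_lin.
  by rewrite scaleN1r opprB addrNK.
split; first by apply: filterS nP => n /Hv.
  move=> i j; have H1u := H2v_H1v Hu.
  apply: (cvg_of_difference (wgrad_L2 H1u i j) nP q0
    (g_ := fun n x => wgrad Om (u - v_ n) x i j)) => n Pn.
  have H1v' := H2v_H1v (Hv _ Pn); have H1d := H2v_H1v Pn.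
  split.
  - exact: wgrad_L2.
  - exact: wgrad_L2.
  - rewrite fun_subE; apply: ae_onS (wgrad_lin (-1) H1v' H1u) => x _ ->.
    by rewrite !mxE mulN1r addrC.
  - rewrite q'E//; apply: le_trans (H1v_dot_ge_component i j H1d) _.
    by rewrite lerDl; apply: Rintegral_ge0 => x _; exact: tdot_ge0.
move=> i j k.
apply: (cvg_of_difference (whess_L2 i j k Hu) nP q0
  (g_ := fun n x => whess Om (u - v_ n) x i j k)) => n Pn.
have H2v' := Hv _ Pn.
split.
- exact: whess_L2.
- exact: whess_L2.
- rewrite fun_subE; apply: ae_onS (whess_lin (-1) H2v' Hu) => x _ ->.
  by rewrite mulN1r addrC.
- rewrite q'E// /L2sq -[leLHS]add0r lerD ?H1v_dot_ge0//.
  apply: le_Rintegral => //.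
  + by apply: L2_sqr_integrable; exact: whess_L2.
  + by apply: tdot_integrable => // *; exact: whess_L2.
  + by move=> x _; exact: tdot_ge_component.
Qed.

End vector_sobolev.

(** * Coefficients depending on the phase *)

Section phase_dependent_coefficients.
Context (R : realType) (d : nat).
Local Notation E := 'rV[R]_d.
Local Notation lam := (lebesgue_rV d : {measure set E -> \bar R}).
Variable Om : set E.
Hypothesis oOm : open Om.
Let mOm : measurable Om. Proof. exact: open_measurable_rV. Qed.

Section fixed_phase.
Variable chi : E -> R.
Hypothesis mchi : measurable_fun Om chi.
Hypothesis chi01 : forall x, Om x -> chi x = 0 \/ chi x = 1.

(** A phase only takes the values 0 and 1, so every coefficient is affine in
    it, however irregular the dependence of the tensors on the phase. *)
Lemma phase_interpolation (g : R -> R) x : Om x ->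
  g (chi x) = g 0 + chi x * (g 1 - g 0).
Proof.
move=> /chi01[->|->]; first by rewrite mul0r addr0.
by rewrite mul1r addrC subrK.
Qed.

Lemma phase_coeff_measurable (g : R -> R) : measurable_fun Om (g \o chi).
Proof.
apply: (eq_measurable_fun (fun x => g 0 + chi x * (g 1 - g 0))).
  by move=> x /set_mem Ox /=; rewrite (phase_interpolation g Ox).
by apply: measurable_funD => //; exact: measurable_funM.
Qed.

Lemma phase_coeff_bounded (g : R -> R) x : Om x ->
  `|(g \o chi) x| <= `|g 0| + `|g 1|.
Proof. by move=> /chi01[]/= ->; rewrite ?lerDl ?lerDr. Qed.

Lemma phase_coeff_L2 (g : R -> R) f : L2 Om f ->
  L2 Om (fun x => g (chi x) * f x).
Proof.
exact: (L2_Mbounded mOm (phase_coeff_measurable g) (phase_coeff_bounded g)).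
Qed.

Variable C : R -> {linear 'M[R]_d -> 'M[R]_d}.

Lemma tensor_entry y (A : 'M[R]_d) k l :
  C y A k l = \sum_i \sum_j C y (delta_mx i j) k l * A i j.
Proof.
rewrite [in LHS](matrix_sum_delta A) linear_sum summxE; apply: eq_bigr => i _.
rewrite linear_sum summxE; apply: eq_bigr => j _.
by rewrite linearZ mxE mulrC.
Qed.

Lemma tensor_mxL2 A : mxL2 Om A -> mxL2 Om (fun x => C (chi x) (A x)).
Proof.
move=> LA k l; under eq_fun do rewrite tensor_entry.
apply: (L2_sum mOm) => i _; apply: (L2_sum mOm) => j _.
exact: (phase_coeff_L2 (fun y => C y (delta_mx i j) k l)).
Qed.

Lemma tensor_mxL2cvg A_ A : mxL2cvg Om A_ A ->
  mxL2cvg Om (fun n x => C (chi x) (A_ n x)) (fun x => C (chi x) (A x)).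
Proof.
move=> h k l.
rewrite (_ : (fun n x => _) = (fun n x => \sum_i \sum_j
   C (chi x) (delta_mx i j) k l * A_ n x i j)); last first.
  by apply/funext => n; apply/funext => x; rewrite tensor_entry.
rewrite (_ : (fun x => _) = (fun x => \sum_i \sum_j
   C (chi x) (delta_mx i j) k l * A x i j)); last first.
  by apply/funext => x; rewrite tensor_entry.
apply: L2cvg_sum => // i; apply: L2cvg_sum => // j.
apply: (L2cvgM oOm (phase_coeff_measurable (fun y => C y (delta_mx i j) k l))
  (phase_coeff_bounded (fun y => C y (delta_mx i j) k l)) (h i j)).
Qed.

Hypothesis bOm : bounded_set Om.

Lemma phase_matrix_mxL2 (G : R -> 'M[R]_d) : mxL2 Om (fun x => G (chi x)).
Proof.
move=> k l; have := phase_coeff_L2 (fun y => G y k l) (L2_cst oOm bOm 1).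
by under eq_fun do rewrite mulr1.
Qed.

End fixed_phase.

Variables (T : R) (chi : R -> E -> R).
Local Notation I0T := (`]0, T[%classic : set (measurableTypeR R)).
Hypothesis mchi : measurable_fun (I0T `*` Om)
  (fun p : measurableTypeR R * E => chi p.1 p.2).
Hypothesis chi01 : forall t x, 0 < t < T -> Om x -> chi t x = 0 \/ chi t x = 1.

Lemma phase_measurable t : 0 < t < T -> measurable_fun Om (chi t).
Proof.
move=> t0T; have mIO : measurable (I0T `*` Om) by exact: measurableX.
apply: (measurable_comp mIO _ mchi (g := fun x : E => (t : measurableTypeR R, x))).
  by move=> _ [x Ox <-]; split => //=; rewrite in_itv.
by apply: measurable_funTS; exact: measurable_fun_pair.
Qed.

(** The joint measurability of the phase enters here, through Tonelli's
    theorem. *)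
Lemma measurable_phase_integral_ge0 (a : E -> R) : measurable_fun Om a ->
  (forall x, Om x -> 0 <= a x) ->
  measurable_fun I0T (fun t => \int[lam]_(x in Om) (chi t x * a x)).
Proof.
move=> ma a0; have mI : measurable I0T by [].
have mIO : measurable (I0T `*` Om) by exact: measurableX.
pose F := (fun p : measurableTypeR R * E => (chi p.1 p.2 * a p.2)%:E) \_ (I0T `*` Om).
have mF : measurable_fun setT F.
  apply/(measurable_restrictT _ mIO)/measurable_EFinP; apply: measurable_funM => //.
  apply: (measurable_comp mOm _ ma); first by move=> _ [[t x] [_ ?] <-].
  by apply: measurable_funTS; exact: measurable_snd.
have F0 p : (0 <= F p)%E.
  rewrite /F patchE; case: ifPn => // /set_mem [] /=.
  rewrite in_itv/= => t0T Ox; rewrite lee_fin mulr_ge0 ?a0//.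
  by case: (chi01 t0T Ox) => ->.
have mG := @measurable_fun_fubini_tonelli_F _ _ _ _ _ (lebesgue_rV d) F mF F0.
apply: (eq_measurable_fun (fine \o (fubini_F (lebesgue_rV d) F))).
  move=> t tI; rewrite /= /Rintegral /fubini_F; congr fine.
  rewrite [RHS]integral_mkcond; apply: eq_integral => x _.
  rewrite /F !patchE /= in_setX tI/=; by case: ifP.
by apply: measurable_funTS; apply: measurableT_comp mG.
Qed.

Lemma measurable_phase_integral (a : E -> R) : integrableR Om a ->
  measurable_fun I0T (fun t => \int[lam]_(x in Om) (chi t x * a x)).
Proof.
move=> ia; have ma := integrableR_measurable ia.
pose p x := Num.max (a x) 0; pose n x := Num.max (- a x) 0.
have mp : measurable_fun Om p by exact: measurable_maxr.
have mn : measurable_fun Om n.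
  by apply: measurable_maxr => //; exact: measurableT_comp.
have p0 x : 0 <= p x by rewrite le_max lexx orbT.
have n0 x : 0 <= n x by rewrite le_max lexx orbT.
have pa x : `|p x| <= `|a x|.
  rewrite ger0_norm// /p /Order.max; case: ifP => _ //; exact: ler_norm.
have na x : `|n x| <= `|a x|.
  rewrite ger0_norm// /n /Order.max; case: ifP => _ //.
  by rewrite -normrN; exact: ler_norm.
have ian := integrable_norm ia.
apply: (eq_measurable_fun (fun t => \int[lam]_(x in Om) (chi t x * p x) -
   \int[lam]_(x in Om) (chi t x * n x))); last first.
  by apply: measurable_funB; apply: measurable_phase_integral_ge0.
move=> t /set_mem; rewrite /= in_itv/= => t0T.
have ic (b : E -> R) : measurable_fun Om b -> (forall x, `|b x| <= `|a x|) ->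
    integrableR Om (fun x => chi t x * b x).
  move=> mb ba; apply: (integrableR_le mOm _ _ ian).
    by apply: measurable_funM => //; exact: phase_measurable.
  move=> x Ox /=; apply: le_trans (ba x); rewrite normrM.
  by case: (chi01 t0T Ox) => ->; rewrite ?normr0 ?mul0r// normr1 mul1r.
rewrite -RintegralB//; [|exact: ic|exact: ic].
apply: eq_Rintegral => x _; rewrite -mulrBr; congr (_ * _).
rewrite /p /n /Order.max oppr_lt0.
by case: ltgtP => h; rewrite ?opprK ?subr0 ?add0r// h addr0.
Qed.

Lemma measurable_phase_coeff_integral (g : R -> R) (a : E -> R) :
  integrableR Om a ->
  measurable_fun I0T (fun t => \int[lam]_(x in Om) (g (chi t x) * a x)).
Proof.
move=> ia.
apply: (eq_measurable_fun (fun t => g 0 * \int[lam]_(x in Om) a x +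
   (g 1 - g 0) * \int[lam]_(x in Om) (chi t x * a x))); last first.
  apply: measurable_funD => //; apply: measurable_funM => //.
  exact: measurable_phase_integral.
move=> t /set_mem; rewrite /= in_itv/= => t0T.
have ic : integrableR Om (fun x => chi t x * a x).
  apply: (integrableR_le mOm _ _ (integrable_norm ia)).
    apply: measurable_funM; first exact: phase_measurable.
    exact: integrableR_measurable.
  move=> x Ox /=; rewrite normrM.
  by case: (chi01 t0T Ox) => ->; rewrite ?normr0 ?mul0r// normr1 mul1r.
rewrite -!RintegralZl// -RintegralD//; try exact: integrableRZ.
apply: eq_Rintegral => x /set_mem Ox.
rewrite (phase_interpolation (fun x => chi01 t0T) g Ox); ring.
Qed.

Variable C : R -> {linear 'M[R]_d -> 'M[R]_d}.

Lemma measurable_tensor_form (A B : E -> 'M[R]_d) : mxL2 Om A -> mxL2 Om B ->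
  measurable_fun I0T
    (fun t => \int[lam]_(x in Om) mdot (C (chi t x) (A x)) (B x)).
Proof.
move=> LA LB.
apply: (eq_measurable_fun (fun t => \sum_k \sum_l \sum_i \sum_j
  \int[lam]_(x in Om) (C (chi t x) (delta_mx i j) k l * (A x i j * B x k l)))).
  move=> t /set_mem; rewrite /= in_itv/= => t0T.
  have mc := phase_measurable t0T.
  have c01 x := chi01 (x := x) t0T.
  rewrite Rintegral_mdot//; last exact: tensor_mxL2.
  apply: eq_bigr => k _; apply: eq_bigr => l _.
  have ii i j : integrableR Om (fun x =>
      C (chi t x) (delta_mx i j) k l * (A x i j * B x k l)).
    under eq_fun do rewrite mulrA; apply: L2M_integrable => //.
    exact: (phase_coeff_L2 mc c01 (fun y => C y (delta_mx i j) k l)).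
  under [RHS]eq_Rintegral do rewrite tensor_entry mulr_suml.
  rewrite Rintegral_sum//; last first.
    move=> i _; under eq_fun do rewrite mulr_suml.
    apply: (integrableR_sum mOm) => j _.
    by under eq_fun do rewrite -mulrA; exact: ii.
  apply: eq_bigr => i _; under [RHS]eq_Rintegral do rewrite mulr_suml.
  rewrite Rintegral_sum//; last first.
    by move=> j _; under eq_fun do rewrite -mulrA; exact: ii.
  by apply: eq_bigr => j _; apply: eq_Rintegral => x _; rewrite mulrA.
do 4! (apply: measurable_sum => ?).
apply: (measurable_phase_coeff_integral (fun y => C y _ _ _)).
exact: L2M_integrable.
Qed.

Hypothesis bOm : bounded_set Om.

Lemma measurable_phase_matrix_form (G : R -> 'M[R]_d) (B : E -> 'M[R]_d) :
  mxL2 Om B ->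
  measurable_fun I0T (fun t => \int[lam]_(x in Om) mdot (G (chi t x)) (B x)).
Proof.
move=> LB.
apply: (eq_measurable_fun (fun t => \sum_k \sum_l
  \int[lam]_(x in Om) (G (chi t x) k l * B x k l))).
  move=> t /set_mem; rewrite /= in_itv/= => t0T.
  have mc := phase_measurable t0T.
  have c01 x := chi01 (x := x) t0T.
  by rewrite Rintegral_mdot//; exact: phase_matrix_mxL2.
do 2! (apply: measurable_sum => ?).
apply: (measurable_phase_coeff_integral (fun y => G y _ _)).
by apply: L2_integrable.
Qed.

End phase_dependent_coefficients.

(** * Properties almost everywhere in time *)

#[local] Instance ae_lebesgue_filter (R : realType) :
  Filter (nbhs (almost_everywhere (@lebesgue_measure R))).
Proof. exact: ae_filter_ringOfSetsType. Qed.

Section time_dependence.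
Context (R : realType) (X : lmodType R) (N : X -> \bar R) (T : R).
Local Notation leb := (@lebesgue_measure R).
Local Notation I0T := (`]0, T[%classic : set (measurableTypeR R)).
Implicit Types P Q : R -> Prop.

Lemma ae_timeI P Q : ae_time T P -> ae_time T Q -> ae_time T (fun t => P t /\ Q t).
Proof.
by rewrite /ae_time => hP hQ; apply: filterS2 hP hQ => t p q t0T; split; auto.
Qed.

Lemma ae_timeS P Q : (forall t, 0 < t < T -> P t -> Q t) ->
  ae_time T P -> ae_time T Q.
Proof.
by rewrite /ae_time => PQ; apply: filterS => t h t0T; apply: PQ => //; exact: h.
Qed.

Lemma ae_time_all P : (forall t, 0 < t < T -> P t) -> ae_time T P.
Proof. by move=> h; apply: aeW => t; exact: h. Qed.

Lemma ae_measurable_eq (f g : R -> R) : ae_time T (fun t => f t = g t) ->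
  ae_measurable T f -> ae_measurable T g.
Proof.
move=> fg [h mh fh]; exists h => //.
by apply: ae_timeS (ae_timeI fg fh) => t _ [<- ->].
Qed.

Lemma ae_measurableD (f g : R -> R) : ae_measurable T f -> ae_measurable T g ->
  ae_measurable T (fun t => f t + g t).
Proof.
move=> [f' mf ff] [g' mg gg]; exists (fun t => f' t + g' t).
  exact: measurable_funD.
by apply: ae_timeS (ae_timeI ff gg) => t _ [-> ->].
Qed.

Lemma measurable_ae_measurable (f : R -> R) : measurable_fun I0T f ->
  ae_measurable T f.
Proof.
move=> mf; exists (f \_ I0T).
  by apply/(measurable_restrictT (D := I0T)).
by apply: ae_time_all => t t0T; rewrite patchE mem_set//= in_itv.
Qed.

(** The set of times at which the norm is infinite is measurable up to a null
    set, because the function and its approximations have finite norms at the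
    same times; its measure is zero since the squared norm is integrable. *)
Lemma sq_integrable_finite (f : R -> X) :
  (forall t, (0 <= N (f t))%E) ->
  (forall v w, (N (v - w) < +oo)%E -> (N v < +oo)%E <-> (N w < +oo)%E) ->
  L2t N T f -> ae_time T (fun t => (N (f t) < +oo)%E).
Proof.
move=> N0 Nsub [bf sf].
(* Finiteness of the norm, as a real function. *)
pose Phi (t : R) v : R := if (N v < +oo)%E then 0 else 1.
have [] : ae_measurable T (fun t => Phi t (f t)).
  apply: (bochner_comp_ae_measurable (Phi := Phi) bf) => //.
  apply: ae_time_all => t _ v_ /fine_cvgP[fin _].
  apply: cvg_near_cst; apply: filterS fin => n fin; rewrite /Phi.
  suff -> : (N (f t) < +oo)%E = (N (v_ n) < +oo)%E by [].
  have h : (N (f t - v_ n) < +oo)%E by rewrite ltey_eq fin.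
  by apply/idP/idP => /(Nsub _ _ h).
move=> g mg [N1 [mN1 N10 sub]].
pose A : set (measurableTypeR R) := (I0T `&` g @^-1` `]2^-1, +oo[) `\` N1.
have mA : measurable A.
  apply: measurableD => //; apply: measurableI => //.
  by rewrite -[X in measurable X]setTI; exact: mg.
have AE t : A t -> N (f t) = +oo%E.
  move=> [[/= tI tg] tN1]; apply: contrapT => Nf; apply: tN1; apply: sub => /=.
  move=> /(_ _)/wrap[]; first by move: tI; rewrite in_itv.
  rewrite /Phi ltey => gt; move: tg; rewrite /= in_itv/= andbT -gt.
  by case: eqP => // _; rewrite invr_lt0 ltrn0.
have A0 : leb A = 0%E.
  apply/eqP; rewrite eq_le measure_ge0 andbT leNgt; apply/negP => A0.
  move: sf; rewrite /sq_integrable ltNge => /negP; apply.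
  apply: (@le_trans _ _ (\int[leb]_(t in I0T) (((cst +oo) \_ A) t))%E).
    rewrite -integral_mkcondr (_ : I0T `&` A = A); last first.
      by apply/seteqP; split=> [t []|t At]//; split => //; case: At => -[].
    by rewrite integral_cst// gt0_mulye.
  apply: le_integral_all => t _; rewrite patchE.
  case: ifPn => [/set_mem /AE ->|_]; first by rewrite expe2.
  by rewrite expe2 mule_ge0.
exists (A `|` N1); split.
- exact: measurableU.
- by apply: null_set_setU.
- move=> t /= /not_implyP[t0T /negP Nf]; have [tN|tN] := pselect (N1 t).
    by right.
  left; split=> //; split; first by rewrite /= in_itv.
  rewrite /= in_itv/= andbT.
  have : ~ ~ (0 < t < T -> Phi t (f t) = g t) by move=> h; apply: tN; exact: sub.
  move=> /contrapT /(_ t0T) <-; rewrite /Phi (negbTE Nf).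
  by rewrite invf_lt1// ltr1n.
Qed.

(** The integral of a non-integrable function carries no information, so the
    hypothesis is used for sets on which [h] is bounded. *)
Lemma integral_indic_ae_eq0 (h : R -> R) : ae_measurable T h ->
  (forall A : set (measurableTypeR R), measurable A ->
     exists2 k : R -> R, ae_time T (fun t => k t = \1_A t * h t) &
       \int[leb]_(t in `]0, T[) k t = 0) ->
  ae_time T (fun t => h t = 0).
Proof.
move=> [g mg hg] H.
have finI : (leb I0T < +oo)%E.
  change (lebesgue_measure `]0%R, T[%classic < +oo)%E.
  by rewrite lebesgue_measure_itv/=; case: ifP => _; rewrite ltry.
(* Where [g] is bounded, it is integrable. *)
pose D n : set (measurableTypeR R) := I0T `&` g @^-1` `[(- n%:R), n%:R].
have mD n : measurable (D n).
  apply: measurableI => //; rewrite -[X in measurable X]setTI.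
  by apply: mg.
have D0 n : {ae leb, forall t, D n t -> g t = 0}.
  have bD A : measurable A -> A `<=` D n -> leb.-integrable A (EFin \o g).
    move=> mA AD; apply: measurable_bounded_integrable => //.
    - apply: le_lt_trans finI; apply: le_measure; rewrite ?inE//.
      by move=> t /AD[].
    - exact: measurable_funTS.
    - exists n%:R; split; first exact: num_real.
      move=> M nM t /AD[_]; rewrite /= in_itv/= -ler_norml => h'.
      exact: le_trans (ltW nM).
  suff : ae_eq leb (D n) (EFin \o g) (cst 0%E).
    by apply: filterS => t h' Dt; have := h' Dt => -[].
  apply: integral_ae_eq => //; first exact: bD.
  move=> A AD mA; rewrite integral0.
  have [k kE k0] := H A mA.
  have iA := bD A mA AD.
  have kA : (\int[leb]_(t in I0T) (k t)%:E = \int[leb]_(t in A) (g t)%:E)%E.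
    rewrite [RHS](_ : _ = \int[leb]_(t in I0T) ((EFin \o g) \_ A) t)%E.
      apply: ae_eq_integral_all => //.
      have := ae_timeI kE hg; rewrite /ae_time; apply: filterS => t kh tI.
      have [|-> ->] := kh; first by move: tI; rewrite /= in_itv.
      rewrite indicE patchE; case: ifP => _; rewrite ?mul1r//.
      by rewrite mul0r.
    rewrite -integral_mkcondr; congr (integral _ _ _).
    by apply/seteqP; split=> [t At|t []//]; split => //; case: (AD _ At).
  move: k0; rewrite /Rintegral kA => /(congr1 (@EFin R)).
  rewrite fineK//; exact: (integrable_fin_num mA iA).
have := ae_foralln D0; move: hg; rewrite /ae_time => hg Dg.
apply: filterS2 hg Dg => t h1 h2 t0T; rewrite h1//.
apply: (h2 (Num.bound `|g t|)); split; first by rewrite /= in_itv.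
rewrite /= in_itv/= -ler_norml.
by apply/ltW/archi_boundP.
Qed.

End time_dependence.

(** * Localization in time of the momentum balance *)

Lemma guarded_cvg (R : realType) (P : nat -> Prop) (Q : Prop) (F : nat -> R)
    (l : R) : Q -> (\forall n \near \oo, P n) -> F n @[n --> \oo] --> l ->
  (if `[< P n >] then F n else 0) @[n --> \oo] --> (if `[< Q >] then l else 0).
Proof.
move=> HQ nP; rewrite asboolT//; apply: cvg_trans; apply: near_eq_cvg.
by apply: filterS nP => n Hn; rewrite asboolT.
Qed.

Lemma Rintegral_add4 dT (X : measurableType dT) (R : realType)
    (m : {measure set X -> \bar R}) (D : set X) (f1 f2 f3 f4 f : X -> R) :
  measurable D ->
  m.-integrable D (EFin \o f1) -> m.-integrable D (EFin \o f2) ->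
  m.-integrable D (EFin \o f3) -> m.-integrable D (EFin \o f4) ->
  (forall x, D x -> f x = f1 x + (f2 x + f3 x) + f4 x) ->
  \int[m]_(x in D) f x = \int[m]_(x in D) f1 x
    + (\int[m]_(x in D) f2 x + \int[m]_(x in D) f3 x) + \int[m]_(x in D) f4 x.
Proof.
move=> mD i1 i2 i3 i4 fE.
have i23 : m.-integrable D (EFin \o (fun x => f2 x + f3 x)).
  exact: (integrableD mD i2 i3).
have i123 : m.-integrable D (EFin \o (fun x => f1 x + (f2 x + f3 x))).
  exact: (integrableD mD i1 i23).
rewrite -(RintegralD mD i2 i3) -(RintegralD mD i1 i23) -(RintegralD mD i123 i4).
by apply: eq_Rintegral => x /set_mem; exact: fE.
Qed.

Section momentum_localization.
Context (R : realType) (d : nat).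
Local Notation E := 'rV[R]_d.
Local Notation lam := (lebesgue_rV d : {measure set E -> \bar R}).
Local Notation leb := (@lebesgue_measure R).
Variables (Om : set E) (T : R).
Hypotheses (oOm : open Om) (bOm : bounded_set Om).
Let mOm : measurable Om. Proof. exact: open_measurable_rV. Qed.
Local Notation I0T := (`]0, T[%classic : set (measurableTypeR R)).
Variable chi : R -> E -> R.
Hypothesis mchi : measurable_fun (I0T `*` Om)
  (fun p : measurableTypeR R * E => chi p.1 p.2).
Hypothesis chi01 : forall t x, 0 < t < T -> Om x -> chi t x = 0 \/ chi t x = 1.
Variables (C Cnu : R -> {linear 'M[R]_d -> 'M[R]_d}) (Tau : R -> 'M[R]_d).
Variables u p : R -> E -> E.
Hypotheses (bu : bochner_measurable (norm_H2v Om) T u)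
  (Hu : ae_time T (fun t => H2v Om (u t)))
  (bp : bochner_measurable (norm_H1perp Om) T p)
  (Hp : ae_time T (fun t => H1perp Om (p t))).

Local Notation stress t x := (Cnu (chi t x) (Defs.esym Om (p t) x)).

(** The integrand of the momentum balance at a fixed time, with [p] in the
    role of the time derivative of [u]. *)
Definition momentum_form (t : R) (z : E -> E) : R :=
  \int[lam]_(x in Om)
    (mdot (stress t x + Wel_deriv C Tau (chi t x) (Defs.esym Om (u t) x))
          (Defs.esym Om z x)
     + tdot (whess Om (u t) x) (whess Om z x)).

Lemma Wel_deriv_mxL2 t : 0 < t < T -> H2v Om (u t) ->
  mxL2 Om (fun x => Wel_deriv C Tau (chi t x) (Defs.esym Om (u t) x)).
Proof.
move=> t0T Hut i j.
have mc := phase_measurable oOm mchi t0T.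
have c01 x := chi01 (x := x) t0T.
have LE := esym_L2 oOm (H2v_H1v Hut).
have L1 := tensor_mxL2 oOm mc c01 C LE i j.
have L2' := phase_matrix_mxL2 oOm mc c01 bOm (fun y => C y (Tau y)) i j.
rewrite (_ : (fun x => _) = (fun x => C (chi t x) (Defs.esym Om (u t) x) i j -
  C (chi t x) (Tau (chi t x)) i j)); first exact: L2B.
by apply/funext => x; rewrite /Wel_deriv linearB !mxE.
Qed.

Lemma stress_mxL2 t : 0 < t < T -> H1perp Om (p t) ->
  mxL2 Om (fun x => stress t x).
Proof.
move=> t0T [Hpt _].
apply: (tensor_mxL2 oOm (phase_measurable oOm mchi t0T)) => //.
  by move=> x; exact: chi01.
exact: esym_L2.
Qed.

Lemma mxL2D (A B : E -> 'M[R]_d) : mxL2 Om A -> mxL2 Om B ->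
  mxL2 Om (fun x => A x + B x).
Proof.
move=> LA LB i j; under eq_fun do rewrite mxE.
by apply: (L2D mOm); [exact: LA|exact: LB].
Qed.

Lemma esym_mxL2cvg (v_ : nat -> E -> E) v :
  mxL2cvg Om (fun n => wgrad Om (v_ n)) (wgrad Om v) ->
  mxL2cvg Om (fun n => Defs.esym Om (v_ n)) (Defs.esym Om v).
Proof.
move=> h i j.
rewrite (_ : (fun n x => _) = (fun n x => 2^-1 * (wgrad Om (v_ n) x i j +
  wgrad Om (v_ n) x j i))); last first.
  by apply/funext => n; apply/funext => x; rewrite !mxE.
rewrite (_ : (fun x => _) = (fun x => 2^-1 * (wgrad Om v x i j +
  wgrad Om v x j i))); last by apply/funext => x; rewrite !mxE.
by apply: L2cvgZ => //; apply: L2cvgD.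
Qed.

(** Separates the terms that depend on time through the velocity, through the
    displacement, and through the phase alone, as their measurability is
    obtained in different spaces. *)
Lemma momentum_form_split t z : 0 < t < T -> H2v Om (u t) ->
  H1perp Om (p t) -> H2v Om z ->
  momentum_form t z =
  \int[lam]_(x in Om) mdot (stress t x) (Defs.esym Om z x)
  + (\int[lam]_(x in Om)
       mdot (C (chi t x) (Defs.esym Om (u t) x)) (Defs.esym Om z x)
     + \int[lam]_(x in Om) tdot (whess Om (u t) x) (whess Om z x))
  + \int[lam]_(x in Om) mdot (- C (chi t x) (Tau (chi t x))) (Defs.esym Om z x).
Proof.
move=> t0T Hut Hpt Hz.
have mc := phase_measurable oOm mchi t0T.
have c01 x := chi01 (x := x) t0T.
have Lz := esym_L2 oOm (H2v_H1v Hz).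
have i1 := mdot_integrable oOm (stress_mxL2 t0T Hpt) Lz.
have i2 := mdot_integrable oOm
  (tensor_mxL2 oOm mc c01 C (esym_L2 oOm (H2v_H1v Hut))) Lz.
have i3 := mdot_integrable oOm
  (phase_matrix_mxL2 oOm mc c01 bOm (fun y => - C y (Tau y))) Lz.
have i4 : integrableR Om (fun x => tdot (whess Om (u t) x) (whess Om z x)).
  by apply: tdot_integrable => // *; exact: whess_L2.
apply: (Rintegral_add4 mOm i1 i2 i4 i3) => x _; rewrite /Wel_deriv linearB/=.
have mD (A B D : 'M[R]_d) : mdot (A + B) D = mdot A D + mdot B D.
  by rewrite -[A]scale1r mdot_linl mul1r scale1r.
by rewrite !mD; ring.
Qed.

Lemma momentum_form_ae_measurable z : H2v Om z ->
  ae_measurable T (momentum_form ^~ z).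
Proof.
move=> Hz; have Lz := esym_L2 oOm (H2v_H1v Hz).
(* Measurability in time is required for every field, so the forms are extended
   by zero outside of their spaces. *)
pose P1 t v : R := if `[< H1perp Om v >] then
  \int[lam]_(x in Om) mdot (Cnu (chi t x) (Defs.esym Om v x)) (Defs.esym Om z x)
  else 0.
pose P2 t v : R := if `[< H2v Om v >] then
  \int[lam]_(x in Om) mdot (C (chi t x) (Defs.esym Om v x)) (Defs.esym Om z x)
  + \int[lam]_(x in Om) tdot (whess Om v x) (whess Om z x)
  else 0.
have m1 : ae_measurable T (fun t => P1 t (p t)).
  apply: (bochner_comp_ae_measurable bp) => [v|].
    rewrite /P1; case: asboolP => [[Hv _]|_]; last exact: measurable_cst.
    exact: (measurable_tensor_form oOm mchi chi01 Cnu (esym_L2 oOm Hv) Lz).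
  apply: ae_timeS Hp => t t0T Hpt v_ cv.
  have [nv hv] := norm_H1perp_cvg oOm Hpt cv.
  have := mxL2cvg_Rintegral oOm
    (tensor_mxL2cvg oOm (phase_measurable oOm mchi t0T)
      (fun x => chi01 t0T (x := x)) Cnu (esym_mxL2cvg hv)) (mxL2cvg_cst oOm Lz).
  exact: (guarded_cvg Hpt nv).
have m2 : ae_measurable T (fun t => P2 t (u t)).
  apply: (bochner_comp_ae_measurable bu) => [v|].
    rewrite /P2; case: asboolP => [Hv|_]; last exact: measurable_cst.
    apply: measurable_funD; last exact: measurable_cst.
    exact: (measurable_tensor_form oOm mchi chi01 C
      (esym_L2 oOm (H2v_H1v Hv)) Lz).
  apply: ae_timeS Hu => t t0T Hut v_ cv.
  have [nv hv hhv] := norm_H2v_cvg oOm Hut cv.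
  have h1 := mxL2cvg_Rintegral oOm
    (tensor_mxL2cvg oOm (phase_measurable oOm mchi t0T)
      (fun x => chi01 t0T (x := x)) C (esym_mxL2cvg hv)) (mxL2cvg_cst oOm Lz).
  have h2 := tdot_cvg_Rintegral oOm hhv
    (fun i j k => L2cvg_cst oOm (whess_L2 oOm i j k Hz)).
  exact: (guarded_cvg Hut nv (cvgD h1 h2)).
have m3 := measurable_ae_measurable (measurable_phase_matrix_form oOm mchi chi01
  bOm (fun y => - C y (Tau y)) Lz).
apply: ae_measurable_eq (ae_measurableD (ae_measurableD m1 m2) m3).
apply: ae_timeS (ae_timeI Hu Hp) => t t0T [Hut Hpt].
by rewrite /P1 /P2 !asboolT// momentum_form_split.
Qed.

Hypothesis momentum : forall z : R -> E -> E, L2t (norm_H2v Om) T z ->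
  \int[leb]_(t in `]0, T[) momentum_form t (z t) = 0.

Lemma norm_H2v0 : norm_H2v Om 0 = 0%E.
Proof.
rewrite /norm_H2v /space_norm asboolT; last exact: H2v0.
have g0 := wgrad0 oOm bOm; have h0 := whess0 oOm bOm.
have -> : H1v_dot Om 0 0 = 0.
  rewrite /H1v_dot (@ae_eq_Rintegral _ _ _ mOm _ (fun=> 0)).
  - by rewrite Rintegral_cst// mul0r.
  - by apply: integrableR_measurable; apply: H1v_dot_integrable => //; exact: H1v0.
  - exact: measurable_cst.
  - apply: ae_onS g0 => x _ ->; rewrite /dotv /mdot !big1 ?addr0// => i _.
      by rewrite big1// => j _; rewrite mxE mul0r.
    by rewrite mxE mul0r.
rewrite add0r (@ae_eq_Rintegral _ _ _ mOm _ (fun=> 0)).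
- by rewrite Rintegral_cst// mul0r sqrtr0.
- apply: integrableR_measurable; apply: tdot_integrable => // *;
    by apply: whess_L2 => //; exact: H2v0.
- exact: measurable_cst.
- apply: ae_onS h0 => x _ h; rewrite /tdot big1// => i _; rewrite big1// => j _.
  by rewrite big1// => k _; rewrite h mul0r.
Qed.

Lemma momentum_form0 t : 0 < t < T -> H2v Om (u t) -> H1perp Om (p t) ->
  momentum_form t 0 = 0.
Proof.
move=> t0T Hut Hpt.
have H0 := H2v0 oOm bOm.
have LS := mxL2D (stress_mxL2 t0T Hpt) (Wel_deriv_mxL2 t0T Hut).
rewrite /momentum_form (@ae_eq_Rintegral _ _ _ mOm _ (fun=> 0)).
- by rewrite Rintegral_cst// mul0r.
- apply: integrableR_measurable; apply: integrableRD => //.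
    by apply: (mdot_integrable oOm LS); exact: (esym_L2 oOm (H2v_H1v H0)).
  by apply: tdot_integrable => // *; exact: whess_L2.
- exact: measurable_cst.
- apply: ae_onS (ae_onI (esym0 oOm bOm) (whess0 oOm bOm)) => x _ [-> h].
  rewrite /mdot /tdot !big1 ?addr0// => i _.
    by rewrite big1// => j _; rewrite big1// => k _; rewrite h mulr0.
  by rewrite big1// => j _; rewrite [X in _ * X]mxE mulr0.
Qed.

Lemma indic_scale_L2t z (A : set (measurableTypeR R)) : measurable A ->
  H2v Om z -> L2t (norm_H2v Om) T (fun t => (\1_A t : R) *: z).
Proof.
move=> mA Hz; split.
  exists (fun=> @SimpleFun R _ 1 (fun=> A) (fun=> z) (fun=> mA)).
  apply: aeW => t _; rewrite /sf_eval big_ord1 /= subrr norm_H2v0.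
  exact: cvg_cst.
have Nz : exists2 c : R, 0 <= c & norm_H2v Om z = c%:E.
  rewrite /norm_H2v /space_norm asboolT//; eexists; last reflexivity.
  exact: sqrtr_ge0.
have [c c0 Nc] := Nz.
apply: (@le_lt_trans _ _ (\int[leb]_(t in `]0%R, T[) (c ^+ 2)%:E)%E).
  apply: le_integral_all => t _; rewrite indicE.
  case: (_ \in _) => /=; first by rewrite scale1r Nc -EFinM expr2.
  by rewrite scale0r norm_H2v0 mul0e lee_fin sqr_ge0.
rewrite integral_cst//.
apply: lte_mul_pinfty; rewrite ?lee_fin ?sqr_ge0//.
change (lebesgue_measure `]0%R, T[%classic < +oo)%E.
by rewrite lebesgue_measure_itv/=; case: ifP => _; rewrite ltry.
Qed.

(** Tested with fields 1_A(t) z, the balance integrated over all times yields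
    its integral over each set A of times. *)
Lemma momentum_form_ae0 z : H2v Om z -> ae_time T (fun t => momentum_form t z = 0).
Proof.
move=> Hz; apply: integral_indic_ae_eq0; first exact: momentum_form_ae_measurable.
move=> A mA; exists (fun t => momentum_form t ((\1_A t : R) *: z)).
  apply: ae_timeS (ae_timeI Hu Hp) => t t0T [Hut Hpt]; rewrite indicE.
  case: (_ \in _) => /=; first by rewrite scale1r mul1r.
  by rewrite scale0r mul0r momentum_form0.
by apply: momentum; exact: indic_scale_L2t.
Qed.

Definition H2_components (z : E -> E)
    (i : ('I_d * 'I_d) + ('I_d * 'I_d * 'I_d)) (x : E) : R :=
  match i with
  | inl ij => Defs.esym Om z x ij.1 ij.2
  | inr ijk => whess Om z x ijk.1.1 ijk.1.2 ijk.2
  end.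

(** The exceptional null set can be chosen independently of the test field,
    since the space of test fields is separable. *)
Lemma momentum_at_ae_time :
  ae_time T (fun t => forall z, H2v Om z -> momentum_form t z = 0).
Proof.
have LJ z i : H2v Om z -> L2 Om (H2_components z i).
  move=> Hz; case: i => [[i j]|[[i j] k]].
    exact: (esym_L2 oOm (H2v_H1v Hz)).
  exact: whess_L2.
have [K [zz [Hzz dense]]] :=
  L2_family_separable oOm bOm (H2v0 oOm bOm) (fun z i Hz => LJ z i Hz).
have H0 : ae_time T (fun t => forall k, momentum_form t (zz k) = 0).
  suff : {ae leb, forall t, forall k, 0 < t < T -> momentum_form t (zz k) = 0}.
    by rewrite /ae_time; apply: filterS => t h t0T k; exact: h.
  apply: ae_forall_countable => k; exact: momentum_form_ae0.
apply: ae_timeS (ae_timeI H0 (ae_timeI Hu Hp)) => t t0T [Hk [Hut Hpt]] z Hz.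
have hk n : exists k, forall i,
    L2sq Om (fun x => H2_components z i x - H2_components (zz k) i x)
    < harmonic n.
  by apply: dense => //; rewrite invr_gt0.
pose k n := projT1 (cid (hk n)).
have kP n i : L2sq Om (fun x => H2_components z i x -
    H2_components (zz (k n)) i x) < harmonic n.
  by rewrite /k; case: cid.
have cv i : L2cvg Om (fun n => H2_components (zz (k n)) i) (H2_components z i).
  apply: (L2cvg_squeeze _ _ _ (@cvg_harmonic R)).
  - exact: (LJ _ i Hz).
  - by apply: nearW => n; exact: (LJ _ i (Hzz (k n))).
  - by apply: nearW => n; apply/ltW; exact: kP.
have LS := mxL2D (stress_mxL2 t0T Hpt) (Wel_deriv_mxL2 t0T Hut).
have h1 := mxL2cvg_Rintegral oOm (mxL2cvg_cst oOm LS)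
  (fun i j => cv (inl (i, j)) : L2cvg Om (fun n x => Defs.esym Om (zz (k n)) x i j)
     (fun x => Defs.esym Om z x i j)).
have h2 := tdot_cvg_Rintegral oOm
  (fun i j l => L2cvg_cst oOm (whess_L2 oOm i j l Hut))
  (fun i j l => cv (inr (i, j, l)) : L2cvg Om
     (fun n x => whess Om (zz (k n)) x i j l) (fun x => whess Om z x i j l)).
have mfE v : H2v Om v -> momentum_form t v =
    \int[lam]_(x in Om) mdot (stress t x +
       Wel_deriv C Tau (chi t x) (Defs.esym Om (u t) x)) (Defs.esym Om v x)
    + \int[lam]_(x in Om) tdot (whess Om (u t) x) (whess Om v x).
  move=> Hv; rewrite /momentum_form RintegralD//.
    by apply: (mdot_integrable oOm LS); exact: (esym_L2 oOm (H2v_H1v Hv)).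
  by apply: tdot_integrable => // *; exact: whess_L2.
have : (fun n => momentum_form t (zz (k n))) @ \oo --> momentum_form t z.
  rewrite (mfE z Hz).
  rewrite (_ : (fun n => _) = (fun n => \int[lam]_(x in Om)
      mdot (stress t x + Wel_deriv C Tau (chi t x) (Defs.esym Om (u t) x))
           (Defs.esym Om (zz (k n)) x)
    + \int[lam]_(x in Om) tdot (whess Om (u t) x) (whess Om (zz (k n)) x))).
    exact: (cvgD h1 h2).
  by apply/funext => n; exact: (mfE _ (Hzz _)).
rewrite (_ : (fun n => _) = (fun=> 0)).
  by move=> /(cvg_lim (@Rhausdorff R)); rewrite lim_cst.
by apply/funext => n; exact: Hk.
Qed.

End momentum_localization.

(** * Test fields and the product rule *)

Lemma continuous_entry (R : realType) (V : topologicalType) m n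
    (f : V -> 'M[R]_(m, n)) i j : continuous f -> continuous (fun x => f x i j).
Proof.
move=> cf x; apply: (@continuous_comp _ _ _ f (fun M : 'M[R]_(m, n) => M i j)).
  exact: cf.
exact: coord_continuous.
Qed.

Section C2_fields.
Context (R : realType) (d : nat).
Local Notation E := 'rV[R]_d.
Implicit Types (B : E -> E).

Lemma continuous_coordf B i : continuous B -> continuous (coordf B i).
Proof. exact: continuous_entry. Qed.

Lemma Ck1_coordf B i : Ck 1 B -> Ck 1 (coordf B i).
Proof.
move=> [cB [dB dcB]]; split; first exact: continuous_coordf.
split=> [x v|v]; first by move/derivable_mxP : (dB x v) => /(_ ord0 i).
split=> //; have -> : 'D_v (coordf B i) = coordf ('D_v B) i.
  by apply/funext => x; rewrite /coordf derive_mx// mxE.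
by apply: continuous_coordf; have [] := dcB v.
Qed.

Lemma Ck2_Ck1 B : Ck 2 B -> Ck 1 B.
Proof.
move=> [cB [dB dcB]]; split=> //; split=> // v; split=> //.
by have [] := dcB v.
Qed.

Lemma continuous_pderiv B i j : Ck 1 B -> continuous (pderiv j (coordf B i)).
Proof. by move=> /(Ck1_coordf i); exact: Ck1_derive_continuous. Qed.

End C2_fields.

Section transported_fields.
Context (R : realType) (d : nat).
Local Notation E := 'rV[R]_d.
Local Notation lam := (lebesgue_rV d : {measure set E -> \bar R}).
Variable Om : set E.
Hypotheses (oOm : open Om) (bOm : bounded_set Om).
Let mOm : measurable Om. Proof. exact: open_measurable_rV. Qed.

Lemma H1_sum (I : Type) (r : seq I) (F : I -> E -> R) :
  (forall i, H1 Om (F i)) -> H1 Om (fun x => \sum_(i <- r) F i x).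
Proof.
move=> HF; rewrite -fct_sumE; apply: (big_ind (H1 Om)) => // [|f g Hf Hg].
  exact: H1_cst.
by have := H1_lin oOm 1 Hf Hg; under eq_fun do rewrite mul1r.
Qed.

Lemma wpartial_sum (I : Type) (r : seq I) (F : I -> E -> R) j :
  (forall i, H1 Om (F i)) ->
  ae_on Om (fun x => wpartial Om j (fun x => \sum_(i <- r) F i x) x =
                     \sum_(i <- r) wpartial Om j (F i) x).
Proof.
move=> HF; elim: r => [|i r IH].
  rewrite (_ : (fun x => \sum_(i <- [::]) F i x) = fun=> 0).
    by apply: ae_onS (wpartial_cst oOm bOm j 0) => x _ ->; rewrite big_nil.
  by apply/funext => x; rewrite big_nil.
rewrite (_ : (fun x => \sum_(_ <- i :: r) _) =
  fun x => 1 * F i x + \sum_(j <- r) F j x); last first.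
  by apply/funext => x; rewrite big_cons mul1r.
have := wpartial_lin oOm j 1 (HF i) (H1_sum r HF).
move=> h; apply: ae_onS (ae_onI h IH) => x _ [-> ->].
by rewrite big_cons mul1r.
Qed.

Section grad_apply_rule.
Variables u B : E -> E.
Hypotheses (Hu : H2v Om u) (CB : Ck 1 B).

Let coordf_grad_apply i : coordf (grad_apply Om u B) i =
  fun x => \sum_j (wpartial Om j (coordf u i) x * coordf B j x).
Proof.
apply/funext => x; rewrite /coordf mxE; apply: eq_bigr => j _.
by rewrite mxE.
Qed.

Let H1_term i j :
  H1 Om (fun x => wpartial Om j (coordf u i) x * coordf B j x).
Proof.
apply: (H1_M oOm bOm); last exact: Ck1_coordf.
by have [_ ] := Hu.
Qed.

Lemma H1v_grad_apply : H1v Om (grad_apply Om u B).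
Proof. by move=> i; rewrite coordf_grad_apply; exact: H1_sum. Qed.

(** The Hessian and gradient terms that the viscous stress contracts in the
    Gibbs-Thomson law add up to the gradient of the transported field
    [grad_apply Om u B]. *)
Lemma wgrad_grad_apply : ae_on Om (fun x =>
  wgrad Om (grad_apply Om u B) x =
  hess_apply Om u B x + wgrad Om u x *m cgrad B x).
Proof.
have : ae_on Om (fun x => forall i k,
    wpartial Om k (coordf (grad_apply Om u B) i) x =
    \sum_j (whess Om u x i k j * coordf B j x +
            wpartial Om j (coordf u i) x * pderiv k (coordf B j) x)).
  apply: ae_on_fin => i; apply: ae_on_fin => k; rewrite coordf_grad_apply.
  have h1 := wpartial_sum (index_enum 'I_d) k (H1_term i).
  have h2 : ae_on Om (fun x => forall j,
      wpartial Om k (fun x => wpartial Om j (coordf u i) x * coordf B j x) x =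
      whess Om u x i k j * coordf B j x +
      wpartial Om j (coordf u i) x * pderiv k (coordf B j) x).
    apply: ae_on_fin => j; apply: (wpartial_M oOm); last exact: Ck1_coordf.
    by have [_ ] := Hu.
  apply: ae_onS (ae_onI h1 h2) => x _ [-> h].
  by apply: eq_bigr => j _; exact: h.
apply: ae_onS => x _ h; apply/matrixP => i k; rewrite !mxE h big_split/=.
by congr (_ + _); apply: eq_bigr => j _; rewrite !mxE.
Qed.

End grad_apply_rule.

Section scalar_times_field.
Variables (xi : E -> R) (B : E -> E).
Hypotheses (Hxi : H1 Om xi) (CB : Ck 1 B).

Let coordf_scale i : coordf (fun y => xi y *: B y) i =
  fun x => xi x * coordf B i x.
Proof. by apply/funext => x; rewrite /coordf mxE. Qed.

Lemma wdiv_scale : ae_on Om (fun x => wdiv Om (fun y => xi y *: B y) x =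
  dotv (wgrad1 Om xi x) (B x) + xi x * cdiv B x).
Proof.
have : ae_on Om (fun x => forall i,
    wpartial Om i (coordf (fun y => xi y *: B y) i) x =
    wpartial Om i xi x * coordf B i x + xi x * pderiv i (coordf B i) x).
  apply: ae_on_fin => i; rewrite coordf_scale.
  by apply: (wpartial_M oOm) => //; exact: Ck1_coordf.
apply: ae_onS => x _ h; rewrite /wdiv /cdiv mulr_sumr -big_split/=.
by apply: eq_bigr => i _; rewrite h mxE.
Qed.

Lemma wdiv_scale_L2 : L2 Om (wdiv Om (fun y => xi y *: B y)).
Proof.
apply: (L2_sum mOm) => i _; apply: (H1_wpartial_L2 oOm).
rewrite coordf_scale; apply: (H1_M oOm bOm) => //; exact: Ck1_coordf.
Qed.

End scalar_times_field.

End transported_fields.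

(** * The transport functional *)

Lemma Rintegral_young dT (X : measurableType dT) (R : realType)
    (m : {measure set X -> \bar R}) (D : set X) (h f g : X -> R) :
  measurable D -> m.-integrable D (EFin \o h) ->
  m.-integrable D (EFin \o f) -> m.-integrable D (EFin \o g) ->
  (forall x, D x -> - h x <= 2^-1 * f x + 2^-1 * g x) ->
  - (\int[m]_(x in D) h x) <=
    2^-1 * \int[m]_(x in D) f x + 2^-1 * \int[m]_(x in D) g x.
Proof.
move=> mD ih iF ig hfg.
have i2f : m.-integrable D (EFin \o (fun x => 2^-1 * f x)).
  exact: (integrableZl mD 2^-1 iF).
have i2g : m.-integrable D (EFin \o (fun x => 2^-1 * g x)).
  exact: (integrableZl mD 2^-1 ig).
have ifg : m.-integrable D (EFin \o (fun x => 2^-1 * f x + 2^-1 * g x)).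
  exact: (integrableD mD i2f i2g).
have iNh : m.-integrable D (EFin \o (fun x => -1 * h x)).
  exact: (integrableZl mD (-1) ih).
rewrite -mulN1r -!RintegralZl//.
rewrite -(RintegralD mD i2f i2g); apply: le_Rintegral => // x Dx.
by rewrite mulN1r; exact: hfg.
Qed.

Section transport_bound.
Context (R : realType) (d : nat).
Local Notation E := 'rV[R]_d.
Local Notation lam := (lebesgue_rV d : {measure set E -> \bar R}).
Variable Om : set E.
Hypotheses (oOm : open Om) (bOm : bounded_set Om).
Let mOm : measurable Om. Proof. exact: open_measurable_rV. Qed.
Variable chi : E -> R.
Hypothesis mchi : measurable_fun Om chi.
Hypothesis chi01 : forall x, Om x -> chi x = 0 \/ chi x = 1.
Variable B : E -> E.
Hypotheses (CB : Ck 1 B) (chiB : \int[lam]_(x in Om) (chi x * cdiv B x) = 0).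

Lemma phase_M_integrable f : L2 Om f -> integrableR Om (fun x => chi x * f x).
Proof.
move=> Lf; apply: (L2_integrable oOm bOm).
exact: (phase_coeff_L2 oOm mchi chi01 id Lf).
Qed.

Lemma continuous_L2 (b : E -> R) : continuous b -> L2 Om b.
Proof.
move=> cb; have := L2_Mcontinuous oOm bOm (L2_cst oOm bOm 1) cb.
by under eq_fun do rewrite mul1r.
Qed.

Lemma cdiv_L2 : L2 Om (cdiv B).
Proof.
by apply: (L2_sum mOm) => i _; apply: continuous_L2; exact: continuous_pderiv.
Qed.

Lemma H1_shift w c : H1 Om w -> H1 Om (fun x => w x + c).
Proof.
move=> Hw; have := H1_lin oOm 1 Hw (H1_cst oOm bOm c).
by under eq_fun do rewrite mul1r.
Qed.

Lemma wgrad1_shift w c : H1 Om w ->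
  ae_on Om (fun x => wgrad1 Om (fun x => w x + c) x = wgrad1 Om w x).
Proof.
move=> Hw.
have : ae_on Om (fun x => forall j,
    wpartial Om j (fun x => w x + c) x = wpartial Om j w x).
  apply: ae_on_fin => j.
  have := wpartial_lin oOm j 1 Hw (H1_cst oOm bOm c).
  rewrite (_ : (fun x => 1 * w x + c) = (fun x => w x + c)); last first.
    by apply/funext => x; rewrite mul1r.
  move=> h; apply: ae_onS (ae_onI h (wpartial_cst oOm bOm j c)) => x _ [-> ->].
  by rewrite mul1r addr0.
by apply: ae_onS => x _ h; apply/rowP => j; rewrite !mxE h.
Qed.

(** The volume constraint on [B] makes the functional blind to constants. *)
Lemma transport_shift w c : H1 Om w ->
  transport Om B chi (fun x => w x + c) = transport Om B chi w.
Proof.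
move=> Hw; have Hs := H1_shift c Hw.
have ic : integrableR Om (fun x => c * (chi x * cdiv B x)).
  by apply: integrableRZ => //; apply: phase_M_integrable; exact: cdiv_L2.
have iw : integrableR Om (fun x => chi x * wdiv Om (fun y => w y *: B y) x).
  by apply: phase_M_integrable; exact: wdiv_scale_L2.
have e : \int[lam]_(x in Om) (chi x * wdiv Om (fun y => (w y + c) *: B y) x) =
    \int[lam]_(x in Om)
      (chi x * wdiv Om (fun y => w y *: B y) x + c * (chi x * cdiv B x)).
  apply: (ae_eq_Rintegral mOm).
  - apply: integrableR_measurable; apply: phase_M_integrable.
    exact: wdiv_scale_L2.
  - by apply: integrableR_measurable; exact: integrableRD.
  - have h1 := wdiv_scale oOm Hs CB; have h2 := wdiv_scale oOm Hw CB.
    apply: ae_onS (ae_onI (ae_onI h1 h2) (wgrad1_shift c Hw)).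
    by move=> x _ [[-> ->] ->]; ring.
rewrite /transport e (RintegralD mOm iw ic) RintegralZl ?chiB ?mulr0 ?addr0//.
by apply: phase_M_integrable; exact: cdiv_L2.
Qed.

Lemma exists_mean_zero_shift w : H1 Om w ->
  exists c, mean_zero Om (fun x => w x + c).
Proof.
move=> Hw; have iw := L2_integrable oOm bOm (H1_L2 Hw).
have shiftE c : \int[lam]_(x in Om) (w x + c) =
    \int[lam]_(x in Om) w x + c * fine (lam Om).
  rewrite (RintegralD mOm iw (integrableR_cst oOm bOm c)).
  by rewrite Rintegral_cst.
(* A null domain leaves no constant to subtract, but all means vanish. *)
have [l0|l0] := eqVneq (fine (lam Om)) 0; last first.
  exists (- (\int[lam]_(x in Om) w x) / fine (lam Om)).
  by rewrite /mean_zero shiftE divfK// subrr.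
exists 0; rewrite /mean_zero shiftE mul0r addr0.
rewrite (@ae_eq_Rintegral _ _ _ mOm _ (fun=> 0)).
- by rewrite Rintegral_cst// mul0r.
- exact: integrableR_measurable.
- exact: measurable_cst.
- exists Om; split=> //; last by move=> x /= /not_implyP[].
  have fOm : lam Om \is a fin_num.
    by rewrite ge0_fin_numE//; exact: bounded_open_measure_fin.
  by rewrite -[LHS]fineK// l0.
Qed.

Lemma dotv_young (a b : E) :
  - dotv a b <= 2^-1 * dotv a a + 2^-1 * dotv b b.
Proof.
rewrite -mulrDr /dotv -big_split/= mulr_sumr -sumrN; apply: ler_sum => i _.
by have := sqr_ge0 (a ord0 i + b ord0 i); nra.
Qed.

Lemma wgrad1_dot_integrable v w : H1 Om v -> H1 Om w ->
  integrableR Om (fun x => dotv (wgrad1 Om v x) (wgrad1 Om w x)).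
Proof.
move=> Hv Hw; apply: (integrableR_sum mOm) => j _.
under eq_fun do rewrite !mxE.
by apply: L2M_integrable => //; exact: H1_wpartial_L2.
Qed.

(** Tested with [w], shifted to have mean zero, the Neumann problem solved by
    [v] writes the transport functional as a scalar product of gradients. *)
Lemma transport_le v w : H1 Om w -> is_neumann_sol Om (transport Om B chi) v ->
  - transport Om B chi w <=
    2^-1 * \int[lam]_(x in Om) dotv (wgrad1 Om v x) (wgrad1 Om v x) +
    2^-1 * \int[lam]_(x in Om) dotv (wgrad1 Om w x) (wgrad1 Om w x).
Proof.
move=> Hw [Hv _ solv]; have [c mc] := exists_mean_zero_shift Hw.
have Hs := H1_shift c Hw.
have iv := wgrad1_dot_integrable Hv Hv; have iw := wgrad1_dot_integrable Hw Hw.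
have ivw := wgrad1_dot_integrable Hv Hw.
rewrite -(transport_shift c Hw) -(solv _ Hs mc).
have -> : \int[lam]_(x in Om)
    dotv (wgrad1 Om v x) (wgrad1 Om (fun x => w x + c) x) =
    \int[lam]_(x in Om) dotv (wgrad1 Om v x) (wgrad1 Om w x).
  apply: (ae_eq_Rintegral mOm).
  - by apply: integrableR_measurable; exact: wgrad1_dot_integrable.
  - exact: integrableR_measurable.
  - by apply: ae_onS (wgrad1_shift c Hw) => x _ ->.
apply: (Rintegral_young mOm ivw iv iw).
by move=> x _; exact: dotv_young.
Qed.

End transport_bound.

(** * Elastic and viscous work at a fixed time *)

Lemma continuous_sumr (R : realType) (V : topologicalType) (I : Type)
    (r : seq I) (F : I -> V -> R) : (forall i, continuous (F i)) ->
  continuous (fun x => \sum_(i <- r) F i x).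
Proof.
move=> cF; rewrite -fct_sumE; apply: (big_ind (fun f : V -> R => continuous f)) => // [|f g cf cg] x.
  exact: cvg_cst.
exact: cvgD (cf x) (cg x).
Qed.

Section matrix_contraction.
Context (R : realType) (d : nat).
Implicit Types A B G S : 'M[R]_d.

Lemma mdot_trace A B : mdot A B = \tr (A^T *m B).
Proof.
rewrite /mdot exchange_big; apply: eq_bigr => i _; rewrite mxE.
by apply: eq_bigr => j _; rewrite mxE.
Qed.

Lemma mdot_trmul A S G : mdot (A^T *m S) G = mdot S (A *m G).
Proof. by rewrite !mdot_trace trmx_mul trmxK mulmxA. Qed.

Lemma mdot_scalar_sub (c : R) A G :
  mdot (c *: 1%:M - A) G = c * \tr G - mdot A G.
Proof.
rewrite mdot_linl -[- A]addr0 -scaleN1r mdot_linl mulN1r.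
rewrite [mdot 1%:M G]mdot_trace trmx1 mul1mx.
by rewrite (_ : mdot 0 G = 0) ?addr0// mdot_trace trmx0 mul0mx mxtrace0.
Qed.

Lemma mdot_sympart S G : symmx S -> mdot S (sympart G) = mdot S G.
Proof.
move=> SS; have -> : sympart G = 2^-1 *: G + (2^-1 *: G^T + 0).
  by rewrite /sympart scalerDr addr0.
rewrite !mdot_linr.
rewrite (_ : mdot S 0 = 0); last by rewrite mdot_trace mulmx0 mxtrace0.
rewrite (_ : mdot S G^T = mdot S G); first by rewrite addr0; field.
by rewrite !mdot_trace -mxtrace_tr trmx_mul !trmxK mxtrace_mulC SS.
Qed.

Lemma elastic_form_ge0 (C : R -> {linear 'M[R]_d -> 'M[R]_d}) y A :
  elastic_tensor C -> symmx A -> 0 <= mdot (C y A) A.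
Proof.
move=> [_ _ [c c0 posC]] sA; apply: le_trans (posC _ _ sA).
by rewrite mulr_ge0 ?(ltW c0)// mdot_ge0.
Qed.

(** This is the positivity of the quadratic form at [A + B]. *)
Lemma elastic_young (C : R -> {linear 'M[R]_d -> 'M[R]_d}) y A B :
  elastic_tensor C -> symmx A -> symmx B ->
  - mdot (C y A) B <= 2^-1 * mdot (C y A) A + 2^-1 * mdot (C y B) B.
Proof.
move=> hC sA sB; have [_ sC _] := hC.
have sAB : symmx (A + B) by rewrite /symmx raddfD/= sA sB.
have := elastic_form_ge0 y hC sAB.
have BA : mdot (C y B) A = mdot (C y A) B by rewrite (sC _ _ _ sB sA) mdotC.
rewrite linearD -[C y A]scale1r mdot_linl -[A in A + B]scale1r !mdot_linr.
by rewrite !mul1r BA scale1r; lra.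
Qed.

End matrix_contraction.

Section slope_bound.
Context (R : realType) (d : nat).
Local Notation E := 'rV[R]_d.
Local Notation lam := (lebesgue_rV d : {measure set E -> \bar R}).
Variable Om : set E.
Hypotheses (oOm : open Om) (bOm : bounded_set Om).
Let mOm : measurable Om. Proof. exact: open_measurable_rV. Qed.

Lemma integrableR_Mcontinuous (f b : E -> R) : integrableR Om f ->
  continuous b -> integrableR Om (fun x => f x * b x).
Proof.
move=> iF cb; have [K bK] := continuous_bounded_on bOm cb.
apply: (integrableR_le mOm (g := fun x => K * `|f x|)).
- apply: measurable_funM; first exact: integrableR_measurable.
  exact: continuous_measurable_on.
- by move=> x Ox; rewrite normrM mulrC ler_wpM2r// bK.
- by apply: integrableRZ => //; exact: (integrable_norm iF).
Qed.

Variable chi : E -> R.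
Hypothesis mchi : measurable_fun Om chi.
Hypothesis chi01 : forall x, Om x -> chi x = 0 \/ chi x = 1.
Variables (C Cnu : R -> {linear 'M[R]_d -> 'M[R]_d}) (Tau : R -> 'M[R]_d).
Hypotheses (hC : elastic_tensor C) (hCnu : elastic_tensor Cnu).
Hypothesis hTau : forall y, symmx (Tau y).
Variables u p : E -> E.
Hypotheses (Hu : H2v Om u) (Hp : H1v Om p).

Local Notation S x := (Cnu (chi x) (Defs.esym Om p x)).
Local Notation We x := (Wel_deriv C Tau (chi x) (Defs.esym Om u x)).

Lemma stress_sym x : symmx (S x).
Proof. by have [h _ _] := hCnu; apply: h; exact: sympart_sym. Qed.

Lemma elastic_stress_sym x : symmx (We x).
Proof.
have [h _ _] := hC; apply: h.
by rewrite /symmx raddfB/= hTau; congr (_ - _); exact: sympart_sym.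
Qed.

Lemma strain_mxL2 : mxL2 Om (fun x => Defs.esym Om u x - Tau (chi x)).
Proof.
move=> i j; rewrite (_ : (fun x => _) = (fun x =>
  Defs.esym Om u x i j - Tau (chi x) i j)); last first.
  by apply/funext => x; rewrite !mxE.
apply: (L2B mOm); first exact: (esym_L2 oOm (H2v_H1v Hu)).
exact: (phase_matrix_mxL2 oOm mchi chi01 bOm Tau).
Qed.

Lemma elastic_stress_mxL2 : mxL2 Om (fun x => We x).
Proof. exact: (tensor_mxL2 oOm mchi chi01 C strain_mxL2). Qed.

Lemma viscous_stress_mxL2 : mxL2 Om (fun x => S x).
Proof. exact: (tensor_mxL2 oOm mchi chi01 Cnu (esym_L2 oOm Hp)). Qed.

Definition viscous_form z : R := \int[lam]_(x in Om)
  mdot (Cnu (chi x) (Defs.esym Om z x)) (Defs.esym Om z x).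

Lemma viscous_form_integrable z : H1v Om z -> integrableR Om
  (fun x => mdot (Cnu (chi x) (Defs.esym Om z x)) (Defs.esym Om z x)).
Proof.
move=> Hz; apply: (mdot_integrable oOm); last exact: esym_L2.
exact: (tensor_mxL2 oOm mchi chi01 Cnu (esym_L2 oOm Hz)).
Qed.

Lemma viscous_form_ge0 z : 0 <= viscous_form z.
Proof.
by apply: Rintegral_ge0 => x _; apply: elastic_form_ge0 => //; exact: sympart_sym.
Qed.

Lemma sqnorm_chiE z : H1v Om z ->
  sqnorm_chi Om Cnu chi z = (viscous_form z)%:E.
Proof.
move=> Hz; rewrite /viscous_form /Rintegral fineK//.
by apply: (integrable_fin_num mOm); exact: viscous_form_integrable.
Qed.

Lemma viscous_work_ge y : H1v Om y ->
  - (\int[lam]_(x in Om) mdot (S x) (Defs.esym Om y x)) <=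
  2^-1 * viscous_form p + 2^-1 * viscous_form y.
Proof.
move=> Hy; apply: (Rintegral_young mOm
  (mdot_integrable oOm viscous_stress_mxL2 (esym_L2 oOm Hy))
  (viscous_form_integrable Hp) (viscous_form_integrable Hy)) => x _.
by apply: elastic_young => //; exact: sympart_sym.
Qed.

Section test_field.
Variable B : E -> E.
Hypothesis CB : Ck 2 B.
Let C1B : Ck 1 B := Ck2_Ck1 CB.

Lemma grad_cgrad_mxL2 : mxL2 Om (fun x => wgrad Om u x *m cgrad B x).
Proof.
move=> i k; rewrite (_ : (fun x => _) = (fun x =>
  \sum_j (wgrad Om u x i j * pderiv k (coordf B j) x))); last first.
  by apply/funext => x; rewrite mxE; apply: eq_bigr => j _; rewrite !mxE.
apply: (L2_sum mOm) => j _; apply: (L2_Mcontinuous oOm bOm).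
  exact: (wgrad_L2 oOm (H2v_H1v Hu)).
exact: continuous_pderiv.
Qed.

Lemma hess_apply_mxL2 : mxL2 Om (hess_apply Om u B).
Proof.
move=> i j; under eq_fun do rewrite mxE.
apply: (L2_sum mOm) => k _; apply: (L2_Mcontinuous oOm bOm).
  exact: whess_L2.
by apply: (@continuous_coordf _ _ B k); have [] := C1B.
Qed.

Let hess_prod_integrable i j k i' j' k' b : continuous b ->
  integrableR Om (fun x => whess Om u x i j k * whess Om u x i' j' k' * b x).
Proof.
move=> cb; apply: integrableR_Mcontinuous => //.
by apply: (L2M_integrable mOm); exact: whess_L2.
Qed.

Let continuous_cgrad i j : continuous (fun x => cgrad B x i j).
Proof.
rewrite (_ : (fun x => _) = pderiv j (coordf B i)); last first.
  by apply/funext => x; rewrite mxE.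
exact: continuous_pderiv.
Qed.

Lemma hess_term2_integrable : integrableR Om (hess_term2 Om u B).
Proof.
do 4 (apply: (integrableR_sum mOm) => ? _).
by apply: hess_prod_integrable; exact: continuous_cgrad.
Qed.

Lemma hess_term3_integrable : integrableR Om (hess_term3 Om u B).
Proof.
do 4 (apply: (integrableR_sum mOm) => ? _).
by apply: hess_prod_integrable; exact: continuous_cgrad.
Qed.

Lemma tr_cgrad x : \tr (cgrad B x) = cdiv B x.
Proof. by apply: eq_bigr => i _; rewrite mxE. Qed.

Lemma elastic_flux_integrable : integrableR Om (fun x =>
  mdot (Wel C Tau (chi x) (Defs.esym Om u x) *: 1%:M
        - (wgrad Om u x)^T *m We x) (cgrad B x)).
Proof.
rewrite (_ : (fun x => _) = (fun x =>
  2^-1 * (mdot (C (chi x) (Defs.esym Om u x - Tau (chi x)))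
    (Defs.esym Om u x - Tau (chi x)) * cdiv B x)
  - mdot (We x) (wgrad Om u x *m cgrad B x))); last first.
  by apply/funext => x; rewrite mdot_scalar_sub tr_cgrad mdot_trmul /Wel mulrA.
apply: (integrableRB mOm); last first.
  exact: (mdot_integrable oOm elastic_stress_mxL2 grad_cgrad_mxL2).
apply: (integrableRZ mOm); apply: integrableR_Mcontinuous.
  exact: (mdot_integrable oOm elastic_stress_mxL2 strain_mxL2).
by apply: continuous_sumr => i; exact: continuous_pderiv.
Qed.

End test_field.

End slope_bound.

(** * Reduction of the first variation *)

Section slope_reduction.
Context (R : realType) (d : nat).
Local Notation E := 'rV[R]_d.
Local Notation lam := (lebesgue_rV d : {measure set E -> \bar R}).
Variable Om : set E.
Hypotheses (oOm : open Om) (bOm : bounded_set Om).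
Let mOm : measurable Om. Proof. exact: open_measurable_rV. Qed.
Variable chi : E -> R.
Hypothesis mchi : measurable_fun Om chi.
Hypothesis chi01 : forall x, Om x -> chi x = 0 \/ chi x = 1.
Variables (C Cnu : R -> {linear 'M[R]_d -> 'M[R]_d}) (Tau : R -> 'M[R]_d).
Hypotheses (hC : elastic_tensor C) (hCnu : elastic_tensor Cnu).
Hypothesis hTau : forall y, symmx (Tau y).
Variables (u p : E -> E) (w : E -> R).
Hypotheses (Hu : H2v Om u) (Hp : H1v Om p) (Hw : H1 Om w).

Local Notation S x := (Cnu (chi x) (Defs.esym Om p x)).
Local Notation We x := (Wel_deriv C Tau (chi x) (Defs.esym Om u x)).

Hypothesis momentum : forall z, H2v Om z ->
  \int[lam]_(x in Om) (mdot (S x + We x) (Defs.esym Om z x)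
     + tdot (whess Om u x) (whess Om z x)) = 0.

Variables (B z : E -> E) (V : {measure set (E * E) -> \bar R}).
Hypotheses (HB : test_fields Om chi B) (Hz : H2v Om z).
Let CB : Ck 2 B. Proof. by have [] := HB. Qed.
Let C1B : Ck 1 B := Ck2_Ck1 CB.

Hypothesis gibbs_thomson :
  varifold_integral Om V (fun x s => mdot (1%:M - tensor s) (cgrad B x)) =
    \int[lam]_(x in Om) (chi x * wdiv Om (fun y => w y *: B y) x)
    + \int[lam]_(x in Om) mdot (S x) (hess_apply Om u B x)
    - \int[lam]_(x in Om)
        (2^-1 * tdot (whess Om u x) (whess Om u x) * cdiv B x)
    - \int[lam]_(x in Om)
        mdot (Wel C Tau (chi x) (Defs.esym Om u x) *: 1%:M
              - (wgrad Om u x)^T *m (S x + We x)) (cgrad B x)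
    + \int[lam]_(x in Om) hess_term1 Om u B x
    + \int[lam]_(x in Om) (hess_term2 Om u B x + hess_term3 Om u B x).

Local Notation y := (fun x => z x - grad_apply Om u B x).

Let yE : y = -1 *: grad_apply Om u B + z.
Proof. by apply/funext => x; rewrite scaleN1r addrC. Qed.

Lemma H1v_relative_velocity : H1v Om y.
Proof.
rewrite yE; apply: (H1v_lin oOm) (H2v_H1v Hz); exact: (H1v_grad_apply oOm bOm).
Qed.

Let LS : mxL2 Om (fun x => S x).
Proof. exact: viscous_stress_mxL2. Qed.

Let iSG : integrableR Om (fun x => mdot (S x) (wgrad Om u x *m cgrad B x)).
Proof. exact: (mdot_integrable oOm LS (grad_cgrad_mxL2 oOm bOm Hu CB)). Qed.

Let iSH : integrableR Om (fun x => mdot (S x) (hess_apply Om u B x)).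
Proof. exact: (mdot_integrable oOm LS (hess_apply_mxL2 oOm bOm Hu CB)). Qed.

Let iSz : integrableR Om (fun x => mdot (S x) (Defs.esym Om z x)).
Proof. exact: (mdot_integrable oOm LS (esym_L2 oOm (H2v_H1v Hz))). Qed.

Let LWe : mxL2 Om (fun x => We x).
Proof. exact: elastic_stress_mxL2. Qed.

Lemma elastic_flux_split :
  \int[lam]_(x in Om) mdot (Wel C Tau (chi x) (Defs.esym Om u x) *: 1%:M
              - (wgrad Om u x)^T *m (S x + We x)) (cgrad B x) =
  \int[lam]_(x in Om) mdot (Wel C Tau (chi x) (Defs.esym Om u x) *: 1%:M
              - (wgrad Om u x)^T *m We x) (cgrad B x)
  - \int[lam]_(x in Om) mdot (S x) (wgrad Om u x *m cgrad B x).
Proof.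
have iE := elastic_flux_integrable oOm bOm mchi chi01 C Tau Hu CB.
rewrite -(RintegralB mOm iE iSG); apply: eq_Rintegral => x _ /=.
rewrite !mdot_scalar_sub !mdot_trmul -[S x]scale1r mdot_linl mul1r scale1r.
ring.
Qed.

Lemma viscous_work_relative :
  \int[lam]_(x in Om) mdot (S x) (Defs.esym Om y x) =
  \int[lam]_(x in Om) mdot (S x) (Defs.esym Om z x)
  - (\int[lam]_(x in Om) mdot (S x) (hess_apply Om u B x)
     + \int[lam]_(x in Om) mdot (S x) (wgrad Om u x *m cgrad B x)).
Proof.
have iHG := integrableRD mOm iSH iSG.
rewrite -(RintegralD mOm iSH iSG) -(RintegralB mOm iSz iHG).
apply: (ae_eq_Rintegral mOm).
- apply: integrableR_measurable; apply: (mdot_integrable oOm LS).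
  by apply: esym_L2 => //; exact: H1v_relative_velocity.
- by apply: integrableR_measurable; exact: integrableRB.
- have h1 := wgrad_grad_apply oOm bOm Hu C1B.
  have h2 := esym_lin oOm (-1) (H1v_grad_apply oOm bOm Hu C1B) (H2v_H1v Hz).
  rewrite yE; apply: ae_onS (ae_onI h1 h2) => x _ [e1 ->] /=.
  rewrite mdot_linr [Defs.esym Om (grad_apply _ _ _) x]/Defs.esym e1.
  rewrite (mdot_sympart _ (stress_sym Om chi hCnu p x)).
  rewrite -[hess_apply Om u B x]scale1r mdot_linr scale1r; ring.
Qed.

(** The elastic stress is symmetric, so it does not distinguish the strain of
    [z] from its gradient. *)
Lemma momentum_split :
  \int[lam]_(x in Om) mdot (S x) (Defs.esym Om z x)
  + (\int[lam]_(x in Om) mdot (We x) (wgrad Om z x)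
     + \int[lam]_(x in Om) tdot (whess Om u x) (whess Om z x)) = 0.
Proof.
have iW : integrableR Om (fun x => mdot (We x) (wgrad Om z x)).
  exact: (mdot_integrable oOm LWe (wgrad_L2 oOm (H2v_H1v Hz))).
have iT : integrableR Om (fun x => tdot (whess Om u x) (whess Om z x)).
  by apply: (tdot_integrable oOm) => *; exact: whess_L2.
have iWT := integrableRD mOm iW iT.
rewrite -(RintegralD mOm iW iT) -(RintegralD mOm iSz iWT) -(momentum Hz).
apply: eq_Rintegral => x _ /=.
rewrite -[S x]scale1r mdot_linl mul1r scale1r -addrA; congr (_ + (_ + _)).
by rewrite (mdot_sympart _ (elastic_stress_sym Om chi hC hTau u x)).
Qed.

(** The Gibbs-Thomson law eliminates the varifold and the momentum balance
    eliminates the elastic forces, so that all energetic terms cancel.  What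
    is left is linear in the potential [w] and in the viscous stress, the
    latter acting on the velocity [z] relative to the transport by [B]. *)
Lemma first_variation_reduced :
  first_variation Om C Tau V chi u B z =
  - transport Om B chi w - \int[lam]_(x in Om) mdot (S x) (Defs.esym Om y x).
Proof.
have i2 := hess_term2_integrable oOm bOm Hu CB.
have i3 := hess_term3_integrable oOm bOm Hu CB.
have mom := momentum_split.
rewrite /first_variation gibbs_thomson elastic_flux_split.
rewrite (RintegralD mOm i2 i3) viscous_work_relative /transport opprK.
lra.
Qed.

End slope_reduction.

(** * Dissipation potentials *)

Section slope_bound_ereal.
Context (R : realType) (d : nat).
Local Notation E := 'rV[R]_d.
Local Notation lam := (lebesgue_rV d : {measure set E -> \bar R}).
Variable Om : set E.

Definition grad_form (w : E -> R) : R :=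
  \int[lam]_(x in Om) dotv (wgrad1 Om w x) (wgrad1 Om w x).

Lemma grad_form_ge0 w : 0 <= grad_form w.
Proof. by apply: Rintegral_ge0 => x _; exact: dotv_ge0. Qed.

(** The chosen potential solves the Neumann problem as soon as some potential
    does. *)
Lemma norm_Hm1_cases (f : (E -> R) -> R) :
  norm_Hm1 Om f = +oo%E \/ exists2 v, is_neumann_sol Om f v &
    ((norm_Hm1 Om f) ^+ 2)%E = (grad_form v)%:E.
Proof.
rewrite /norm_Hm1 /space_norm; case: asboolP => [ex|_]; last by left.
right; exists (inv_lapN Om f); first exact: (xgetPex _ ex).
by rewrite expe2 -EFinM -expr2 sqr_sqrtr// grad_form_ge0.
Qed.

Lemma grad_form_ereal w : open Om -> H1 Om w ->
  (\int[lam]_(x in Om) (dotv (wgrad1 Om w x) (wgrad1 Om w x))%:E)%E =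
  (grad_form w)%:E.
Proof.
move=> oOm Hw; rewrite /grad_form /Rintegral fineK//.
have mOm : measurable Om by exact: open_measurable_rV.
apply: (integrable_fin_num mOm).
exact: (wgrad1_dot_integrable oOm Hw Hw).
Qed.

End slope_bound_ereal.

(** * Dissipation rates as functions of time *)

Section square_norms_in_time.
Context (R : realType) (d : nat).
Local Notation E := 'rV[R]_d.
Variables (Om : set E) (T : R).
Hypotheses (oOm : open Om) (bOm : bounded_set Om).
Variable chi : R -> E -> R.
Local Notation I0T := (`]0, T[%classic : set (measurableTypeR R)).
Hypothesis mchi : measurable_fun (I0T `*` Om)
  (fun p : measurableTypeR R * E => chi p.1 p.2).
Hypothesis chi01 : forall t x, 0 < t < T -> Om x -> chi t x = 0 \/ chi t x = 1.
Variable Cnu : R -> {linear 'M[R]_d -> 'M[R]_d}.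

Lemma space_norm_ge0 P (q : R) : (0 <= space_norm P q)%E.
Proof.
by rewrite /space_norm; case: asboolP => _; rewrite ?lee_fin ?sqrtr_ge0 ?leey.
Qed.

Lemma space_norm_lty P (q : R) : (space_norm P q < +oo)%E <-> P.
Proof. by rewrite /space_norm; case: asboolP => HP; rewrite ?ltry ?ltxx. Qed.

Lemma norm_H1perp_lty v : (norm_H1perp Om v < +oo)%E <-> H1perp Om v.
Proof. exact: space_norm_lty. Qed.

Lemma norm_H1_lty v : (norm_H1 Om v < +oo)%E <-> H1 Om v.
Proof. exact: space_norm_lty. Qed.

Lemma norm_H1perp_lty_sub (v w : E -> E) : (norm_H1perp Om (v - w)%R < +oo)%E ->
  (norm_H1perp Om v < +oo)%E <-> (norm_H1perp Om w < +oo)%E.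
Proof.
move=> /norm_H1perp_lty Hvw; split=> /norm_H1perp_lty H; apply/norm_H1perp_lty.
  rewrite (_ : w = -1 *: (v - w) + v); first exact: H1perp_lin.
  by rewrite scaleN1r opprB addrNK.
rewrite (_ : v = 1 *: (v - w) + w); first exact: H1perp_lin.
by rewrite scale1r addrNK.
Qed.

Lemma norm_H1_lty_sub (v w : E -> R) : (norm_H1 Om (v - w)%R < +oo)%E ->
  (norm_H1 Om v < +oo)%E <-> (norm_H1 Om w < +oo)%E.
Proof.
move=> /norm_H1_lty Hvw; split=> /norm_H1_lty H; apply/norm_H1_lty.
  rewrite (_ : w = fun x => -1 * (v - w) x + v x); first exact: H1_lin.
  by apply/funext => x; rewrite mulN1r opprB addrNK.
rewrite (_ : v = fun x => 1 * (v - w) x + w x); first exact: H1_lin.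
by apply/funext => x; rewrite mul1r addrNK.
Qed.

Lemma L2t_H1perp p : L2t (norm_H1perp Om) T p ->
  ae_time T (fun t => H1perp Om (p t)).
Proof.
move=> Lp.
have N0 t : (0 <= norm_H1perp Om (p t))%E by exact: space_norm_ge0.
have := sq_integrable_finite N0 norm_H1perp_lty_sub Lp.
by apply: ae_timeS => t _ /norm_H1perp_lty.
Qed.

Lemma L2t_H1 w : L2t (norm_H1 Om) T w -> ae_time T (fun t => H1 Om (w t)).
Proof.
move=> Lw.
have N0 t : (0 <= norm_H1 Om (w t))%E by exact: space_norm_ge0.
have := sq_integrable_finite N0 norm_H1_lty_sub Lw.
by apply: ae_timeS => t _ /norm_H1_lty.
Qed.

Lemma viscous_form_ae_measurable p : L2t (norm_H1perp Om) T p ->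
  ae_measurable T (fun t => viscous_form Om (chi t) Cnu (p t)).
Proof.
move=> Lp; have Hp := L2t_H1perp Lp; have [bp _] := Lp.
pose P t v : R := if `[< H1perp Om v >] then viscous_form Om (chi t) Cnu v else 0.
have m : ae_measurable T (fun t => P t (p t)).
  apply: (bochner_comp_ae_measurable bp) => [v|].
    rewrite /P; case: asboolP => [[Hv _]|_]; last exact: measurable_cst.
    have Lv := esym_L2 oOm Hv.
    exact: (measurable_tensor_form oOm mchi chi01 Cnu Lv Lv).
  apply: ae_timeS Hp => t t0T Hpt v_ cv.
  have [nv hv] := norm_H1perp_cvg oOm Hpt cv.
  have := mxL2cvg_Rintegral oOm
    (tensor_mxL2cvg oOm (phase_measurable oOm mchi t0T)
      (fun x => chi01 t0T (x := x)) Cnu (esym_mxL2cvg oOm hv))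
    (esym_mxL2cvg oOm hv).
  exact: (guarded_cvg Hpt nv).
apply: ae_measurable_eq m; apply: ae_timeS Hp => t _ Hpt.
by rewrite /P asboolT.
Qed.

Lemma grad_form_cvg w (w_ : nat -> E -> R) :
  (forall j, L2cvg Om (fun n => wpartial Om j (w_ n)) (wpartial Om j w)) ->
  grad_form Om (w_ n) @[n --> \oo] --> grad_form Om w.
Proof.
have mOm : measurable Om by exact: open_measurable_rV.
move=> h.
pose q (v : E -> R) := \sum_j \int[lebesgue_rV d]_(x in Om)
  (wpartial Om j v x * wpartial Om j v x).
have qE v : (forall j, L2 Om (wpartial Om j v)) -> grad_form Om v = q v.
  move=> Lv; rewrite /grad_form /dotv.
  under eq_Rintegral do under eq_bigr do rewrite !mxE.
  by rewrite Rintegral_sum// => j _; exact: L2M_integrable.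
rewrite qE; last by move=> j; have [] := h j.
have cq : q (w_ n) @[n --> \oo] --> q w.
  by apply: cvg_sumr => j; apply: (L2cvg_Rintegral oOm); exact: h.
apply: cvg_trans cq; apply: near_eq_cvg.
have : \forall n \near \oo, forall j, L2 Om (wpartial Om j (w_ n)).
  by apply: filter_forall => j; have [] := h j.
by apply: filterS => n /qE.
Qed.

Lemma grad_form_ae_measurable w : L2t (norm_H1 Om) T w ->
  ae_measurable T (fun t => grad_form Om (w t)).
Proof.
move=> Lw; have Hw := L2t_H1 Lw; have [bw _] := Lw.
pose P (t : R) v : R := if `[< H1 Om v >] then grad_form Om v else 0.
have m : ae_measurable T (fun t => P t (w t)).
  apply: (bochner_comp_ae_measurable bw) => [v|]; first exact: measurable_cst.
  apply: ae_timeS Hw => t t0T Hwt v_ cv.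
  have [nv hv] := norm_H1_cvg oOm Hwt cv.
  exact: (guarded_cvg Hwt nv (grad_form_cvg hv)).
apply: ae_measurable_eq m; apply: ae_timeS Hw => t _ Hwt.
by rewrite /P asboolT.
Qed.

End square_norms_in_time.

(** * The slope inequality almost everywhere in time *)

(** In the application [tw] is the transport functional at the potential, [sy]
    the work of the viscous stress, and the other variables are the squared
    norms of the Neumann potential, of the Gibbs-Thomson potential, of the
    velocity and of the relative velocity. *)
Lemma completed_squares_le (R : realFieldType) (tw sy v2 w2 p2 y2 : R) :
  tw <= 2^-1 * v2 + 2^-1 * w2 -> - sy <= 2^-1 * p2 + 2^-1 * y2 ->
  0 <= w2 -> 0 <= p2 ->
  tw - sy - 2^-1 * v2 - 2^-1 * y2 <= w2 + p2.
Proof. lra. Qed.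

Section slope_in_time.
Context (R : realType) (d : nat).
Local Notation E := 'rV[R]_d.
Local Notation leb := (@lebesgue_measure R).
Variables (Om : set E) (Tst : R).
Variables (C Cnu : R -> {linear 'M[R]_d -> 'M[R]_d}) (Tau : R -> 'M[R]_d).
Variables (mu : R -> {measure set (E * E) -> \bar R}).
Variables (chi : R -> E -> R) (u : R -> E -> E).
Hypotheses (oOm : open Om) (bOm : bounded_set Om).
Hypotheses (hC : elastic_tensor C) (hCnu : elastic_tensor Cnu).
Hypothesis hTau : forall y, symmx (Tau y).
Hypothesis regular : sol_regularity Om Tst chi u.
Hypothesis momentum : sol_momentum Om Tst C Cnu Tau chi u.
Variable w : R -> E -> R.
Hypothesis Lw : L2t (norm_H1 Om) Tst w.
Hypothesis gibbs_thomson : sol_gibbs_thomson Om Tst C Cnu Tau mu chi u w.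

Local Notation p := (dt_u Om Tst u).
Local Notation Du := (sqnorm_dt_u Om Tst Cnu chi u).
Local Notation slope := (slope_term Om C Cnu Tau mu chi u).
Local Notation gradw t :=
  (\int[lebesgue_rV d]_(x in Om)
     (dotv (wgrad1 Om (w t) x) (wgrad1 Om (w t) x))%:E)%E.

Let mchi : measurable_fun ((`]0, Tst[%classic : set (measurableTypeR R)) `*` Om)
  (fun q : measurableTypeR R * E => chi q.1 q.2).
Proof. by have [[]] := regular. Qed.

Let chi01 t x : 0 < t < Tst -> Om x -> chi t x = 0 \/ chi t x = 1.
Proof. by have [[_ h] _ _ _ _] := regular; exact: h. Qed.

Lemma dt_u_L2t : L2t (norm_H1perp Om) Tst p.
Proof.
have [_ _ _ [_ [g Lg ug]] _] := regular.
have ex : exists g, L2t (norm_H1perp Om) Tst g /\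
  is_wderiv (norm_H1perp Om) Tst u g by exists g.
by have [] := xgetPex (fun=> 0) ex.
Qed.

Lemma u_H2v_ae : ae_time Tst (fun t => H2v Om (u t)).
Proof.
have [_ _ _ _ [_ [M uM]]] := regular.
apply: (@ae_timeS _ _ (fun t => (norm_H2v Om (u t) <= M%:E)%E)) uM => t _ h.
have : (norm_H2v Om (u t) < +oo)%E by exact: le_lt_trans h (ltry _).
by move/space_norm_lty.
Qed.

(** The exceptional times do not depend on the test fields, so that a supremum
    over these may be taken afterwards. *)
Lemma slope_le_ae : ae_time Tst (fun t =>
  [/\ H1 Om (w t), H1perp Om (p t) &
    forall B z, test_fields Om (chi t) B -> H2v Om z ->
      (slope t B z <= gradw t + Du t)%E]).
Proof.
have Hp := L2t_H1perp oOm dt_u_L2t; have Hw := L2t_H1 oOm Lw.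
have Hu := u_H2v_ae; have [bp _] := dt_u_L2t.
have [_ _ _ _ [bu _]] := regular.
have mom := momentum_at_ae_time oOm bOm mchi chi01 bu Hu bp Hp momentum.
apply: ae_timeS (ae_timeI (ae_timeI Hp Hw)
  (ae_timeI Hu (ae_timeI mom gibbs_thomson))) => t t0T.
move=> [[Hpt Hwt] [Hut [mt gtt]]]; split=> // B z HB Hz.
have [Hp1 _] := Hpt; have [CB chiB tB] := HB.
have mc := phase_measurable oOm mchi t0T.
have c01 x := chi01 (x := x) t0T.
have red := first_variation_reduced oOm bOm mc c01 hC hCnu hTau Hut Hp1 mt
  HB Hz (gtt B CB tB).
have Hy := H1v_relative_velocity oOm bOm Hut HB Hz.
have work := viscous_work_ge oOm mc c01 hCnu Hp1 Hy.
rewrite (grad_form_ereal oOm Hwt) /sqnorm_dt_u (sqnorm_chiE oOm mc c01 _ Hp1).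
rewrite /slope_term red (sqnorm_chiE oOm mc c01 _ Hy).
have gw0 := grad_form_ge0 Om (w t).
have vp0 := viscous_form_ge0 Om (chi t) hCnu (p t).
have [->|[v sv ->]] := norm_Hm1_cases Om (transport Om B (chi t)).
  rewrite expe2 mulyy gt0_muley; last by rewrite lte_fin invr_gt0.
  by rewrite /= addeNy addNye leNye.
have := transport_le oOm bOm mc c01 (Ck2_Ck1 CB) chiB Hwt sv.
rewrite -/(grad_form Om v) -/(grad_form Om (w t)) => tr.
rewrite -!EFinM -!EFinN -!EFinD lee_fin.
exact: (completed_squares_le tr work gw0 vp0).
Qed.

(** Provides the measurable summand required for subadditivity of the lower
    integral. *)
Lemma dissipation_rate_Borel : exists g : R -> R,
  [/\ measurable_fun setT g, forall t, 0 <= g t &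
      ae_time Tst (fun t => (gradw t + Du t)%E = (g t)%:E)].
Proof.
have Lp := dt_u_L2t.
have [g mg gE] := ae_measurableD (grad_form_ae_measurable oOm Lw)
  (viscous_form_ae_measurable oOm mchi chi01 Cnu Lp).
exists (fun t => Num.max (g t) 0); split.
- exact: measurable_maxr.
- by move=> t; rewrite le_max lexx orbT.
- have Hp := L2t_H1perp oOm Lp; have Hw := L2t_H1 oOm Lw.
  apply: ae_timeS (ae_timeI gE (ae_timeI Hp Hw)) => t t0T [gt [[Hp1 _] Hwt]].
  have mc := phase_measurable oOm mchi t0T.
  have c01 x := chi01 (x := x) t0T.
  rewrite (grad_form_ereal oOm Hwt) /sqnorm_dt_u (sqnorm_chiE oOm mc c01 _ Hp1).
  rewrite -EFinD gt max_l// -gt addr_ge0 ?grad_form_ge0//.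
  exact: viscous_form_ge0.
Qed.

(** The function [f] stands for the slope of a given pair of test fields, added
    to the other dissipation terms [a], or for the supremum of the slopes, with
    [a] equal to zero. *)
Lemma integral_slope_le (s T : R) (a f : R -> \bar R) : 0 <= s -> T <= Tst ->
  (forall t, 0 <= a t)%E ->
  (forall t, 0 < t < Tst ->
     (forall B z, test_fields Om (chi t) B -> H2v Om z ->
        (slope t B z <= gradw t + Du t)%E) ->
     (f t <= a t + (gradw t + Du t))%E) ->
  (\int[leb]_(t in `]s, T[) f t <=
   \int[leb]_(t in `]s, T[) a t + \int[leb]_(t in `]s, T[) (gradw t + Du t))%E.
Proof.
move=> s0 TT a0 fH; have [g [mg g0 gE]] := dissipation_rate_Borel.
apply: (@ae_le_integralD _ (measurableTypeR R) R leb `]s, T[%classic f a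
  (fun t => gradw t + Du t)%E g) => //; first exact: measurable_funTS.
have := ae_timeI slope_le_ae gE; rewrite /ae_time; apply: filterS => t h.
rewrite /= in_itv/= => /andP[st tT].
have t0T : 0 < t < Tst by rewrite (le_lt_trans s0 st) (lt_le_trans tT TT).
by have [[_ _ hs] e] := h t0T; split; [exact: e|exact: fH].
Qed.

End slope_in_time.

(** * The energy dissipation inequalities *)

Lemma dissipation_mono_le (R : realType) (a b i j k : \bar R) :
  (a + 2^-1%:E * i + 2^-1%:E * j <= b)%E -> (k <= j)%E ->
  (a + 2^-1%:E * i + 2^-1%:E * k <= b)%E.
Proof.
move=> h kj; apply: le_trans h; apply: leeD2l.
by apply: lee_wpmul2l => //; rewrite lee_fin invr_ge0.
Qed.

Lemma dissipation_sum_le (R : realType) (a b i j k : \bar R) :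
  (a + 2^-1%:E * i + 2^-1%:E * j <= b)%E -> (0 <= i)%E -> (0 <= j)%E ->
  (k <= i + j)%E -> (a + 2^-1%:E * k <= b)%E.
Proof.
move=> h i0 j0 kij; apply: le_trans h; rewrite -addeA -ge0_muleDr//.
by apply: leeD2l; apply: lee_wpmul2l; rewrite ?lee_fin ?invr_ge0.
Qed.

Theorem corollary1p6 (R : realType) (d : nat) (hd : d = 2%N \/ d = 3%N)
  (Om : set 'rV[R]_d) (hOm : smooth_bounded_domain Om)
  (Tst c0 alpha : R) (hT : 0 < Tst) (hc0 : 0 < c0)
  (halpha : 0 < alpha <= pi / 2)
  (C Cnu : R -> {linear 'M[R]_d -> 'M[R]_d}) (Tau : R -> 'M[R]_d)
  (hC : elastic_tensor C) (hCnu : elastic_tensor Cnu)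
  (hTau : forall y, symmx (Tau y))
  (chi0 : 'rV[R]_d -> R) (hchi0 : BV_char Om chi0)
  (hchi0_gt0 : 0 < \int[lebesgue_rV d]_(x in Om) chi0 x)
  (hchi0_lt :
    ((\int[lebesgue_rV d]_(x in Om) chi0 x)%:E < lebesgue_rV d Om)%E)
  (u0 : 'rV[R]_d -> 'rV[R]_d) (hu0 : H1perp Om u0 /\ H2v Om u0)
  (mu : R -> {measure set ('rV[R]_d * 'rV[R]_d) -> \bar R})
  (chi : R -> 'rV[R]_d -> R) (u : R -> 'rV[R]_d -> 'rV[R]_d)
  (hsol : varifold_solution Om Tst c0 alpha C Cnu Tau chi0 u0 mu chi u) :
  let F t := energy_at Om C Tau mu chi u t in
  let F0 := energy0 Om c0 alpha C Tau chi0 u0 in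
  let Dchi t := sqnorm_dt_chi Om Tst chi t in
  let Du t := sqnorm_dt_u Om Tst Cnu chi u t in
  let slope t B z := slope_term Om C Cnu Tau mu chi u t B z in
  ae_time_pairs Tst (fun s T =>
    forall (z B : R -> 'rV[R]_d -> 'rV[R]_d),
      bochner_measurable (norm_H2v Om) Tst z ->
      (forall t, 0 < t < Tst -> H2v Om (z t) /\ H1perp Om (z t)) ->
      sq_integrable (norm_H2v Om) Tst z ->
      bochner_measurable (norm_C2 Om) Tst B ->
      (forall t, 0 < t < Tst -> test_fields Om (chi t) (B t)) ->
      sq_integrable (norm_C2 Om) Tst B ->
      (F T + 2^-1%:E * \int[lebesgue_measure]_(t in `]s, T[)
               (Dchi t + Du t + slope t (B t) (z t)) <= F s)%E /\
      (F s <= F0)%E) /\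
  ae_time_pairs Tst (fun s T =>
      (F T + 2^-1%:E * \int[lebesgue_measure]_(t in `]s, T[) (Dchi t + Du t)
       + 2^-1%:E * \int[lebesgue_measure]_(t in `]s, T[)
           ereal_sup [set r | exists B z,
             [/\ test_fields Om (chi t) B, H1perp Om z, H2v Om z &
                 r = slope t B z]] <= F s)%E /\
      (F s <= F0)%E).
Proof.
move=> F F0 Dchi Du slope.
have [oOm _ _ bOm _] := hOm.
have [[_ reg] _ _ [w [Lw gt diss]] [_ mom _]] := hsol.
have Dchi0 t : (0 <= Dchi t)%E by rewrite /Dchi /sqnorm_dt_chi expe2 mule_ge0 ?space_norm_ge0.
have Du0 t : (0 <= Du t)%E.
  apply: integral_ge0 => x _; rewrite lee_fin.
  by apply: elastic_form_ge0 => //; exact: sympart_sym.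
have rate0 t : (0 <= \int[lebesgue_rV d]_(x in Om)
    (dotv (wgrad1 Om (w t) x) (wgrad1 Om (w t) x))%:E + Du t)%E.
  by apply: adde_ge0 => //; apply: integral_ge0 => x _; rewrite lee_fin dotv_ge0.
have bound := integral_slope_le oOm bOm hC hCnu hTau reg mom Lw gt.
split; move: diss; rewrite /sol_dissipation /ae_time_pairs; apply: filterS.
  move=> [s T] /= h s0 sT TT z B _ Hz _ _ HB _.
  have [h1 h2] := h s0 sT TT; split; last exact: h2.
  have DD t : (0 <= Dchi t + Du t)%E by exact: adde_ge0.
  apply: (dissipation_sum_le h1).
  - by apply: integral_ge0 => t _; exact: DD.
  - by apply: integral_ge0 => t _; exact: rate0.
  - apply: (bound s T) => // t t0T h'; apply: leeD2l.
    by have [Hzt _] := Hz t t0T; exact: (h' _ _ (HB t t0T) Hzt).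
move=> [s T] /= h s0 sT TT.
have [h1 h2] := h s0 sT TT; split; last exact: h2.
apply: (dissipation_mono_le h1).
have zero0 (t : R) : (0 <= (0 : \bar R))%E by [].
have := bound s T (fun=> 0%E) _ s0 TT zero0.
rewrite integral0 => bound0; rewrite -[leRHS]add0e; apply: bound0 => t t0T h'.
rewrite add0e; apply: ge_ereal_sup => _ [B [z [HB _ Hz ->]]].
exact: (h' _ _ HB Hz).
Qed.
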